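(* Fix $(r,s)\in\mathbb{C}^2\setminus\frac12\mathbb{Z}^2$ and $\tau_0\in\mathbb{H}$. Then $\wp(p_{r,s}(\tau)|\tau)$ has a pole at $\tau_0$ (equivalently $p_{r,s}(\tau_0)\in\Lambda_{\tau_0}$, equivalently $t_0=t(\tau_0)$ is a pole of $\lambda_{r,s}(t)$) if and only if either $r+s\tau_0\in\Lambda_{\tau_0}$, or $r+s\tau_0\notin\Lambda_{\tau_0}$ and $Z^{(2)}_{r,s}(\tau_0)=0$.
   Context: Notation: $\mathbb{H}$ upper half plane; $\Lambda_\tau=\mathbb{Z}+\mathbb{Z}\tau$; $\wp(z|\tau)$, $\zeta(z|\tau)$ Weierstrass functions with periods $1,\tau$; quasi-periods $\eta_1,\eta_2$ with $\zeta(z+1)=\zeta(z)+\eta_1$, $\zeta(z+\tau)=\zeta(z)+\eta_2$; $e_1=\wp(\frac12)$, $e_2=\wp(\frac\tau2)$, $e_3=\wp(\frac{1+\tau}2)$; $\wp'^2=4\wp^3-g_2\wp-g_3$; $t(\tau)=\frac{e_3-e_1}{e_2-e_1}$. For $(r,s)\in\mathbb{C}^2\setminus\frac12\mathbb{Z}^2$: $\alpha=r+s\tau$, $Z_{r,s}(\tau)=\zeta(r+s\tau|\tau)-r\eta_1(\tau)-s\eta_2(\tau)$, $Z^{(2)}_{r,s}(\tau)=Z_{r,s}(\tau)^3-3\wp(r+s\tau|\tau)Z_{r,s}(\tau)-\wp'(r+s\tau|\tau)$, and $\wp(p_{r,s}(\tau)|\tau)=\wp(\alpha)+\frac{3\wp'(\alpha)Z_{r,s}^2+(12\wp(\alpha)^2-g_2)Z_{r,s}+3\wp(\alpha)\wp'(\alpha)}{2Z^{(2)}_{r,s}(\tau)}$,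 a meromorphic function of $\tau\in\mathbb{H}$; $\lambda_{r,s}(t(\tau))=\frac{\wp(p_{r,s}(\tau)|\tau)-e_1}{e_2-e_1}$ is a solution of PVI$(\frac98,-\frac18,\frac18,\frac38)$. *)

(* Defs.v *)
From Stdlib Require Import Reals ZArith ClassicalEpsilon.
Open Scope R_scope.

Record Cplx := mkC { Re : R; Im : R }.

Definition C0 : Cplx := mkC 0 0.
Definition C1 : Cplx := mkC 1 0.
Definition RtoC (x : R) : Cplx := mkC x 0.
Definition ZtoC (k : Z) : Cplx := RtoC (IZR k).
Definition Cadd (z w : Cplx) : Cplx := mkC (Re z + Re w) (Im z + Im w).
Definition Copp (z : Cplx) : Cplx := mkC (- Re z) (- Im z).
Definition Csub (z w : Cplx) : Cplx := Cadd z (Copp w).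
Definition Cmul (z w : Cplx) : Cplx :=
  mkC (Re z * Re w - Im z * Im w) (Re z * Im w + Im z * Re w).
Definition Cnorm2 (z : Cplx) : R := Re z * Re z + Im z * Im z.
Definition Cinv (z : Cplx) : Cplx := mkC (Re z / Cnorm2 z) (- Im z / Cnorm2 z).
Definition Cdiv (z w : Cplx) : Cplx := Cmul z (Cinv w).
Definition Cabs (z : Cplx) : R := sqrt (Cnorm2 z).
Fixpoint Cpow (z : Cplx) (n : nat) : Cplx :=
  match n with O => C1 | S k => Cmul z (Cpow z k) end.
Definition Cnat (n : nat) : Cplx := RtoC (INR n).

Declare Scope C_scope.
Delimit Scope C_scope with C.
Bind Scope C_scope with Cplx.
Infix "+" := Cadd : C_scope.
Infix "-" := Csub : C_scope.
Infix "*" := Cmul : C_scope.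
Infix "/" := Cdiv : C_scope.
Notation "- z" := (Copp z) : C_scope.
Infix "^" := Cpow : C_scope.

Definition Ccv (u : nat -> Cplx) (l : Cplx) : Prop :=
  forall eps : R, eps > 0 -> exists N : nat, forall n : nat, (n >= N)%nat ->
    Cabs (Csub (u n) l) < eps.

(** The limit of a sequence (its value is unspecified if it does not converge). *)
Definition Clim (u : nat -> Cplx) : Cplx :=
  epsilon (inhabits C0) (fun l => Ccv u l).

Fixpoint Csum (n : nat) (g : nat -> Cplx) : Cplx :=
  match n with O => C0 | S k => Cadd (Csum k g) (g k) end.

Definition square_sum (N : nat) (f : Z -> Z -> Cplx) : Cplx :=
  Csum (2 * N + 1) (fun i =>
    Csum (2 * N + 1) (fun j =>
      f (Z.of_nat i - Z.of_nat N)%Z (Z.of_nat j - Z.of_nat N)%Z)).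

(** Sum over the nonzero lattice indices (m,n) <> (0,0) (all sums used below
    are absolutely convergent, so summing over expanding squares is legitimate). *)
Definition lsum' (f : Z -> Z -> Cplx) : Cplx :=
  Clim (fun N => square_sum N (fun m n =>
    if (Z.eqb m 0 && Z.eqb n 0)%bool then C0 else f m n)).

Definition lat (tau : Cplx) (m n : Z) : Cplx := Cadd (ZtoC m) (Cmul (ZtoC n) tau).

Definition in_lattice (z tau : Cplx) : Prop := exists m n : Z, z = lat tau m n.

Definition upper_half (tau : Cplx) : Prop := Im tau > 0.

Definition wp (z tau : Cplx) : Cplx :=
  (C1 / z ^ 2 + lsum' (fun m n => let w := lat tau m n in
      C1 / (z - w) ^ 2 - C1 / w ^ 2))%C.

Definition wp' (z tau : Cplx) : Cplx :=
  (Copp (RtoC 2) / z ^ 3 + lsum' (fun m n => let w := lat tau m n in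
      Copp (RtoC 2) / (z - w) ^ 3))%C.

Definition wzeta (z tau : Cplx) : Cplx :=
  (C1 / z + lsum' (fun m n => let w := lat tau m n in
      C1 / (z - w) + C1 / w + z / w ^ 2))%C.

Definition g2 (tau : Cplx) : Cplx :=
  (RtoC 60 * lsum' (fun m n => C1 / (lat tau m n) ^ 4))%C.

Definition g3 (tau : Cplx) : Cplx :=
  (RtoC 140 * lsum' (fun m n => C1 / (lat tau m n) ^ 6))%C.

(** Quasi-periods: zeta(z+1) = zeta(z) + eta1, zeta(z+tau) = zeta(z) + eta2.
    By oddness of zeta, eta1 = 2 zeta(1/2), eta2 = 2 zeta(tau/2). *)
Definition eta1 (tau : Cplx) : Cplx := (RtoC 2 * wzeta (RtoC (1/2)) tau)%C.
Definition eta2 (tau : Cplx) : Cplx := (RtoC 2 * wzeta (tau / RtoC 2) tau)%C.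

Definition alpha (r s tau : Cplx) : Cplx := (r + s * tau)%C.

Definition Zrs (r s tau : Cplx) : Cplx :=
  (wzeta (alpha r s tau) tau - r * eta1 tau - s * eta2 tau)%C.

Definition Z2rs (r s tau : Cplx) : Cplx :=
  let a := alpha r s tau in let Z := Zrs r s tau in
  (Z ^ 3 - RtoC 3 * wp a tau * Z - wp' a tau)%C.

(** wp(p_{r,s}(tau) | tau), given by the explicit formula of the paper. *)
Definition wp_p (r s tau : Cplx) : Cplx :=
  let a := alpha r s tau in let Z := Zrs r s tau in
  (wp a tau +
   (RtoC 3 * wp' a tau * Z ^ 2
    + (RtoC 12 * (wp a tau) ^ 2 - g2 tau) * Z
    + RtoC 3 * wp a tau * wp' a tau) / (RtoC 2 * Z2rs r s tau))%C.

(** Points tau of H where the formula for wp_p is literally defined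
    (alpha not a lattice point, Z2 nonzero). Elsewhere wp_p(tau) is understood
    as its meromorphic continuation. *)
Definition wp_p_dom (r s tau : Cplx) : Prop :=
  upper_half tau /\ ~ in_lattice (alpha r s tau) tau /\ Z2rs r s tau <> C0.

Definition has_pole_at (D : Cplx -> Prop) (f : Cplx -> Cplx) (tau0 : Cplx) : Prop :=
  (forall delta : R, delta > 0 ->
     exists tau, D tau /\ 0 < Cabs (Csub tau tau0) < delta) /\
  (forall M : R, exists delta : R, delta > 0 /\
     forall tau, D tau -> 0 < Cabs (Csub tau tau0) < delta ->
       M < Cabs (f tau)).

Definition in_half_Z2 (r s : Cplx) : Prop :=
  exists a b : Z, r = RtoC (IZR a / 2) /\ s = RtoC (IZR b / 2).

(* Main.v *)
(** Write [a = r + s tau] and [Z = Z_{r,s}].  While [a] is off the lattice, the numerator and the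
    denominator of the formula for [wp_p] are holomorphic in [tau], so a pole forces [Z2 = 0].
    Conversely, when [Z2 = 0] one may substitute [wp' = Z^3 - 3 wp Z]: the numerator becomes
    [Z (3 (Z^2 - wp)^2 - g2)].  If [Z = 0] then [wp' = 0], so [a] is a half-period, and
    [eta1 tau - eta2 <> 0] puts [(r, s)] in [(1/2) Z^2]; if [g2 = 3 (Z^2 - wp)^2] the discriminant
    vanishes.  So the numerator is nonzero, and the heat equation shows that it is proportional to
    the [tau]-derivative of [Z2] at that point: the zero of [Z2] is isolated and gives a pole.
    When [a] tends to [0] one finds [a Z2 -> 3 c^2] and [a^2 (2 Z2 wp + numerator) -> 2 c^3] with
    [c = s (eta1 tau - eta2)], hence [wp_p ~ c / (3 a)].

    The classical facts come directly from the lattice sums.  The increments of [zeta] over square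
    partial sums telescope to a Riemann sum of [dw / w], which gives [eta1 tau - eta2 <> 0].
    Liouville's theorem for elliptic functions follows from circle means: the first Fourier
    coefficient [K r] of a holomorphic function on the circle of radius [r] satisfies [r K' = K].
    It yields [wp'' = 6 wp^2 - g2 / 2] and a formula for the [tau]-derivative of [wp]. *)

From Coquelicot Require Complex.
From Coquelicot Require Import Rcomplements Hierarchy Continuity Derive RInt RInt_analysis.
From Stdlib Require Import Reals ZArith Psatz Classical ClassicalEpsilon FunctionalExtensionality List.
Require Import Defs.
Open Scope R_scope.
Open Scope C_scope.

(** A pole asks for two things: the domain of the formula accumulates at the point, and the values
    grow there. Hence at a zero of [Z2] the converse must also show that [Z2] does not vanish
    nearby, which is why its derivative is computed. The quantity [eta1 tau * tau - eta2 tau],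
    called [kappa tau], enters only as a factor to be cancelled. A lower bound, uniform in the size
    of the square, on the imaginary part of the Riemann sums therefore suffices, with no integral to
    evaluate. That [kappa] is constant in [tau] comes out of the heat equation. Functions of
    [(z, tau)] are differentiated along all complex lines, because both [r + s tau] and the period
    [tau] make the two variables move together. In Liouville's theorem the function is known to be
    differentiable only off the lattice, and merely continuous on it. The circle mean can thus be
    differentiated only at radii whose circle misses the lattice; finitely many radii fail in a
    bounded range, and continuity carries [K r / r] across them. *)

(** * Field structure and modulus of the complex numbers *)

Lemma Cplx_eq (z w : Cplx) : Re z = Re w -> Im z = Im w -> z = w.
Proof. destruct z, w; simpl; intros -> ->; reflexivity. Qed.

Lemma Cnorm2_eq0 (z : Cplx) : Cnorm2 z = 0%R -> z = C0.
Proof. destruct z as [x y]; unfold Cnorm2; simpl; intros H; apply Cplx_eq; simpl; nra. Qed.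

Lemma Cplx_ring_theory : ring_theory C0 C1 Cadd Cmul Csub Copp (@eq Cplx).
Proof. constructor; intros; apply Cplx_eq; simpl; ring. Qed.

Lemma C1_neq_C0 : C1 <> C0.
Proof. intros H; injection H; lra. Qed.

Lemma Cplx_field_theory : field_theory C0 C1 Cadd Cmul Csub Copp Cdiv Cinv (@eq Cplx).
Proof.
  constructor; [apply Cplx_ring_theory | apply C1_neq_C0 | reflexivity |].
  intros p Hp; assert (Cnorm2 p <> 0%R) by (intros H; apply Hp, Cnorm2_eq0, H).
  destruct p as [x y]; unfold Cnorm2 in *; simpl in *.
  apply Cplx_eq; unfold Cinv, Cnorm2; simpl; field; assumption.
Qed.

Lemma Cplx_power_theory : power_theory C1 Cmul (@eq Cplx) N.to_nat Cpow.
Proof.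
  constructor; intros r n; destruct n as [|p]; [reflexivity|].
  simpl; induction p using Pos.peano_ind.
  - apply Cplx_eq; simpl; ring.
  - rewrite Pos2Nat.inj_succ; simpl; rewrite IHp.
    symmetry; apply pow_pos_succ;
      [split; red; congruence | red; red; congruence | apply Cplx_ring_theory].
Qed.

(** Lets [ring] and [field] compute with literals such as [RtoC 60], which are convertible to values
    of [ZtoC]. *)
Lemma ZtoC_morph : ring_morph C0 C1 Cadd Cmul Csub Copp (@eq Cplx)
  0%Z 1%Z Z.add Z.mul Z.sub Z.opp Zeq_bool ZtoC.
Proof.
  constructor; try reflexivity; intros; unfold ZtoC, RtoC; try (apply Cplx_eq; simpl).
  all: try rewrite plus_IZR; try rewrite mult_IZR; try rewrite minus_IZR; try rewrite opp_IZR; try ring.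
  all: apply Zeq_bool_eq in H; subst; reflexivity.
Qed.

Ltac Cplx_cst t :=
  match t with
  | C0 => constr:(0%Z) | C1 => constr:(1%Z)
  | RtoC ?r => IZR_tac_aux r
  | ZtoC ?z => match isZcst z with true => z | _ => constr:(NotConstant) end
  | _ => constr:(NotConstant) end
with IZR_tac_aux r :=
  match r with
  | IZR ?z => match isZcst z with true => z | _ => constr:(NotConstant) end
  | _ => constr:(NotConstant) end.

Ltac Cpow_tac t := match isnatcst t with true => constr:(N.of_nat t) | _ => constr:(InitialRing.NotConstant) end.
Add Field Cplx_field : Cplx_field_theory
  (morphism ZtoC_morph, constants [Cplx_cst], power_tac Cplx_power_theory [Cpow_tac]).

Lemma RtoC_neq0 (x : R) : x <> 0%R -> RtoC x <> C0.
Proof. intros H E; injection E; exact H. Qed.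

Ltac cside := repeat split; try assumption; try exact C1_neq_C0; try (apply RtoC_neq0; lra).
Ltac cfield := field; cside.

Lemma Cabs_ge0 (z : Cplx) : 0 <= Cabs z.
Proof. apply sqrt_pos. Qed.

Lemma Cnorm2_ge0 (z : Cplx) : 0 <= Cnorm2 z.
Proof. unfold Cnorm2; nra. Qed.

Lemma Cabs_sqr (z : Cplx) : (Cabs z * Cabs z = Cnorm2 z)%R.
Proof. apply sqrt_sqrt, Cnorm2_ge0. Qed.

Lemma Cabs_mul (z w : Cplx) : Cabs (z * w) = (Cabs z * Cabs w)%R.
Proof.
  unfold Cabs; rewrite <- sqrt_mult by apply Cnorm2_ge0.
  f_equal; unfold Cnorm2; simpl; ring.
Qed.

Lemma Cabs_triang (z w : Cplx) : Cabs (z + w) <= Cabs z + Cabs w.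
Proof.
  assert (H : forall u, Cabs u = Complex.Cmod (Re u, Im u)).
  { intros u; unfold Cabs, Complex.Cmod, Cnorm2; simpl; f_equal; ring. }
  rewrite !H; exact (Complex.Cmod_triangle (Re z, Im z) (Re w, Im w)).
Qed.

Lemma Cabs_opp (z : Cplx) : Cabs (- z) = Cabs z.
Proof. unfold Cabs, Cnorm2; f_equal; simpl; ring. Qed.

Lemma Cabs_sub_sym (z w : Cplx) : Cabs (z - w) = Cabs (w - z).
Proof. rewrite <- Cabs_opp; f_equal; ring. Qed.

Lemma Cabs_sub_triang (z w : Cplx) : Cabs (z - w) <= Cabs z + Cabs w.
Proof. unfold Csub; rewrite <- (Cabs_opp w); apply Cabs_triang. Qed.

Lemma Cabs_sub_ge (z w : Cplx) : Cabs z - Cabs w <= Cabs (z - w).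
Proof.
  generalize (Cabs_triang (z - w) w); replace (z - w + w) with z by ring; lra.
Qed.

Lemma Cabs_add_ge (z w : Cplx) : Cabs z - Cabs w <= Cabs (z + w).
Proof.
  rewrite <- (Cabs_opp w); replace (z + w) with (z - (- w)) by ring; apply Cabs_sub_ge.
Qed.

Lemma Cabs_RtoC (x : R) : Cabs (RtoC x) = Rabs x.
Proof.
  unfold Cabs, Cnorm2; simpl; replace (x * x + 0 * 0)%R with (x * x)%R by ring.
  apply sqrt_Rsqr_abs.
Qed.

Lemma Cabs_C0 : Cabs C0 = 0%R.
Proof. change C0 with (RtoC 0); rewrite Cabs_RtoC; apply Rabs_R0. Qed.

Lemma Cabs_C1 : Cabs C1 = 1%R.
Proof. change C1 with (RtoC 1); rewrite Cabs_RtoC; apply Rabs_R1. Qed.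

Lemma Cabs_eq0 (z : Cplx) : Cabs z = 0%R -> z = C0.
Proof. intros H; apply Cnorm2_eq0; rewrite <- Cabs_sqr, H; ring. Qed.

Lemma Cabs_gt0 (z : Cplx) : z <> C0 -> 0 < Cabs z.
Proof.
  intros H; destruct (Cabs_ge0 z) as [|E]; [assumption | symmetry in E; apply Cabs_eq0 in E; tauto].
Qed.

Lemma Cabs_gt0_neq (z : Cplx) : 0 < Cabs z -> z <> C0.
Proof. intros H ->; rewrite Cabs_C0 in H; lra. Qed.

Lemma Cabs_inv (z : Cplx) : z <> C0 -> Cabs (C1 / z) = (/ Cabs z)%R.
Proof.
  intros H; assert (P := Cabs_gt0 z H).
  apply Rmult_eq_reg_r with (Cabs z); [|lra].
  rewrite <- Cabs_mul; replace (C1 / z * z) with C1 by (field; assumption).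
  rewrite Cabs_C1; field; lra.
Qed.

Lemma Cabs_div (z w : Cplx) : w <> C0 -> Cabs (z / w) = (Cabs z / Cabs w)%R.
Proof.
  intros H; replace (z / w) with (z * (C1 / w)) by (field; assumption).
  rewrite Cabs_mul, Cabs_inv by assumption; reflexivity.
Qed.

Lemma Re_le_Cabs (z : Cplx) : Rabs (Re z) <= Cabs z.
Proof.
  rewrite <- sqrt_Rsqr_abs; apply sqrt_le_1_alt; unfold Cnorm2, Rsqr; nra.
Qed.

Lemma Im_le_Cabs (z : Cplx) : Rabs (Im z) <= Cabs z.
Proof.
  rewrite <- sqrt_Rsqr_abs; apply sqrt_le_1_alt; unfold Cnorm2, Rsqr; nra.
Qed.

Lemma Cabs_le_ReIm (z : Cplx) : Cabs z <= Rabs (Re z) + Rabs (Im z).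
Proof.
  replace z with (mkC (Re z) 0 + mkC 0 (Im z)) at 1 by (apply Cplx_eq; simpl; ring).
  eapply Rle_trans; [apply Cabs_triang|]; apply Rplus_le_compat.
  - change (mkC (Re z) 0) with (RtoC (Re z)); rewrite Cabs_RtoC; lra.
  - unfold Cabs, Cnorm2; simpl; replace (0 * 0 + Im z * Im z)%R with (Rsqr (Im z)) by (unfold Rsqr; ring).
    rewrite sqrt_Rsqr_abs; lra.
Qed.

Lemma Csub_neq0 (z w : Cplx) : z <> w -> z - w <> C0.
Proof. intros H E; apply H; replace z with (z - w + w) by ring; rewrite E; ring. Qed.

Lemma Csub_eq0 (z w : Cplx) : z - w = C0 -> z = w.
Proof. intros E; replace z with (z - w + w) by ring; rewrite E; ring. Qed.

Lemma Cmul_neq0 (z w : Cplx) : z <> C0 -> w <> C0 -> z * w <> C0.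
Proof.
  intros Hz Hw; apply Cabs_gt0_neq; rewrite Cabs_mul.
  apply Rmult_lt_0_compat; apply Cabs_gt0; assumption.
Qed.

Lemma Cmul_eq0 (z w : Cplx) : z * w = C0 -> z = C0 \/ w = C0.
Proof.
  intros H; destruct (classic (z = C0)); [tauto|]; destruct (classic (w = C0)); [tauto|].
  exfalso; revert H; apply Cmul_neq0; assumption.
Qed.

Lemma Cpow_neq0 (z : Cplx) (n : nat) : z <> C0 -> z ^ n <> C0.
Proof.
  intros H; induction n; simpl; [apply C1_neq_C0 | apply Cmul_neq0; assumption].
Qed.

Lemma lt_Rmin_l (x a b : R) : x < Rmin a b -> x < a.
Proof. generalize (Rmin_l a b); lra. Qed.

Lemma lt_Rmin_r (x a b : R) : x < Rmin a b -> x < b.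
Proof. generalize (Rmin_r a b); lra. Qed.

(** * Limits and complex derivatives *)

Definition Clim_at (f : Cplx -> Cplx) (z l : Cplx) : Prop :=
  forall eps : R, 0 < eps -> exists del : R, 0 < del /\
    forall w, 0 < Cabs (w - z) < del -> Cabs (f w - l) < eps.

(** The centre is included, unlike in [Clim_at]; punctured statements carry the premise [w <> z]
    inside [P], so that one intersection lemma serves both kinds. *)
Definition near (z : Cplx) (P : Cplx -> Prop) : Prop :=
  exists del : R, 0 < del /\ forall w, Cabs (w - z) < del -> P w.

Lemma near_and (z : Cplx) (P Q : Cplx -> Prop) :
  near z P -> near z Q -> near z (fun w => P w /\ Q w).
Proof.
  intros [d [Hd H]] [e [He G]]; exists (Rmin d e); split; [apply Rmin_pos; assumption|].
  intros w Hw; split; [apply H | apply G]; eapply Rlt_le_trans; try apply Hw;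
    [apply Rmin_l | apply Rmin_r].
Qed.

Lemma near_imp (z : Cplx) (P Q : Cplx -> Prop) :
  (forall w, P w -> Q w) -> near z P -> near z Q.
Proof. intros I [d [Hd H]]; exists d; split; auto. Qed.

Lemma near_pt (z : Cplx) (P : Cplx -> Prop) : near z P -> P z.
Proof. intros [d [Hd H]]; apply H; replace (z - z) with C0 by ring; rewrite Cabs_C0; lra. Qed.

Lemma Clim_at_near (f : Cplx -> Cplx) (z l : Cplx) (eps : R) :
  Clim_at f z l -> 0 < eps -> near z (fun w => w <> z -> Cabs (f w - l) < eps).
Proof.
  intros H He; destruct (H eps He) as [d [Hd G]]; exists d; split; [assumption|].
  intros w Hw N; apply G; split; [apply Cabs_gt0, Csub_neq0, N | assumption].
Qed.

Lemma near_Clim_at (f : Cplx -> Cplx) (z l : Cplx) :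
  (forall eps, 0 < eps -> near z (fun w => w <> z -> Cabs (f w - l) < eps)) -> Clim_at f z l.
Proof.
  intros H e He; destruct (H e He) as [d [Hd G]]; exists d; split; [assumption|].
  intros w [Hw1 Hw2]; apply G; [assumption|].
  intros ->; revert Hw1; replace (z - z) with C0 by ring; rewrite Cabs_C0; lra.
Qed.

Lemma Clim_at_ext (f g : Cplx -> Cplx) (z l : Cplx) :
  near z (fun w => w <> z -> f w = g w) -> Clim_at f z l -> Clim_at g z l.
Proof.
  intros E H; apply near_Clim_at; intros e He.
  generalize (near_and _ _ _ E (Clim_at_near _ _ _ _ H He)).
  apply near_imp; intros w [H1 H2] N; rewrite <- H1; auto.
Qed.

Lemma near_true (z : Cplx) (P : Cplx -> Prop) : (forall w, P w) -> near z P.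
Proof. intros H; exists 1%R; split; [lra | auto]. Qed.

Lemma near_ball (z : Cplx) (d : R) : 0 < d -> near z (fun w => Cabs (w - z) < d).
Proof. intros H; exists d; auto. Qed.

Lemma Clim_at_const (c z : Cplx) : Clim_at (fun _ => c) z c.
Proof.
  intros e He; exists 1%R; split; [lra|]; intros.
  replace (c - c) with C0 by ring; rewrite Cabs_C0; assumption.
Qed.

Lemma Clim_at_id (z : Cplx) : Clim_at (fun w => w) z z.
Proof. intros e He; exists e; split; [assumption|]; intros w [_ H]; exact H. Qed.

Lemma Clim_at_plus (f g : Cplx -> Cplx) (z l m : Cplx) :
  Clim_at f z l -> Clim_at g z m -> Clim_at (fun w => f w + g w) z (l + m).
Proof.
  intros Hf Hg; apply near_Clim_at; intros e He.
  assert (He2 : 0 < e / 2) by lra.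
  generalize (near_and _ _ _ (Clim_at_near _ _ _ _ Hf He2) (Clim_at_near _ _ _ _ Hg He2)).
  apply near_imp; intros w [H1 H2] N.
  replace (f w + g w - (l + m)) with ((f w - l) + (g w - m)) by ring.
  generalize (Cabs_triang (f w - l) (g w - m)) (H1 N) (H2 N); lra.
Qed.

Lemma Clim_at_mult (f g : Cplx -> Cplx) (z l m : Cplx) :
  Clim_at f z l -> Clim_at g z m -> Clim_at (fun w => f w * g w) z (l * m).
Proof.
  intros Hf Hg; apply near_Clim_at; intros e He.
  (* With both errors below [d <= 1], the product error is at most
     [d * d + d * (Cabs l + Cabs m) <= d * K]. *)
  set (K := (Cabs l + Cabs m + 1)%R).
  assert (PK : 0 < K) by (unfold K; generalize (Cabs_ge0 l) (Cabs_ge0 m); lra).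
  set (d := Rmin 1 (e / (2 * K))).
  assert (Hd : 0 < d) by (apply Rmin_pos; [lra | apply Rdiv_lt_0_compat; lra]).
  assert (Hd1 : d <= 1) by apply Rmin_l.
  assert (Hd2 : d * (2 * K) <= e).
  { generalize (Rmin_r 1 (e / (2 * K))); fold d; intros H.
    apply Rmult_le_compat_r with (r := (2 * K)%R) in H; [|lra].
    replace (e / (2 * K) * (2 * K))%R with e in H by (field; lra); exact H. }
  generalize (near_and _ _ _ (Clim_at_near _ _ _ _ Hf Hd) (Clim_at_near _ _ _ _ Hg Hd)).
  apply near_imp; intros w [H1 H2] N; specialize (H1 N); specialize (H2 N).
  replace (f w * g w - l * m) with ((f w - l) * (g w - m) + ((f w - l) * m + l * (g w - m))) by ring.
  eapply Rle_lt_trans; [apply Cabs_triang|].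
  eapply Rle_lt_trans; [apply Rplus_le_compat_l, Cabs_triang|].
  rewrite !Cabs_mul.
  generalize (Cabs_ge0 (f w - l)) (Cabs_ge0 (g w - m)) (Cabs_ge0 l) (Cabs_ge0 m); intros.
  unfold K in *; nra.
Qed.

Lemma Clim_at_opp (f : Cplx -> Cplx) (z l : Cplx) :
  Clim_at f z l -> Clim_at (fun w => - f w) z (- l).
Proof.
  intros H e He; destruct (H e He) as [d [Hd G]]; exists d; split; [assumption|].
  intros w Hw; replace (- f w - - l) with (- (f w - l)) by ring; rewrite Cabs_opp; auto.
Qed.

Lemma Clim_at_minus (f g : Cplx -> Cplx) (z l m : Cplx) :
  Clim_at f z l -> Clim_at g z m -> Clim_at (fun w => f w - g w) z (l - m).
Proof. intros Hf Hg; apply (Clim_at_plus f (fun w => - g w)); [|apply Clim_at_opp]; assumption. Qed.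

Lemma Clim_at_neq0 (f : Cplx -> Cplx) (z l : Cplx) :
  Clim_at f z l -> l <> C0 -> near z (fun w => w <> z -> Cabs l / 2 < Cabs (f w)).
Proof.
  intros H N; assert (P := Cabs_gt0 l N).
  generalize (Clim_at_near _ _ _ (Cabs l / 2) H ltac:(lra)); apply near_imp; intros w Hw Nw.
  specialize (Hw Nw); rewrite Cabs_sub_sym in Hw.
  generalize (Cabs_sub_triang (l - f w) (- f w)); replace (l - f w - - f w) with l by ring.
  rewrite Cabs_opp; lra.
Qed.

Lemma Clim_at_inv (f : Cplx -> Cplx) (z l : Cplx) :
  Clim_at f z l -> l <> C0 -> Clim_at (fun w => C1 / f w) z (C1 / l).
Proof.
  intros H N; apply near_Clim_at; intros e He.
  assert (P := Cabs_gt0 l N).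
  assert (Q : 0 < e * (Cabs l * Cabs l) / 2) by (assert (0 < e * (Cabs l * Cabs l)) by (repeat apply Rmult_lt_0_compat; assumption); lra).
  generalize (near_and _ _ _ (Clim_at_neq0 _ _ _ H N) (Clim_at_near _ _ _ _ H Q)).
  apply near_imp; intros w [H1 H2] Nw; specialize (H1 Nw); specialize (H2 Nw).
  assert (N2 : f w <> C0) by (apply Cabs_gt0_neq; lra).
  replace (C1 / f w - C1 / l) with (- ((f w - l) / (f w * l))) by (field; split; assumption).
  rewrite Cabs_opp, Cabs_div by (apply Cmul_neq0; assumption); rewrite Cabs_mul.
  apply Rmult_lt_reg_r with (Cabs (f w) * Cabs l)%R; [nra|].
  unfold Rdiv; rewrite Rmult_assoc, Rinv_l by nra; nra.
Qed.

Lemma Clim_at_unique (f : Cplx -> Cplx) (z l m : Cplx) :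
  Clim_at f z l -> Clim_at f z m -> l = m.
Proof.
  intros Hl Hm; apply NNPP; intros N; assert (P := Cabs_gt0 _ (Csub_neq0 _ _ N)).
  destruct (near_and _ _ _ (Clim_at_near _ _ _ (Cabs (l - m) / 2) Hl ltac:(lra))
    (Clim_at_near _ _ _ (Cabs (l - m) / 2) Hm ltac:(lra))) as [d [Hd G]].
  assert (E : Cabs (z + RtoC (d / 2) - z) = (d / 2)%R).
  { replace (z + RtoC (d / 2) - z) with (RtoC (d / 2)) by ring.
    rewrite Cabs_RtoC, Rabs_pos_eq; lra. }
  destruct (G (z + RtoC (d / 2))) as [G1 G2]; [lra|].
  assert (Nz : z + RtoC (d / 2) <> z).
  { intros Ez; rewrite Ez in E; revert E; replace (z - z) with C0 by ring; rewrite Cabs_C0; lra. }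
  specialize (G1 Nz); specialize (G2 Nz); rewrite Cabs_sub_sym in G1.
  generalize (Cabs_triang (l - f (z + RtoC (d/2))) (f (z + RtoC (d/2)) - m)).
  replace (l - f (z + RtoC (d / 2)) + (f (z + RtoC (d / 2)) - m)) with (l - m) by ring; lra.
Qed.

Definition Ccont (f : Cplx -> Cplx) (z : Cplx) : Prop := Clim_at f z (f z).

Definition Cder (f : Cplx -> Cplx) (z l : Cplx) : Prop :=
  Clim_at (fun w => (f w - f z) / (w - z)) z l.

Lemma Cder_unique (f : Cplx -> Cplx) (z l m : Cplx) : Cder f z l -> Cder f z m -> l = m.
Proof. apply Clim_at_unique. Qed.

Lemma Cder_ext (f g : Cplx -> Cplx) (z l : Cplx) :
  near z (fun w => f w = g w) -> Cder f z l -> Cder g z l.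
Proof.
  intros E; assert (Ez := near_pt _ _ E); apply Clim_at_ext; revert E; apply near_imp.
  intros w -> _; rewrite Ez; reflexivity.
Qed.

Lemma near_neq (z : Cplx) (P : Cplx -> Prop) :
  (forall w, w - z <> C0 -> P w) -> near z (fun w => w <> z -> P w).
Proof. intros H; apply near_true; intros w N; apply H, Csub_neq0, N. Qed.

Lemma Cder_cont (f : Cplx -> Cplx) (z l : Cplx) : Cder f z l -> Ccont f z.
Proof.
  intros H; unfold Ccont.
  replace (f z) with (f z + l * (z - z)) by ring.
  apply Clim_at_ext with (fun w => f z + (f w - f z) / (w - z) * (w - z)).
  - apply near_neq; intros w N; field; exact N.
  - apply Clim_at_plus; [apply Clim_at_const|].
    apply Clim_at_mult; [exact H|].
    apply Clim_at_minus; [apply Clim_at_id | apply Clim_at_const].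
Qed.

Lemma Cder_const (c z : Cplx) : Cder (fun _ => c) z C0.
Proof.
  apply Clim_at_ext with (fun _ => C0); [|apply Clim_at_const].
  apply near_neq; intros w N; field; exact N.
Qed.

Lemma Cder_id (z : Cplx) : Cder (fun w => w) z C1.
Proof.
  apply Clim_at_ext with (fun _ => C1); [|apply Clim_at_const].
  apply near_neq; intros w N; field; exact N.
Qed.

Lemma Cder_plus (f g : Cplx -> Cplx) (z l m : Cplx) :
  Cder f z l -> Cder g z m -> Cder (fun w => f w + g w) z (l + m).
Proof.
  intros Hf Hg; eapply Clim_at_ext; [|apply Clim_at_plus; [exact Hf | exact Hg]].
  apply near_neq; intros w N; simpl; field; exact N.
Qed.

Lemma Cder_minus (f g : Cplx -> Cplx) (z l m : Cplx) :
  Cder f z l -> Cder g z m -> Cder (fun w => f w - g w) z (l - m).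
Proof.
  intros Hf Hg; eapply Clim_at_ext; [|apply Clim_at_minus; [exact Hf | exact Hg]].
  apply near_neq; intros w N; simpl; field; exact N.
Qed.

Lemma Cder_opp (f : Cplx -> Cplx) (z l : Cplx) :
  Cder f z l -> Cder (fun w => - f w) z (- l).
Proof.
  intros Hf; eapply Clim_at_ext; [|apply Clim_at_opp; exact Hf].
  apply near_neq; intros w N; simpl; field; exact N.
Qed.

Lemma Cder_mult (f g : Cplx -> Cplx) (z l m : Cplx) :
  Cder f z l -> Cder g z m -> Cder (fun w => f w * g w) z (l * g z + f z * m).
Proof.
  intros Hf Hg.
  eapply Clim_at_ext; [|apply Clim_at_plus; apply Clim_at_mult;
    [exact Hf | apply (Cder_cont _ _ _ Hg) | apply Clim_at_const | exact Hg]].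
  apply near_neq; intros w N; simpl; field; exact N.
Qed.

Lemma Ccont_neq0 (f : Cplx -> Cplx) (z : Cplx) :
  Ccont f z -> f z <> C0 -> near z (fun w => f w <> C0).
Proof.
  intros H N; generalize (Clim_at_neq0 _ _ _ H N); apply near_imp; intros w Hw.
  destruct (classic (w = z)) as [-> | Nw]; [assumption|].
  apply Cabs_gt0_neq; specialize (Hw Nw); generalize (Cabs_ge0 (f z)); lra.
Qed.

Lemma Cder_inv (f : Cplx -> Cplx) (z l : Cplx) :
  Cder f z l -> f z <> C0 -> Cder (fun w => C1 / f w) z (- l / (f z * f z)).
Proof.
  intros Hf Nf.
  replace (- l / (f z * f z)) with (- (l * ((C1 / f z) * (C1 / f z)))) by (field; assumption).
  eapply Clim_at_ext; [|apply Clim_at_opp, Clim_at_mult;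
    [exact Hf | apply Clim_at_mult; [apply Clim_at_inv; [apply (Cder_cont _ _ _ Hf)|assumption] | apply Clim_at_const]]].
  generalize (Ccont_neq0 _ _ (Cder_cont _ _ _ Hf) Nf); apply near_imp; intros w H Nw.
  assert (w - z <> C0) by (apply Csub_neq0, Nw); simpl; field; repeat split; assumption.
Qed.

Lemma Cder_div (f g : Cplx -> Cplx) (z l m : Cplx) :
  Cder f z l -> Cder g z m -> g z <> C0 ->
  Cder (fun w => f w / g w) z ((l * g z - f z * m) / (g z * g z)).
Proof.
  intros Hf Hg N.
  replace ((l * g z - f z * m) / (g z * g z)) with (l * (C1 / g z) + f z * (- m / (g z * g z))) by (field; assumption).
  eapply Cder_ext; [|exact (Cder_mult _ _ _ _ _ Hf (Cder_inv _ _ _ Hg N))].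
  generalize (Ccont_neq0 _ _ (Cder_cont _ _ _ Hg) N); apply near_imp; intros w H; simpl; field; assumption.
Qed.

Lemma Cder_eq (f : Cplx -> Cplx) (z l m : Cplx) : Cder f z l -> l = m -> Cder f z m.
Proof. intros H <-; exact H. Qed.

(** The form in which lattice sums deliver derivatives: quadratic remainders can be added term by
    term once their constants are summable. *)
Lemma Cder_quadratic (f : Cplx -> Cplx) (z l : Cplx) (K : R) :
  near z (fun w => Cabs (f w - f z - (w - z) * l) <= K * (Cabs (w - z) * Cabs (w - z))) ->
  Cder f z l.
Proof.
  intros H; apply near_Clim_at; intros e He.
  set (d := (e / (Rabs K + 1))%R).
  assert (PK := Rabs_pos K).
  assert (Hd : 0 < d) by (apply Rdiv_lt_0_compat; lra).
  assert (Ed : (d * (Rabs K + 1) = e)%R) by (unfold d; field; lra).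
  generalize (near_and _ _ _ (near_ball z d Hd) H); apply near_imp; intros w [H1 H2] N.
  assert (N2 := Csub_neq0 _ _ N); assert (P := Cabs_gt0 _ N2).
  replace ((f w - f z) / (w - z) - l) with ((f w - f z - (w - z) * l) / (w - z)) by (field; assumption).
  rewrite Cabs_div by assumption.
  apply Rmult_lt_reg_r with (Cabs (w - z)); [assumption|].
  unfold Rdiv; rewrite Rmult_assoc, Rinv_l by lra; rewrite Rmult_1_r.
  eapply Rle_lt_trans; [exact H2|].
  assert (K <= Rabs K) by apply Rle_abs.
  rewrite <- Ed; generalize dependent (Cabs (w - z)); intros x; intros.
  assert (K * x <= Rabs K * x) by (apply Rmult_le_compat_r; lra).
  rewrite <- Rmult_assoc; apply Rmult_lt_compat_r; [assumption|]; nra.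
Qed.

(** Multiplied out, the estimate covers [w = z] too, as the chain rule requires: a curve may return
    to its starting value. *)
Lemma Cder_linear (f : Cplx -> Cplx) (z l : Cplx) (eps : R) :
  Cder f z l -> 0 < eps ->
  near z (fun w => Cabs (f w - f z - (w - z) * l) <= eps * Cabs (w - z)).
Proof.
  intros H He; generalize (Clim_at_near _ _ _ _ H He); apply near_imp; intros w Hw.
  destruct (classic (w = z)) as [-> | N].
  - replace (f z - f z - (z - z) * l) with C0 by ring; replace (z - z) with C0 by ring.
    rewrite Cabs_C0; lra.
  - specialize (Hw N); assert (N2 := Csub_neq0 _ _ N).
    replace (f w - f z - (w - z) * l) with (((f w - f z) / (w - z) - l) * (w - z)) by (field; assumption).
    rewrite Cabs_mul; apply Rmult_le_compat_r; [apply Cabs_ge0 | lra].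
Qed.

(** * Convergence of sequences *)

Lemma Ccv_unique (u : nat -> Cplx) (l m : Cplx) : Ccv u l -> Ccv u m -> l = m.
Proof.
  intros Hl Hm; apply NNPP; intros N; assert (P := Cabs_gt0 _ (Csub_neq0 _ _ N)).
  destruct (Hl (Cabs (l - m) / 2)%R ltac:(lra)) as [N1 H1].
  destruct (Hm (Cabs (l - m) / 2)%R ltac:(lra)) as [N2 H2].
  specialize (H1 (N1 + N2)%nat ltac:(lia)); specialize (H2 (N1 + N2)%nat ltac:(lia)).
  rewrite Cabs_sub_sym in H1; generalize (Cabs_triang (l - u (N1 + N2)%nat) (u (N1 + N2)%nat - m)).
  replace (l - u (N1 + N2)%nat + (u (N1 + N2)%nat - m)) with (l - m) by ring; lra.
Qed.

Lemma Clim_eq (u : nat -> Cplx) (l : Cplx) : Ccv u l -> Clim u = l.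
Proof.
  intros H; apply (Ccv_unique u); [|exact H].
  unfold Clim; apply epsilon_spec; exists l; exact H.
Qed.

Lemma Ccv_ext (u v : nat -> Cplx) (l : Cplx) : (forall n, u n = v n) -> Ccv u l -> Ccv v l.
Proof. intros E H e He; destruct (H e He) as [N G]; exists N; intros n Hn; rewrite <- E; auto. Qed.

Lemma Ccv_const (c : Cplx) : Ccv (fun _ => c) c.
Proof. intros e He; exists 0%nat; intros; replace (c - c) with C0 by ring; rewrite Cabs_C0; lra. Qed.

Lemma Ccv_plus (u v : nat -> Cplx) (l m : Cplx) :
  Ccv u l -> Ccv v m -> Ccv (fun n => u n + v n) (l + m).
Proof.
  intros Hu Hv e He; destruct (Hu (e / 2)%R ltac:(lra)) as [N1 H1].
  destruct (Hv (e / 2)%R ltac:(lra)) as [N2 H2]; exists (N1 + N2)%nat; intros n Hn.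
  specialize (H1 n ltac:(lia)); specialize (H2 n ltac:(lia)).
  replace (u n + v n - (l + m)) with ((u n - l) + (v n - m)) by ring.
  generalize (Cabs_triang (u n - l) (v n - m)); lra.
Qed.

Lemma Ccv_scal (c : Cplx) (u : nat -> Cplx) (l : Cplx) :
  Ccv u l -> Ccv (fun n => c * u n) (c * l).
Proof.
  intros H e He; assert (P := Cabs_ge0 c).
  destruct (H (e / (Cabs c + 1))%R) as [N G]; [apply Rlt_gt, Rdiv_lt_0_compat; lra|].
  exists N; intros n Hn; specialize (G n Hn).
  replace (c * u n - c * l) with (c * (u n - l)) by ring; rewrite Cabs_mul.
  apply Rmult_lt_compat_l with (r := (Cabs c + 1)%R) in G; [|lra].
  replace ((Cabs c + 1) * (e / (Cabs c + 1)))%R with e in G by (field; lra).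
  generalize (Cabs_ge0 (u n - l)); nra.
Qed.

Lemma Ccv_bound (u : nat -> Cplx) (l : Cplx) (K : R) :
  Ccv u l -> (forall n, Cabs (u n) <= K) -> Cabs l <= K.
Proof.
  intros H B; apply Rnot_lt_le; intros L.
  destruct (H (Cabs l - K)%R ltac:(lra)) as [N G]; specialize (G N ltac:(lia)); specialize (B N).
  rewrite Cabs_sub_sym in G; generalize (Cabs_sub_ge l (u N)); lra.
Qed.

Lemma Ccv_squeeze (u : nat -> Cplx) (l : Cplx) (K : R) (N0 : nat) :
  (forall n, (n >= N0)%nat -> Cabs (u n - l) <= K / (INR n + 1)) -> Ccv u l.
Proof.
  intros H e He.
  destruct (INR_unbounded (Rabs K / e)) as [N1 HN].
  exists (N0 + N1)%nat; intros n Hn; eapply Rle_lt_trans; [apply H; lia|].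
  assert (P := pos_INR n); assert (Q := Rle_abs K).
  assert (L : (INR N1 <= INR n)%R) by (apply le_INR; lia).
  apply Rmult_lt_reg_r with (INR n + 1)%R; [lra|].
  replace (K / (INR n + 1) * (INR n + 1))%R with K by (field; lra).
  assert (Rabs K < e * INR N1).
  { apply Rmult_lt_reg_r with (/ e)%R; [apply Rinv_0_lt_compat; lra|].
    replace (e * INR N1 * / e)%R with (INR N1) by (field; lra); exact HN. }
  nra.
Qed.

Lemma Ccv_Cauchy (u : nat -> Cplx) (K : R) :
  (forall n k, Cabs (u (n + k)%nat - u n) <= K / (INR n + 1)) -> exists l, Ccv u l.
Proof.
  intros H.
  (* Real and imaginary parts are handled at once, as additive maps [p] that do not increase the
     modulus. *)
  assert (HC : forall p : Cplx -> R, (forall z, Rabs (p z) <= Cabs z) -> (forall z w, p (z - w) = (p z - p w)%R) ->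
    exists l, Un_cv (fun n => p (u n)) l).
  { intros p Hp Hm;
    destruct (R_complete (fun n => p (u n))) as [l Hl]; [|exists l; exact Hl].
    intros e He.
    assert (S : Ccv (fun n => RtoC (K / (INR n + 1))) C0).
    { apply Ccv_squeeze with (Rabs K) 0%nat; intros n _.
      replace (RtoC (K / (INR n + 1)) - C0) with (RtoC (K / (INR n + 1))) by ring.
      assert (P := pos_INR n).
      rewrite Cabs_RtoC; unfold Rdiv; rewrite Rabs_mult, Rabs_inv, (Rabs_pos_eq (INR n + 1)) by lra; lra. }
    destruct (S (e / 2)%R ltac:(lra)) as [N G]; exists N; intros n m Hn Hm'.
    specialize (G N ltac:(lia)).
    replace (RtoC (K / (INR N + 1)) - C0) with (RtoC (K / (INR N + 1))) in G by ring.
    rewrite Cabs_RtoC in G; apply Rabs_def2 in G.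
    assert (B : forall n, (n >= N)%nat -> Rabs (p (u n) - p (u N)) < e / 2).
    { intros q Hq; rewrite <- Hm; eapply Rle_lt_trans; [apply Hp|].
      replace q with (N + (q - N))%nat by lia; eapply Rle_lt_trans; [apply H|]; lra. }
    unfold Rdist; generalize (B n Hn) (B m Hm'); intros B1 B2.
    rewrite Rabs_minus_sym in B2; generalize (Rabs_triang (p (u n) - p (u N)) (p (u N) - p (u m))).
    replace (p (u n) - p (u N) + (p (u N) - p (u m)))%R with (p (u n) - p (u m))%R by ring; lra. }
  destruct (HC Re Re_le_Cabs) as [a Ha]; [intros; reflexivity|].
  destruct (HC Im Im_le_Cabs) as [b Hb]; [intros; reflexivity|].
  exists (mkC a b); intros e He.
  destruct (Ha (e / 2)%R ltac:(lra)) as [N1 H1]; destruct (Hb (e / 2)%R ltac:(lra)) as [N2 H2].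
  exists (N1 + N2)%nat; intros n Hn; specialize (H1 n ltac:(lia)); specialize (H2 n ltac:(lia)).
  eapply Rle_lt_trans; [apply Cabs_le_ReIm|]; unfold Rdist in *.
  change (Re (u n - mkC a b)) with (Re (u n) - a)%R; change (Im (u n - mkC a b)) with (Im (u n) - b)%R; lra.
Qed.

(** * Sums over expanding squares *)

(** Grows by one term at each end, so that a sum over a square grows by its border; reflections and
    telescoping then become inductions on [N]. *)
Fixpoint zsum (N : nat) (g : Z -> Cplx) : Cplx :=
  match N with
  | O => g 0%Z
  | S k => g (- Z.of_nat (S k))%Z + zsum k g + g (Z.of_nat (S k))
  end.

Lemma Csum_ext (n : nat) (f g : nat -> Cplx) : (forall i, f i = g i) -> Csum n f = Csum n g.
Proof. intros H; induction n; simpl; [reflexivity | rewrite IHn, H; reflexivity]. Qed.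

Lemma Csum_first (n : nat) (f : nat -> Cplx) : Csum (S n) f = f 0%nat + Csum n (fun i => f (S i)).
Proof.
  induction n; [simpl; ring|].
  change (Csum (S (S n)) f) with (Csum (S n) f + f (S n)); rewrite IHn; simpl; ring.
Qed.

Lemma zsum_Csum (N : nat) (g : Z -> Cplx) :
  Csum (2 * N + 1) (fun i => g (Z.of_nat i - Z.of_nat N)%Z) = zsum N g.
Proof.
  induction N; [simpl; ring|].
  replace (2 * S N + 1)%nat with (S (S (2 * N + 1))) by lia.
  rewrite Csum_first.
  change (Csum (S (2 * N + 1)) (fun i => g (Z.of_nat (S i) - Z.of_nat (S N))%Z)) with
    (Csum (2 * N + 1) (fun i => g (Z.of_nat (S i) - Z.of_nat (S N))%Z)
     + g (Z.of_nat (S (2 * N + 1)) - Z.of_nat (S N))%Z).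
  cbn [zsum]; rewrite <- IHN.
  rewrite (Csum_ext _ (fun i => g (Z.of_nat (S i) - Z.of_nat (S N))%Z) (fun i => g (Z.of_nat i - Z.of_nat N)%Z))
    by (intros; f_equal; lia).
  replace (Z.of_nat 0 - Z.of_nat (S N))%Z with (- Z.of_nat (S N))%Z by lia.
  replace (Z.of_nat (S (2 * N + 1)) - Z.of_nat (S N))%Z with (Z.of_nat (S N)) by lia.
  ring.
Qed.

Lemma zsum_ext (N : nat) (f g : Z -> Cplx) : (forall i, f i = g i) -> zsum N f = zsum N g.
Proof. intros H; induction N; simpl; rewrite ?IHN, !H; reflexivity. Qed.

Definition sqsum (N : nat) (f : Z -> Z -> Cplx) : Cplx := zsum N (fun m => zsum N (f m)).

Lemma square_sum_zsum (N : nat) (f : Z -> Z -> Cplx) : square_sum N f = sqsum N f.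
Proof.
  unfold square_sum, sqsum; rewrite <- zsum_Csum; apply Csum_ext; intros i.
  apply (zsum_Csum N (f (Z.of_nat i - Z.of_nat N)%Z)).
Qed.

Lemma zsum_plus (N : nat) (f g : Z -> Cplx) : zsum N (fun i => f i + g i) = zsum N f + zsum N g.
Proof. induction N; simpl; rewrite ?IHN; ring. Qed.

Lemma zsum_scal (N : nat) (c : Cplx) (f : Z -> Cplx) : zsum N (fun i => c * f i) = c * zsum N f.
Proof. induction N; simpl; rewrite ?IHN; ring. Qed.

Lemma zsum_opp (N : nat) (f : Z -> Cplx) : zsum N (fun i => f (- i)%Z) = zsum N f.
Proof.
  induction N; [reflexivity|]; cbn [zsum]; rewrite IHN.
  replace (- - Z.of_nat (S N))%Z with (Z.of_nat (S N)) by lia; ring.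
Qed.

(** The end indices [- N - 1] and [N] are not opposite; evaluating at minus half a period later
    makes them symmetric, at distance [N + 1/2]. *)
Lemma zsum_tele (N : nat) (f : Z -> Cplx) :
  zsum N (fun i => f (i - 1)%Z - f i) = f (- Z.of_nat N - 1)%Z - f (Z.of_nat N).
Proof.
  induction N; [reflexivity|]; cbn [zsum]; rewrite IHN.
  replace (Z.of_nat (S N) - 1)%Z with (Z.of_nat N) by lia.
  replace (- Z.of_nat (S N))%Z with (- Z.of_nat N - 1)%Z by lia; ring.
Qed.

Lemma zsum_bound (N : nat) (f : Z -> Cplx) (B : R) :
  (forall i, (Z.abs i <= Z.of_nat N)%Z -> Cabs (f i) <= B) -> Cabs (zsum N f) <= (2 * INR N + 1) * B.
Proof.
  induction N; intros H; [simpl; specialize (H 0%Z ltac:(lia)); lra|].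
  cbn [zsum]; rewrite S_INR.
  assert (H1 := H (- Z.of_nat (S N))%Z ltac:(lia)); assert (H2 := H (Z.of_nat (S N)) ltac:(lia)).
  assert (H3 : Cabs (zsum N f) <= (2 * INR N + 1) * B) by (apply IHN; intros; apply H; lia).
  eapply Rle_trans; [apply Cabs_triang|].
  eapply Rle_trans; [apply Rplus_le_compat_r, Cabs_triang|]; lra.
Qed.

Lemma zsum_C0 (N : nat) : zsum N (fun _ => C0) = C0.
Proof. induction N; simpl; rewrite ?IHN; ring. Qed.

Lemma sqsum_ext (N : nat) (f g : Z -> Z -> Cplx) :
  (forall m n, f m n = g m n) -> sqsum N f = sqsum N g.
Proof. intros H; apply zsum_ext; intros; apply zsum_ext; auto. Qed.

Lemma sqsum_plus (N : nat) (f g : Z -> Z -> Cplx) :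
  sqsum N (fun m n => f m n + g m n) = sqsum N f + sqsum N g.
Proof.
  unfold sqsum; rewrite <- zsum_plus; apply zsum_ext; intros; apply zsum_plus.
Qed.

Lemma sqsum_scal (N : nat) (c : Cplx) (f : Z -> Z -> Cplx) :
  sqsum N (fun m n => c * f m n) = c * sqsum N f.
Proof.
  unfold sqsum; rewrite <- zsum_scal; apply zsum_ext; intros; apply zsum_scal.
Qed.

Lemma sqsum_opp (N : nat) (f : Z -> Z -> Cplx) :
  sqsum N (fun m n => f (- m)%Z (- n)%Z) = sqsum N f.
Proof.
  unfold sqsum; rewrite <- (zsum_opp N (fun m => zsum N (f m))).
  apply zsum_ext; intros i; apply (zsum_opp N (f (- i)%Z)).
Qed.

(** Comparable with the modulus of the lattice point, but independent of [tau] and never below 1: a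
    single scale for all estimates while [tau] varies. *)
Definition ell (m n : Z) : R := (1 + Rabs (IZR m) + Rabs (IZR n))%R.

Lemma ell_ge1 (m n : Z) : 1 <= ell m n.
Proof. unfold ell; generalize (Rabs_pos (IZR m)) (Rabs_pos (IZR n)); lra. Qed.

Lemma zsum_split (N : nat) (f : Z -> Z -> Cplx) :
  sqsum (S N) f = sqsum N f
    + (zsum (S N) (f (- Z.of_nat (S N))%Z) + zsum (S N) (f (Z.of_nat (S N)))
    + (zsum N (fun m => f m (- Z.of_nat (S N))%Z) + zsum N (fun m => f m (Z.of_nat (S N))))).
Proof.
  unfold sqsum at 1; cbn [zsum].
  rewrite !zsum_plus; unfold sqsum; cbn [zsum]; ring.
Qed.

(* The square of size N+1 has 8(N+1) points outside the square of size N, all with ell >= N+2. *)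
Lemma sqsum_step (N : nat) (f : Z -> Z -> Cplx) (K : R) :
  (forall m n, (m, n) <> (0, 0)%Z -> Cabs (f m n) <= K / (ell m n * ell m n * ell m n)) ->
  Cabs (sqsum (S N) f - sqsum N f) <= 8 * K * (/ (INR N + 1) - / (INR N + 2)).
Proof.
  intros H.
  assert (PN := pos_INR N).
  set (L := (INR N + 2)%R).
  assert (HK : 0 <= K).
  { specialize (H 1%Z 0%Z ltac:(congruence)); assert (P := ell_ge1 1 0).
    generalize (Cabs_ge0 (f 1%Z 0%Z)); intros Q.
    assert (0 <= K / (ell 1 0 * ell 1 0 * ell 1 0)) by lra.
    apply Rnot_lt_le; intros C; apply (Rlt_not_le 0 (K / (ell 1 0 * ell 1 0 * ell 1 0))); [|assumption].
    unfold Rdiv; assert (0 < / (ell 1 0 * ell 1 0 * ell 1 0)) by (apply Rinv_0_lt_compat; repeat apply Rmult_lt_0_compat; lra); nra. }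
  set (B := (K / (L * L * L))%R).
  assert (HB : forall m n, (Z.abs m = Z.of_nat (S N) \/ Z.abs n = Z.of_nat (S N)) -> Cabs (f m n) <= B).
  { intros m n Hmn; eapply Rle_trans; [apply H; intros E; injection E; intros -> ->; simpl in Hmn; lia|].
    assert (E : L <= ell m n).
    { unfold L, ell; destruct Hmn as [E|E]; apply (f_equal IZR) in E; rewrite abs_IZR, <- INR_IZR_INZ, S_INR in E;
      rewrite E; generalize (Rabs_pos (IZR m)) (Rabs_pos (IZR n)); lra. }
    assert (0 < L) by (unfold L; lra).
    unfold B, Rdiv; apply Rmult_le_compat_l; [assumption|].
    apply Rinv_le_contravar; [repeat apply Rmult_lt_0_compat; assumption|].
    repeat (apply Rmult_le_compat; try lra); nra. }
  rewrite zsum_split.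
  match goal with |- Cabs (?a + ?b - ?a) <= _ => replace (a + b - a) with b by ring end.
  assert (H1 : forall s, Z.abs s = Z.of_nat (S N) -> Cabs (zsum (S N) (f s)) <= (2 * INR (S N) + 1) * B)
    by (intros s Hs; apply zsum_bound; intros; apply HB; tauto).
  assert (H2 : forall s, Z.abs s = Z.of_nat (S N) -> Cabs (zsum N (fun m => f m s)) <= (2 * INR N + 1) * B)
    by (intros s Hs; apply zsum_bound; intros; apply HB; tauto).
  assert (G1 := H1 (- Z.of_nat (S N))%Z ltac:(lia)); assert (G2 := H1 (Z.of_nat (S N))%Z ltac:(lia)).
  assert (G3 := H2 (- Z.of_nat (S N))%Z ltac:(lia)); assert (G4 := H2 (Z.of_nat (S N))%Z ltac:(lia)).
  rewrite S_INR in G1, G2.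
  match goal with |- Cabs (?a + ?b + (?c + ?d)) <= _ =>
    generalize (Cabs_triang (a + b) (c + d)) (Cabs_triang a b) (Cabs_triang c d) end; intros.
  apply Rle_trans with (8 * (INR N + 1) * B)%R; [lra|].
  unfold B, L; replace (8 * K * (/ (INR N + 1) - / (INR N + 2)))%R with (8 * (K / ((INR N + 1) * (INR N + 2))))%R by (field; lra).
  rewrite Rmult_assoc; apply Rmult_le_compat_l; [lra|].
  replace ((INR N + 1) * (K / ((INR N + 2) * (INR N + 2) * (INR N + 2))))%R with
    (K * ((INR N + 1) / ((INR N + 2) * (INR N + 2) * (INR N + 2))))%R by (field; lra).
  unfold Rdiv at 2; apply Rmult_le_compat_l; [assumption|].
  apply Rmult_le_reg_r with ((INR N + 1) * ((INR N + 2) * (INR N + 2) * (INR N + 2)))%R; [repeat apply Rmult_lt_0_compat; lra|].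
  replace ((INR N + 1) / ((INR N + 2) * (INR N + 2) * (INR N + 2)) * ((INR N + 1) * ((INR N + 2) * (INR N + 2) * (INR N + 2))))%R
    with ((INR N + 1) * (INR N + 1))%R by (field; lra).
  replace (/ ((INR N + 1) * (INR N + 2)) * ((INR N + 1) * ((INR N + 2) * (INR N + 2) * (INR N + 2))))%R
    with ((INR N + 2) * (INR N + 2))%R by (field; lra).
  nra.
Qed.

(** The bounds of [sqsum_step] telescope. The tail is thus at most [8 * K / (N + 1)], and [N = 0]
    gives the bound [8 * K] for a whole sum. *)
Lemma sqsum_Cauchy (N k : nat) (f : Z -> Z -> Cplx) (K : R) :
  (forall m n, (m, n) <> (0, 0)%Z -> Cabs (f m n) <= K / (ell m n * ell m n * ell m n)) ->
  Cabs (sqsum (N + k) f - sqsum N f) <= 8 * K * (/ (INR N + 1) - / (INR (N + k) + 1)).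
Proof.
  intros H; induction k.
  - rewrite Nat.add_0_r; replace (sqsum N f - sqsum N f) with C0 by ring; rewrite Cabs_C0; lra.
  - assert (S1 := sqsum_step (N + k) f K H); rewrite Nat.add_succ_r, S_INR.
    replace (sqsum (S (N + k)) f - sqsum N f) with ((sqsum (S (N + k)) f - sqsum (N + k) f) + (sqsum (N + k) f - sqsum N f)) by ring.
    eapply Rle_trans; [apply Cabs_triang|].
    replace (INR (N + k) + 1 + 1)%R with (INR (N + k) + 2)%R by ring; lra.
Qed.

Definition mask (f : Z -> Z -> Cplx) (m n : Z) : Cplx :=
  if (Z.eqb m 0 && Z.eqb n 0)%bool then C0 else f m n.

Lemma mask_neq (f : Z -> Z -> Cplx) (m n : Z) : (m, n) <> (0, 0)%Z -> mask f m n = f m n.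
Proof.
  intros H; unfold mask; destruct (Z.eqb_spec m 0), (Z.eqb_spec n 0); simpl; subst; tauto.
Qed.

Lemma mask_ext (f g : Z -> Z -> Cplx) :
  (forall m n, (m, n) <> (0, 0)%Z -> f m n = g m n) -> forall m n, mask f m n = mask g m n.
Proof.
  intros H m n; destruct (classic ((m, n) = (0, 0)%Z)) as [E|E].
  - injection E; intros -> ->; reflexivity.
  - rewrite !mask_neq by assumption; auto.
Qed.

(** Three is the least integer exponent for which a sum over a plane lattice converges absolutely;
    the terms of [wzeta], [wp], [wp'] and of their [tau]-derivatives decay at least at this rate. *)
Definition dominated (f : Z -> Z -> Cplx) (K : R) : Prop :=
  forall m n, (m, n) <> (0, 0)%Z -> Cabs (f m n) <= K / (ell m n * ell m n * ell m n).

Lemma lsum_unfold (f : Z -> Z -> Cplx) : lsum' f = Clim (fun N => sqsum N (mask f)).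
Proof.
  unfold lsum'; f_equal; apply functional_extensionality; intros N.
  apply square_sum_zsum.
Qed.

Lemma lsum_eq (f : Z -> Z -> Cplx) (l : Cplx) : Ccv (fun N => sqsum N (mask f)) l -> lsum' f = l.
Proof. rewrite lsum_unfold; apply Clim_eq. Qed.

Lemma dominated_mask (f : Z -> Z -> Cplx) (K : R) : dominated f K -> dominated (mask f) K.
Proof. intros H m n N; rewrite mask_neq by assumption; auto. Qed.

Lemma dominated_nonneg (f : Z -> Z -> Cplx) (K : R) : dominated f K -> 0 <= K.
Proof.
  intros H; specialize (H 1%Z 0%Z ltac:(congruence)).
  assert (P := ell_ge1 1 0); assert (Q := Cabs_ge0 (f 1%Z 0%Z)).
  set (c := (ell 1 0 * ell 1 0 * ell 1 0)%R) in *.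
  assert (0 < c) by (unfold c; repeat apply Rmult_lt_0_compat; lra).
  replace K with (K / c * c)%R by (field; lra); apply Rmult_le_pos; lra.
Qed.

Lemma lsum_cv (f : Z -> Z -> Cplx) (K : R) :
  dominated f K -> Ccv (fun N => sqsum N (mask f)) (lsum' f).
Proof.
  intros H; assert (HK := dominated_nonneg _ _ H).
  destruct (Ccv_Cauchy (fun N => sqsum N (mask f)) (8 * K)) as [l Hl].
  - intros n k; eapply Rle_trans; [apply sqsum_Cauchy, dominated_mask, H|].
    assert (P := pos_INR n); assert (Q := pos_INR (n + k)).
    unfold Rdiv; apply Rmult_le_compat_l; [lra|].
    assert (0 < / (INR (n + k) + 1)) by (apply Rinv_0_lt_compat; lra); lra.
  - rewrite (lsum_eq _ _ Hl); exact Hl.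
Qed.

Lemma lsum_bound (f : Z -> Z -> Cplx) (K : R) : dominated f K -> Cabs (lsum' f) <= 8 * K.
Proof.
  intros H; assert (HK := dominated_nonneg _ _ H).
  apply (Ccv_bound _ _ _ (lsum_cv _ _ H)); intros n.
  generalize (sqsum_Cauchy 0 n (mask f) K (dominated_mask _ _ H)).
  replace (sqsum 0 (mask f)) with C0 by reflexivity.
  replace (sqsum (0 + n) (mask f) - C0) with (sqsum n (mask f)) by (simpl; ring).
  intros B; eapply Rle_trans; [exact B|].
  assert (Q := pos_INR (0 + n)); assert (0 < / (INR (0 + n) + 1)) by (apply Rinv_0_lt_compat; lra).
  simpl (INR 0); rewrite Rplus_0_l, Rinv_1; nra.
Qed.

Lemma lsum_ext (f g : Z -> Z -> Cplx) :
  (forall m n, (m, n) <> (0, 0)%Z -> f m n = g m n) -> lsum' f = lsum' g.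
Proof.
  intros H; rewrite !lsum_unfold; f_equal; apply functional_extensionality; intros N.
  apply sqsum_ext, mask_ext, H.
Qed.

Lemma lsum_plus (f g : Z -> Z -> Cplx) (K L : R) :
  dominated f K -> dominated g L -> lsum' (fun m n => f m n + g m n) = lsum' f + lsum' g.
Proof.
  intros Hf Hg; apply lsum_eq.
  apply Ccv_ext with (fun N => sqsum N (mask f) + sqsum N (mask g)).
  - intros N; rewrite <- sqsum_plus; apply sqsum_ext; intros m n; unfold mask.
    destruct (Z.eqb m 0 && Z.eqb n 0)%bool; ring.
  - apply Ccv_plus; eapply lsum_cv; eassumption.
Qed.

Lemma lsum_scal (c : Cplx) (f : Z -> Z -> Cplx) (K : R) :
  dominated f K -> lsum' (fun m n => c * f m n) = c * lsum' f.
Proof.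
  intros Hf; apply lsum_eq.
  apply Ccv_ext with (fun N => c * sqsum N (mask f)).
  - intros N; rewrite <- sqsum_scal; apply sqsum_ext; intros m n; unfold mask.
    destruct (Z.eqb m 0 && Z.eqb n 0)%bool; ring.
  - apply Ccv_scal; eapply lsum_cv; eassumption.
Qed.

Lemma lsum_reflect (f : Z -> Z -> Cplx) : lsum' (fun m n => f (- m)%Z (- n)%Z) = lsum' f.
Proof.
  rewrite !lsum_unfold; f_equal; apply functional_extensionality; intros N.
  rewrite <- (sqsum_opp N (mask f)); apply sqsum_ext; intros m n; unfold mask.
  destruct (Z.eqb_spec m 0), (Z.eqb_spec n 0), (Z.eqb_spec (- m) 0), (Z.eqb_spec (- n) 0); simpl; try reflexivity; lia.
Qed.

Lemma dominated_scal (c : Cplx) (f : Z -> Z -> Cplx) (K : R) :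
  dominated f K -> dominated (fun m n => c * f m n) (Cabs c * K).
Proof.
  intros H m n N; rewrite Cabs_mul; unfold Rdiv; rewrite Rmult_assoc.
  apply Rmult_le_compat_l; [apply Cabs_ge0 | apply H, N].
Qed.

(** * Distance to the lattice *)

(** Plays the part of a minimum over finitely many indices; applied twice, first in [n] and then in
    [m], it covers a square of lattice points. *)
Lemma zrange_min (P : Z -> R -> Prop) (N : nat) :
  (forall i c c', c' <= c -> P i c -> P i c') ->
  (forall i, exists c, 0 < c /\ P i c) ->
  exists c, 0 < c /\ forall i, (Z.abs i <= Z.of_nat N)%Z -> P i c.
Proof.
  intros M E; induction N as [|N [c [Hc IH]]].
  - destruct (E 0%Z) as [c [Hc H]]; exists c; split; [assumption|].
    intros i Hi; replace i with 0%Z by lia; assumption.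
  - destruct (E (Z.of_nat (S N))) as [c1 [Hc1 H1]]; destruct (E (- Z.of_nat (S N))%Z) as [c2 [Hc2 H2]].
    exists (Rmin c (Rmin c1 c2)); split; [repeat apply Rmin_pos; assumption|].
    intros i Hi.
    destruct (Z.eq_dec i (Z.of_nat (S N))) as [->|N1].
    { apply M with c1; [eapply Rle_trans; [apply Rmin_r | apply Rmin_l] | assumption]. }
    destruct (Z.eq_dec i (- Z.of_nat (S N))) as [->|N2].
    { apply M with c2; [eapply Rle_trans; [apply Rmin_r | apply Rmin_r] | assumption]. }
    apply M with c; [apply Rmin_l | apply IH; lia].
Qed.

Lemma Cabs_ZtoC (n : Z) : Cabs (ZtoC n) = Rabs (IZR n).
Proof. apply Cabs_RtoC. Qed.

(** The imaginary part controls [n], and the triangle inequality then controls [m]. *)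
Lemma lat_lower (tau : Cplx) (m n : Z) : upper_half tau ->
  Rabs (IZR m) + Rabs (IZR n) <= (1 + (1 + Cabs tau) / Im tau) * Cabs (lat tau m n).
Proof.
  unfold upper_half; intros H.
  assert (H1 : Rabs (IZR n) * Im tau <= Cabs (lat tau m n)).
  { eapply Rle_trans; [|apply Im_le_Cabs].
    rewrite <- (Rabs_pos_eq (Im tau)) at 1 by lra; rewrite <- Rabs_mult.
    apply Req_le; f_equal; unfold lat, ZtoC, RtoC; simpl; ring. }
  assert (H2 : Rabs (IZR m) <= Cabs (lat tau m n) + Rabs (IZR n) * Cabs tau).
  { replace (Rabs (IZR m)) with (Cabs (lat tau m n - ZtoC n * tau)).
    - eapply Rle_trans; [apply Cabs_sub_triang|]; rewrite Cabs_mul, Cabs_ZtoC; lra.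
    - unfold lat; replace (ZtoC m + ZtoC n * tau - ZtoC n * tau) with (ZtoC m) by ring.
      apply Cabs_RtoC. }
  assert (T := Cabs_ge0 tau); assert (L := Cabs_ge0 (lat tau m n)); assert (Pn := Rabs_pos (IZR n)).
  assert (H3 : Rabs (IZR n) <= Cabs (lat tau m n) / Im tau).
  { apply Rmult_le_reg_r with (Im tau); [lra|].
    replace (Cabs (lat tau m n) / Im tau * Im tau)%R with (Cabs (lat tau m n)) by (field; lra); exact H1. }
  replace ((1 + (1 + Cabs tau) / Im tau) * Cabs (lat tau m n))%R with
    (Cabs (lat tau m n) + (1 + Cabs tau) * (Cabs (lat tau m n) / Im tau))%R by (field; lra).
  nra.
Qed.

Lemma lattice_gap_pt (tau z : Cplx) : upper_half tau ->
  (forall m n, (m, n) <> (0, 0)%Z -> z <> lat tau m n) ->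
  exists c, 0 < c /\ forall m n, (m, n) <> (0, 0)%Z -> c * ell m n <= Cabs (z - lat tau m n).
Proof.
  intros Ht Hz.
  set (A := (1 + (1 + Cabs tau) / Im tau)%R).
  assert (HA : 1 <= A).
  { unfold A; assert (0 <= (1 + Cabs tau) / Im tau); [|lra].
    apply Rdiv_le_0_compat; [generalize (Cabs_ge0 tau); lra | exact Ht]. }
  assert (Zp := Cabs_ge0 z).
  (* Beyond [N] the lower bound [lat_lower] absorbs [Cabs z]; only finitely many lattice points
     remain, each at positive distance from [z]. *)
  destruct (INR_unbounded (2 * A * Cabs z + 2)) as [N HN].
  destruct (zrange_min (fun m c => forall n, (Z.abs n <= Z.of_nat N)%Z -> (m, n) <> (0, 0)%Z -> c <= Cabs (z - lat tau m n)) N)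
    as [c [Hc Hmin]].
  { intros i c c' Hle H n Hn Hmn; eapply Rle_trans; [exact Hle | auto]. }
  { intros m; destruct (zrange_min (fun n c => (m, n) <> (0, 0)%Z -> c <= Cabs (z - lat tau m n)) N) as [c [Hc Hm]].
    - intros i c c' Hle H Hmn; eapply Rle_trans; [exact Hle | auto].
    - intros n; destruct (classic ((m, n) = (0, 0)%Z)) as [E|E].
      + exists 1%R; split; [lra | tauto].
      + exists (Cabs (z - lat tau m n)); split; [apply Cabs_gt0, Csub_neq0, Hz, E | intros; lra].
    - exists c; split; [assumption | auto]. }
  exists (Rmin (c / (1 + 2 * INR N)) (1 / (4 * A))).
  assert (PN := pos_INR N).
  assert (Q1 : 0 < c / (1 + 2 * INR N)) by (apply Rdiv_lt_0_compat; lra).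
  assert (Q2 : 0 < 1 / (4 * A)) by (apply Rdiv_lt_0_compat; lra).
  split; [apply Rmin_pos; assumption|].
  intros m n Hmn; assert (HL := ell_ge1 m n).
  destruct (Rle_lt_dec (Rabs (IZR m) + Rabs (IZR n)) (INR N)) as [Lmn|Gmn].
  - apply Rle_trans with (c / (1 + 2 * INR N) * ell m n)%R; [apply Rmult_le_compat_r; [lra | apply Rmin_l]|].
    apply Rle_trans with c.
    + replace c with (c / (1 + 2 * INR N) * (1 + 2 * INR N))%R at 2 by (field; lra).
      apply Rmult_le_compat_l; [lra | unfold ell; lra].
    + generalize (Rabs_pos (IZR m)) (Rabs_pos (IZR n)); intros.
      apply Hmin; [| |exact Hmn]; apply le_IZR; rewrite abs_IZR, <- INR_IZR_INZ; lra.
  - apply Rle_trans with (1 / (4 * A) * ell m n)%R; [apply Rmult_le_compat_r; [lra | apply Rmin_r]|].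
    assert (D := lat_lower tau m n Ht); fold A in D.
    rewrite Cabs_sub_sym; generalize (Cabs_sub_ge (lat tau m n) z); intros D2.
    unfold ell in *; set (t := (Rabs (IZR m) + Rabs (IZR n))%R) in *.
    apply Rmult_le_reg_l with (4 * A)%R; [lra|].
    replace (4 * A * (1 / (4 * A) * (1 + Rabs (IZR m) + Rabs (IZR n))))%R with (1 + t)%R by (unfold t; field; lra).
    apply Rle_trans with (4 * A * (Cabs (lat tau m n) - Cabs z))%R; nra.
Qed.

(** Moving [tau] displaces the lattice point by an amount proportional to [n], which half of the gap
    [c * ell m n] absorbs. This uniformity is what permits differentiation of the sums in [tau]. *)
Lemma lattice_gap (tau0 z0 : Cplx) : upper_half tau0 ->
  (forall m n, (m, n) <> (0, 0)%Z -> z0 <> lat tau0 m n) ->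
  exists c d, 0 < c /\ 0 < d /\ forall z tau, Cabs (z - z0) < d -> Cabs (tau - tau0) < d ->
    forall m n, (m, n) <> (0, 0)%Z -> c * ell m n <= Cabs (z - lat tau m n).
Proof.
  intros Ht Hz; destruct (lattice_gap_pt tau0 z0 Ht Hz) as [c [Hc H]].
  exists (c / 2)%R, (c / 2)%R; split; [lra|]; split; [lra|].
  intros z tau H1 H2 m n Hmn; specialize (H m n Hmn).
  replace (z - lat tau m n) with ((z0 - lat tau0 m n) + ((z - z0) - ZtoC n * (tau - tau0))) by (unfold lat; ring).
  generalize (Cabs_add_ge (z0 - lat tau0 m n) ((z - z0) - ZtoC n * (tau - tau0))); intros G.
  assert (G2 := Cabs_sub_triang (z - z0) (ZtoC n * (tau - tau0))).
  rewrite Cabs_mul, Cabs_ZtoC in G2.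
  assert (Cabs (z - z0) + Rabs (IZR n) * Cabs (tau - tau0) <= c / 2 * ell m n); [|lra].
  unfold ell; generalize (Rabs_pos (IZR n)) (Rabs_pos (IZR m)); nra.
Qed.

Lemma upper_half_near (tau0 : Cplx) : upper_half tau0 -> near tau0 upper_half.
Proof.
  unfold upper_half; intros H; exists (Im tau0); split; [lra|]; intros w Hw.
  generalize (Im_le_Cabs (w - tau0)); change (Im (w - tau0)) with (Im w - Im tau0)%R; intros G.
  assert (B : Rabs (Im w - Im tau0) < Im tau0) by lra; apply Rabs_def2 in B; lra.
Qed.

Lemma lat_neq0 (tau : Cplx) (m n : Z) : upper_half tau -> (m, n) <> (0, 0)%Z -> lat tau m n <> C0.
Proof.
  intros H N E; generalize (lat_lower tau m n H); rewrite E, Cabs_C0, Rmult_0_r; intros G.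
  apply N; generalize (Rabs_pos (IZR m)) (Rabs_pos (IZR n)); intros.
  assert (Em : Rabs (IZR m) = 0%R) by lra; assert (En : Rabs (IZR n) = 0%R) by lra.
  apply Rcomplements.Rabs_eq_0 in Em; apply Rcomplements.Rabs_eq_0 in En.
  apply (eq_IZR m 0) in Em; apply (eq_IZR n 0) in En; subst; reflexivity.
Qed.

(** * Differentiation of lattice sums *)

(* Families [F h] of lattice functions of order [ell ^ k], differentiable at [h = 0] with
   derivative [F'] up to a quadratic remainder, both uniformly over the lattice. *)
Definition fam (k : Z) (F : Cplx -> Z -> Z -> Cplx) (F' : Z -> Z -> Cplx) : Prop :=
  exists K d, 0 <= K /\ 0 < d /\ forall h, Cabs h < d -> forall m n, (m, n) <> (0, 0)%Z ->
    Cabs (F h m n) <= K * powerRZ (ell m n) k /\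
    Cabs (F' m n) <= K * powerRZ (ell m n) k /\
    Cabs (F h m n - F C0 m n - h * F' m n) <= K * (Cabs h * Cabs h) * powerRZ (ell m n) k.

Lemma powell_pos (k m n : Z) : 0 < powerRZ (ell m n) k.
Proof. apply powerRZ_lt; generalize (ell_ge1 m n); lra. Qed.

Lemma fam_eq (k : Z) (F G : Cplx -> Z -> Z -> Cplx) (F' G' : Z -> Z -> Cplx) :
  fam k F F' ->
  near C0 (fun h => forall m n, (m, n) <> (0, 0)%Z -> F h m n = G h m n) ->
  (forall m n, (m, n) <> (0, 0)%Z -> F' m n = G' m n) -> fam k G G'.
Proof.
  intros [K [d [HK [Hd H]]]] [e [He E]] E'.
  exists K, (Rmin d e); split; [assumption|]; split; [apply Rmin_pos; assumption|].
  intros h Hh m n N.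
  assert (Cabs h < d) by (exact (lt_Rmin_l _ _ _ Hh)).
  assert (Cabs h < e) by (exact (lt_Rmin_r _ _ _ Hh)).
  rewrite <- (E h), <- (E C0), <- E' by (try assumption; replace (h - C0) with h by ring; replace (C0 - C0) with C0 by ring; try rewrite Cabs_C0; assumption).
  apply H; assumption.
Qed.

Lemma fam_weaken (j k : Z) (F : Cplx -> Z -> Z -> Cplx) (F' : Z -> Z -> Cplx) :
  (j <= k)%Z -> fam j F F' -> fam k F F'.
Proof.
  intros L [K [d [HK [Hd H]]]]; exists K, d; split; [assumption|]; split; [assumption|].
  intros h Hh m n N; destruct (H h Hh m n N) as [H1 [H2 H3]].
  assert (P : powerRZ (ell m n) j <= powerRZ (ell m n) k).
  { replace k with (j + (k - j))%Z by lia; assert (E := ell_ge1 m n); rewrite powerRZ_add by lra.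
    assert (Q := powell_pos j m n).
    assert (1 <= powerRZ (ell m n) (k - j)).
    { destruct (Z_of_nat_complete (k - j)) as [p ->]; [lia|].
      rewrite <- pow_powerRZ; apply pow_R1_Rle; assumption. }
    nra. }
  assert (Q := Cabs_ge0 h).
  repeat split; eapply Rle_trans; try eassumption; apply Rmult_le_compat_l; try assumption.
  apply Rmult_le_pos; nra.
Qed.

Lemma fam_plus (k : Z) (F G : Cplx -> Z -> Z -> Cplx) (F' G' : Z -> Z -> Cplx) :
  fam k F F' -> fam k G G' -> fam k (fun h m n => F h m n + G h m n) (fun m n => F' m n + G' m n).
Proof.
  intros [K [d [HK [Hd H]]]] [L [e [HL [He E]]]].
  exists (K + L)%R, (Rmin d e); split; [lra|]; split; [apply Rmin_pos; assumption|].
  intros h Hh m n N.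
  destruct (H h (lt_Rmin_l _ _ _ Hh) m n N) as [H1 [H2 H3]].
  destruct (E h (lt_Rmin_r _ _ _ Hh) m n N) as [E1 [E2 E3]].
  repeat split.
  - eapply Rle_trans; [apply Cabs_triang|]; lra.
  - eapply Rle_trans; [apply Cabs_triang|]; lra.
  - replace (F h m n + G h m n - (F C0 m n + G C0 m n) - h * (F' m n + G' m n)) with
      ((F h m n - F C0 m n - h * F' m n) + (G h m n - G C0 m n - h * G' m n)) by ring.
    eapply Rle_trans; [apply Cabs_triang|]; lra.
Qed.

Lemma fam_mult (j k : Z) (F G : Cplx -> Z -> Z -> Cplx) (F' G' : Z -> Z -> Cplx) :
  fam j F F' -> fam k G G' ->
  fam (j + k) (fun h m n => F h m n * G h m n) (fun m n => F' m n * G C0 m n + F C0 m n * G' m n).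
Proof.
  intros [K [d [HK [Hd H]]]] [L [e [HL [He E]]]].
  (* [4 = 1 + 2 + 1] counts the three pieces of the remainder of a product; the radius 1 allows
     [x * x] to be replaced by [x] in the increment of [G]. *)
  exists (4 * (K * L))%R, (Rmin 1 (Rmin d e)); split; [nra|]; split; [repeat apply Rmin_pos; lra|].
  intros h Hh m n N.
  assert (h1 : Cabs h < 1) by (exact (lt_Rmin_l _ _ _ Hh)).
  assert (h2 : Cabs h < d) by (exact (lt_Rmin_l _ _ _ (lt_Rmin_r _ _ _ Hh))).
  assert (h3 : Cabs h < e) by (exact (lt_Rmin_r _ _ _ (lt_Rmin_r _ _ _ Hh))).
  destruct (H h h2 m n N) as [H1 [H2 H3]]; destruct (E h h3 m n N) as [E1 [E2 E3]].
  destruct (H C0 ltac:(rewrite Cabs_C0; assumption) m n N) as [H0 _].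
  destruct (E C0 ltac:(rewrite Cabs_C0; assumption) m n N) as [E0 _].
  assert (Q := Cabs_ge0 h); assert (EL := ell_ge1 m n).
  rewrite powerRZ_add by lra.
  assert (Pa := powell_pos j m n); assert (Pb := powell_pos k m n).
  set (a := powerRZ (ell m n) j) in *; set (b := powerRZ (ell m n) k) in *; set (x := Cabs h) in *.
  assert (Gd : Cabs (G h m n - G C0 m n) <= 2 * (x * (L * b))).
  { replace (G h m n - G C0 m n) with ((G h m n - G C0 m n - h * G' m n) + h * G' m n) by ring.
    eapply Rle_trans; [apply Cabs_triang|]; rewrite Cabs_mul; fold x.
    assert (x * Cabs (G' m n) <= x * (L * b)) by (apply Rmult_le_compat_l; assumption).
    assert (L * (x * x) * b <= x * (L * b)); [|lra].
    replace (L * (x * x) * b)%R with (x * (x * (L * b)))%R by ring.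
    assert (0 <= x * (L * b)) by (repeat apply Rmult_le_pos; lra); nra. }
  assert (M : forall p q u v, 0 <= Cabs p -> Cabs p <= u -> Cabs q <= v -> Cabs (p * q) <= u * v).
  { intros p q u v Hp Hu Hv; rewrite Cabs_mul; apply Rmult_le_compat; try assumption; apply Cabs_ge0. }
  assert (KL : 0 <= (K * a) * (L * b)) by (apply Rmult_le_pos; apply Rmult_le_pos; lra).
  repeat split.
  - eapply Rle_trans; [apply M; [apply Cabs_ge0 | eassumption | eassumption]|]; nra.
  - eapply Rle_trans; [apply Cabs_triang|].
    eapply Rle_trans; [apply Rplus_le_compat; apply M; first [apply Cabs_ge0 | eassumption]|]; nra.
  - replace (F h m n * G h m n - F C0 m n * G C0 m n - h * (F' m n * G C0 m n + F C0 m n * G' m n)) with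
      ((F h m n - F C0 m n - h * F' m n) * G h m n +
       (h * F' m n * (G h m n - G C0 m n) + F C0 m n * (G h m n - G C0 m n - h * G' m n))) by ring.
    eapply Rle_trans; [apply Cabs_triang|].
    eapply Rle_trans; [apply Rplus_le_compat_l, Cabs_triang|].
    assert (T : Cabs (h * F' m n) <= x * (K * a)) by (rewrite Cabs_mul; apply Rmult_le_compat_l; assumption).
    assert (T1 := M _ _ _ _ (Cabs_ge0 _) H3 E1).
    assert (T2 := M _ _ _ _ (Cabs_ge0 _) T Gd).
    assert (T3 := M _ _ _ _ (Cabs_ge0 _) H0 E3).
    eapply Rle_trans; [apply Rplus_le_compat; [exact T1 | apply Rplus_le_compat; [exact T2 | exact T3]]|].
    apply Req_le; ring.
Qed.

Lemma fam_fixed (k : Z) (F : Z -> Z -> Cplx) (K : R) :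
  (forall m n, Cabs (F m n) <= K * powerRZ (ell m n) k) -> fam k (fun _ => F) (fun _ _ => C0).
Proof.
  intros H; exists (Rabs K), 1%R; split; [apply Rabs_pos|]; split; [lra|].
  intros h _ m n _; assert (P := powell_pos k m n); assert (HK := Rle_abs K); assert (HK' := Rabs_pos K).
  replace (F m n - F m n - h * C0) with C0 by ring; rewrite Cabs_C0.
  repeat split; [eapply Rle_trans; [apply H | nra] | nra |].
  apply Rmult_le_pos; [|lra]; apply Rmult_le_pos; [assumption|]; generalize (Cabs_ge0 h); nra.
Qed.

Lemma fam_cst (c : Cplx) : fam 0 (fun _ _ _ => c) (fun _ _ => C0).
Proof. apply (fam_fixed 0 (fun _ _ => c) (Cabs c)); intros; simpl; lra. Qed.

Lemma fam_n : fam 1 (fun _ _ n => ZtoC n) (fun _ _ => C0).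
Proof.
  apply (fam_fixed 1 (fun _ n => ZtoC n) 1); intros m n; rewrite powerRZ_1; rewrite Cabs_ZtoC.
  unfold ell; generalize (Rabs_pos (IZR m)); lra.
Qed.

Lemma fam_lin (z a : Cplx) : fam 0 (fun h _ _ => z + h * a) (fun _ _ => a).
Proof.
  exists (Cabs z + Cabs a)%R, 1%R; generalize (Cabs_ge0 z) (Cabs_ge0 a); intros; split; [lra|]; split; [lra|].
  intros h Hh m n _; simpl; replace (z + h * a - (z + C0 * a) - h * a) with C0 by ring; rewrite Cabs_C0.
  assert (Q := Cabs_ge0 h); repeat split.
  - eapply Rle_trans; [apply Cabs_triang|]; rewrite Cabs_mul; nra.
  - lra.
  - rewrite Rmult_1_r; apply Rmult_le_pos; nra.
Qed.

(** With [v = u + h a], the remainder of [1 / v] is exactly [(h a)^2 / (v u^2)]: the square of the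
    slope costs two powers of [ell], the three inverses gain three, and the order stays [-1]. *)
Lemma fam_inv (u a : Z -> Z -> Cplx) (A c d : R) : 0 < c -> 0 < d -> 0 <= A ->
  (forall m n, Cabs (a m n) <= A * ell m n) ->
  (forall h, Cabs h < d -> forall m n, (m, n) <> (0, 0)%Z -> c * ell m n <= Cabs (u m n + h * a m n)) ->
  fam (-1) (fun h m n => C1 / (u m n + h * a m n)) (fun m n => - a m n / (u m n * u m n)).
Proof.
  intros Hc Hd HA Ha Hu.
  assert (P1 : 0 < / c) by (apply Rinv_0_lt_compat; assumption).
  set (q := (/ c)%R) in *.
  exists (q + A * (q * q) + A * A * (q * q * q))%R, d.
  assert (0 <= A * (q * q)) by (apply Rmult_le_pos; nra).
  assert (0 <= A * A * (q * q * q)) by (repeat apply Rmult_le_pos; lra).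
  split; [lra|]; split; [assumption|].
  intros h Hh m n N; assert (L := ell_ge1 m n).
  assert (B := Hu h Hh m n N); assert (B0 := Hu C0 ltac:(rewrite Cabs_C0; assumption) m n N).
  replace (u m n + C0 * a m n) with (u m n) in * by ring.
  set (v := u m n + h * a m n) in *.
  assert (cl : 0 < c * ell m n) by nra.
  assert (Nv : v <> C0) by (apply Cabs_gt0_neq; lra).
  assert (Nu : u m n <> C0) by (apply Cabs_gt0_neq; lra).
  assert (I : forall w, c * ell m n <= Cabs w -> / Cabs w <= q * / ell m n).
  { intros w Hw; unfold q; rewrite <- Rinv_mult; apply Rinv_le_contravar; assumption. }
  assert (Iv := I v B); assert (Iu := I _ B0).
  assert (Pv : 0 < / Cabs v) by (apply Rinv_0_lt_compat; lra).
  assert (Pu : 0 < / Cabs (u m n)) by (apply Rinv_0_lt_compat; lra).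
  assert (Pl : 0 < / ell m n) by (apply Rinv_0_lt_compat; lra).
  replace (powerRZ (ell m n) (-1)) with (/ ell m n)%R by (simpl; rewrite Rmult_1_r; reflexivity).
  assert (Ql : (ell m n * / ell m n = 1)%R) by (field; lra).
  specialize (Ha m n).
  set (l := ell m n) in *; set (li := (/ l)%R) in *.
  assert (E1 : Cabs (a m n) * (/ Cabs (u m n) * / Cabs (u m n)) <= A * (q * q) * li).
  { apply Rle_trans with (A * l * ((q * li) * (q * li)))%R.
    - apply Rmult_le_compat; try assumption; [apply Cabs_ge0 | nra |]; apply Rmult_le_compat; lra.
    - apply Req_le; replace (A * l * (q * li * (q * li)))%R with (A * (q * q) * li * (l * li))%R by ring; rewrite Ql; ring. }
  assert (E2 : (Cabs (a m n) * Cabs (a m n)) * (/ Cabs v * (/ Cabs (u m n) * / Cabs (u m n))) <= A * A * (q * q * q) * li).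
  { apply Rle_trans with (A * l * (A * l) * ((q * li) * ((q * li) * (q * li))))%R.
    - assert (0 <= Cabs (a m n)) by apply Cabs_ge0.
      apply Rmult_le_compat; [nra | apply Rmult_le_pos; nra | apply Rmult_le_compat; lra |].
      apply Rmult_le_compat; [lra | nra | lra |]; apply Rmult_le_compat; lra.
    - apply Req_le; replace (A * l * (A * l) * (q * li * (q * li * (q * li))))%R with (A * A * (q * q * q) * li * ((l * li) * (l * li)))%R by ring; rewrite Ql; ring. }
  repeat split.
  - rewrite Cabs_inv by assumption; nra.
  - replace (- a m n / (u m n * u m n)) with (- (a m n * ((C1 / u m n) * (C1 / u m n)))) by (field; assumption).
    rewrite Cabs_opp, !Cabs_mul, !Cabs_inv by assumption; nra.
  - replace (C1 / v - C1 / u m n - h * (- a m n / (u m n * u m n))) with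
      ((h * h) * ((a m n * a m n) * ((C1 / v) * ((C1 / u m n) * (C1 / u m n))))).
    2:{ assert (Ev : h * a m n = v - u m n) by (unfold v; ring).
        replace (h * h * (a m n * a m n * (C1 / v * (C1 / u m n * (C1 / u m n))))) with
          ((h * a m n) * (h * a m n) * (C1 / v * (C1 / u m n * (C1 / u m n)))) by ring.
        replace (C1 / v - C1 / u m n - h * (- a m n / (u m n * u m n))) with
          (C1 / v - C1 / u m n + (h * a m n) / (u m n * u m n)) by (field; split; assumption).
        rewrite Ev; field; split; assumption. }
    rewrite !Cabs_mul, !Cabs_inv by assumption.
    assert (0 <= Cabs h * Cabs h) by (generalize (Cabs_ge0 h); nra).
    apply Rle_trans with (Cabs h * Cabs h * (A * A * (q * q * q) * li))%R; [apply Rmult_le_compat_l; assumption|].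
    replace ((q + A * (q * q) + A * A * (q * q * q)) * (Cabs h * Cabs h) * li)%R with
      ((Cabs h * Cabs h) * (((q + A * (q * q)) + A * A * (q * q * q)) * li))%R by ring.
    apply Rmult_le_compat_l; [assumption|]; apply Rmult_le_compat_r; lra.
Qed.

Lemma powell_m3 (m n : Z) : powerRZ (ell m n) (-3) = (/ (ell m n * ell m n * ell m n))%R.
Proof. assert (L := ell_ge1 m n); simpl; field; lra. Qed.

(** At order [-3] the termwise remainders are themselves dominated, with constant [K * |h|^2], so
    [lsum_bound] turns them into a quadratic remainder of the sum. *)
Lemma fam_sum (F : Cplx -> Z -> Z -> Cplx) (F' : Z -> Z -> Cplx) :
  fam (-3) F F' ->
  Cder (fun h => lsum' (F h)) C0 (lsum' F') /\
  exists K, 0 <= K /\ dominated F' K /\ near C0 (fun h => dominated (F h) K).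
Proof.
  intros [K [d [HK [Hd H]]]].
  assert (D : near C0 (fun h => dominated (F h) K)).
  { exists d; split; [assumption|]; intros h Hh m n N.
    replace (h - C0) with h in Hh by ring.
    destruct (H h Hh m n N) as [H1 _]; rewrite powell_m3 in H1; exact H1. }
  assert (D' : dominated F' K).
  { intros m n N; destruct (H C0 ltac:(rewrite Cabs_C0; assumption) m n N) as [_ [H1 _]]; rewrite powell_m3 in H1; exact H1. }
  split; [|exists K; auto].
  apply Cder_quadratic with (8 * K)%R; destruct D as [e [He D]].
  exists (Rmin d e); split; [apply Rmin_pos; assumption|]; intros h Hh.
  assert (Hh1 : Cabs (h - C0) < e) by (exact (lt_Rmin_r _ _ _ Hh)).
  assert (Hh2 : Cabs (h - C0) < d) by (exact (lt_Rmin_l _ _ _ Hh)).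
  assert (D0 : dominated (F C0) K) by (apply D; replace (C0 - C0) with C0 by ring; rewrite Cabs_C0; assumption).
  specialize (D h Hh1); replace (h - C0) with h in * by ring.
  assert (D1 : dominated (fun m n => F h m n + - C1 * F C0 m n + - h * F' m n) (K * (Cabs h * Cabs h))).
  { intros m n N; destruct (H h Hh2 m n N) as [_ [_ H3]]; rewrite powell_m3 in H3.
    replace (F h m n + - C1 * F C0 m n + - h * F' m n) with (F h m n - F C0 m n - h * F' m n) by ring; exact H3. }
  apply lsum_bound in D1; rewrite Rmult_assoc.
  replace (lsum' (F h) - lsum' (F C0) - h * lsum' F') with
    (lsum' (fun m n => F h m n + - C1 * F C0 m n + - h * F' m n)); [exact D1|].
  assert (S1 := dominated_scal (- C1) _ _ D0); assert (S2 := dominated_scal (- h) _ _ D').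
  assert (S3 : dominated (fun m n => F h m n + - C1 * F C0 m n) (K + Cabs (- C1) * K)).
  { intros m n N; eapply Rle_trans; [apply Cabs_triang|]; unfold Rdiv; rewrite Rmult_plus_distr_r.
    apply Rplus_le_compat; [apply D | apply S1]; assumption. }
  rewrite (lsum_plus _ _ _ _ S3 S2), (lsum_plus _ _ _ _ D S1), (lsum_scal _ _ _ D0), (lsum_scal _ _ _ D'); ring.
Qed.

(** The origin is allowed: sums over the nonzero lattice points are regular there, and the
    expansions at zero rely on it. *)
Definition offlat (z tau : Cplx) : Prop :=
  forall m n, (m, n) <> (0, 0)%Z -> z <> lat tau m n.

Lemma lat_00 (tau : Cplx) : lat tau 0 0 = C0.
Proof. unfold lat, ZtoC; ring. Qed.

Lemma notin_offlat (z tau : Cplx) : ~ in_lattice z tau -> offlat z tau.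
Proof. intros H m n _ E; apply H; exists m, n; exact E. Qed.

Lemma notin_neq0 (z tau : Cplx) : ~ in_lattice z tau -> z <> C0.
Proof. intros H ->; apply H; exists 0%Z, 0%Z; symmetry; apply lat_00. Qed.

Lemma offlat_notin (z tau : Cplx) : offlat z tau -> z <> C0 -> ~ in_lattice z tau.
Proof.
  intros H N [m [n E]]; destruct (classic ((m, n) = (0, 0)%Z)) as [E0|E0].
  - injection E0; intros -> ->; rewrite lat_00 in E; tauto.
  - exact (H m n E0 E).
Qed.

Lemma offlat_0 (tau : Cplx) : upper_half tau -> offlat C0 tau.
Proof. intros H m n N E; apply (lat_neq0 tau m n H N); symmetry; exact E. Qed.

Lemma path_near (z a : Cplx) (P : Cplx -> Prop) :
  near z P -> near C0 (fun h => P (z + h * a)).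
Proof.
  intros [d [Hd H]]; assert (Q := Cabs_ge0 a).
  exists (d / (Cabs a + 1))%R; split; [apply Rdiv_lt_0_compat; lra|].
  intros h Hh; apply H; replace (z + h * a - z) with ((h - C0) * a) by ring; rewrite Cabs_mul.
  assert (Hh2 : Cabs (h - C0) * (Cabs a + 1) < d).
  { apply Rmult_lt_compat_r with (r := (Cabs a + 1)%R) in Hh; [|lra].
    replace (d / (Cabs a + 1) * (Cabs a + 1))%R with d in Hh by (field; lra); exact Hh. }
  generalize (Cabs_ge0 (h - C0)); nra.
Qed.

Lemma lattice_gap_path (z tau a b : Cplx) : upper_half tau -> offlat z tau ->
  exists c d, 0 < c /\ 0 < d /\ forall h, Cabs h < d -> forall m n, (m, n) <> (0, 0)%Z ->
    c * ell m n <= Cabs (z + h * a - lat (tau + h * b) m n).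
Proof.
  intros Ht Hz; destruct (lattice_gap tau z Ht Hz) as [c [d [Hc [Hd H]]]].
  destruct (near_and _ _ _ (path_near z a _ (near_ball z d Hd)) (path_near tau b _ (near_ball tau d Hd))) as [e [He G]].
  exists c, e; split; [assumption|]; split; [assumption|].
  intros h Hh; destruct (G h) as [G1 G2]; [replace (h - C0) with h by ring; assumption|].
  apply H; assumption.
Qed.

Lemma offlat_path (z tau a b : Cplx) : upper_half tau -> offlat z tau ->
  near C0 (fun h => offlat (z + h * a) (tau + h * b)).
Proof.
  intros Ht Hz; destruct (lattice_gap_path z tau a b Ht Hz) as [c [d [Hc [Hd H]]]].
  exists d; split; [assumption|]; intros h Hh m n N E.
  replace (h - C0) with h in Hh by ring.
  specialize (H h Hh m n N); rewrite E in H.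
  replace (lat (tau + h * b) m n - lat (tau + h * b) m n) with C0 in H by ring; rewrite Cabs_C0 in H.
  generalize (ell_ge1 m n); nra.
Qed.

Lemma upper_half_path (tau b : Cplx) : upper_half tau -> near C0 (fun h => upper_half (tau + h * b)).
Proof. intros H; apply path_near, upper_half_near, H. Qed.

(** [fam_A] and [fam_B] are the two elementary fractions [1 / w] and [1 / (z - w)]; every family
    below is assembled from them, [n], [z] and constants by sums and products. *)
Lemma fam_A (tau b : Cplx) : upper_half tau ->
  fam (-1) (fun h m n => C1 / lat (tau + h * b) m n)
    (fun m n => - (ZtoC n * b) / (lat tau m n * lat tau m n)).
Proof.
  intros Ht; destruct (lattice_gap_path C0 tau C0 b Ht (offlat_0 tau Ht)) as [c [d [Hc [Hd H]]]].
  assert (E : forall h m n, lat (tau + h * b) m n = lat tau m n + h * (ZtoC n * b)) by (intros; unfold lat; ring).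
  eapply fam_eq; [apply (fam_inv (lat tau) (fun m n => ZtoC n * b) (Cabs b) c d); try assumption | |].
  - apply Cabs_ge0.
  - intros m n; rewrite Cabs_mul, Cabs_ZtoC; unfold ell.
    generalize (Rabs_pos (IZR m)) (Cabs_ge0 b) (Rabs_pos (IZR n)); nra.
  - intros h Hh m n N; specialize (H h Hh m n N).
    replace (C0 + h * C0 - lat (tau + h * b) m n) with (- lat (tau + h * b) m n) in H by ring.
    rewrite Cabs_opp, E in H; exact H.
  - apply near_true; intros h m n _; simpl; rewrite E; reflexivity.
  - reflexivity.
Qed.

Lemma fam_B (z tau a b : Cplx) : upper_half tau -> offlat z tau ->
  fam (-1) (fun h m n => C1 / (z + h * a - lat (tau + h * b) m n))
    (fun m n => - (a - ZtoC n * b) / ((z - lat tau m n) * (z - lat tau m n))).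
Proof.
  intros Ht Hz; destruct (lattice_gap_path z tau a b Ht Hz) as [c [d [Hc [Hd H]]]].
  assert (E : forall h m n, z + h * a - lat (tau + h * b) m n = (z - lat tau m n) + h * (a - ZtoC n * b)) by (intros; unfold lat; ring).
  eapply fam_eq; [apply (fam_inv (fun m n => z - lat tau m n) (fun m n => a - ZtoC n * b) (Cabs a + Cabs b) c d); try assumption | |].
  - generalize (Cabs_ge0 a) (Cabs_ge0 b); lra.
  - intros m n; eapply Rle_trans; [apply Cabs_sub_triang|]; rewrite Cabs_mul, Cabs_ZtoC; unfold ell.
    generalize (Rabs_pos (IZR m)) (Cabs_ge0 b) (Rabs_pos (IZR n)) (Cabs_ge0 a); nra.
  - intros h Hh m n N; specialize (H h Hh m n N); rewrite E in H; exact H.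
  - apply near_true; intros h m n _; simpl; rewrite E; reflexivity.
  - reflexivity.
Qed.

(** Asks for more than two partial derivatives: the curve [(r + s tau, tau)] and translation by
    [tau] both need directions in which the two variables move. *)
Definition Der2 (f : Cplx -> Cplx -> Cplx) (z tau fz ft : Cplx) : Prop :=
  forall a b, Cder (fun h => f (z + h * a) (tau + h * b)) C0 (a * fz + b * ft).

Lemma Der2_sum (F : Cplx -> Cplx -> Z -> Z -> Cplx) (z tau : Cplx) (f g : Z -> Z -> Cplx) :
  (forall a b, fam (-3) (fun h => F (z + h * a) (tau + h * b)) (fun m n => a * f m n + b * g m n)) ->
  Der2 (fun z tau => lsum' (F z tau)) z tau (lsum' f) (lsum' g).
Proof.
  intros H a b; destruct (fam_sum _ _ (H a b)) as [D _].
  (* The two coordinate directions show that [f] and [g] are dominated separately, so that the sum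
     of their combination splits. *)
  destruct (fam_sum _ _ (H C1 C0)) as [_ [K [_ [D1 _]]]].
  destruct (fam_sum _ _ (H C0 C1)) as [_ [L [_ [D2 _]]]].
  assert (D1' : dominated f K).
  { intros m n N; specialize (D1 m n N); replace (f m n) with (C1 * f m n + C0 * g m n) by ring; exact D1. }
  assert (D2' : dominated g L).
  { intros m n N; specialize (D2 m n N); replace (g m n) with (C0 * f m n + C1 * g m n) by ring; exact D2. }
  eapply Cder_eq; [exact D|].
  rewrite (lsum_plus _ _ _ _ (dominated_scal a _ _ D1') (dominated_scal b _ _ D2')).
  rewrite (lsum_scal _ _ _ D1'), (lsum_scal _ _ _ D2'); reflexivity.
Qed.

Lemma Der2_plus (f g : Cplx -> Cplx -> Cplx) (z tau fz ft gz gt : Cplx) :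
  Der2 f z tau fz ft -> Der2 g z tau gz gt ->
  Der2 (fun z tau => f z tau + g z tau) z tau (fz + gz) (ft + gt).
Proof.
  intros Hf Hg a b; eapply Cder_eq; [exact (Cder_plus _ _ _ _ _ (Hf a b) (Hg a b)) | ring].
Qed.

Lemma Cder_path (z a : Cplx) : Cder (fun h => z + h * a) C0 a.
Proof.
  eapply Cder_eq; [apply Cder_plus; [apply Cder_const | apply Cder_mult; [apply Cder_id | apply Cder_const]]|].
  simpl; ring.
Qed.

Lemma Der2_eq (f : Cplx -> Cplx -> Cplx) (z tau fz ft gz gt : Cplx) :
  Der2 f z tau fz ft -> fz = gz -> ft = gt -> Der2 f z tau gz gt.
Proof. intros H <- <-; exact H. Qed.

Lemma Der2_z (f : Cplx -> Cplx -> Cplx) (z tau fz ft : Cplx) :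
  Der2 f z tau fz ft -> Cder (fun w => f w tau) z fz.
Proof.
  intros H; specialize (H C1 C0).
  apply Cder_ext with (fun w => (fun h => f (z + h * C1) (tau + h * C0)) (- z + C1 * w)).
  - apply near_true; intros w; f_equal; ring.
  - replace fz with (C1 * (C1 * fz + C0 * ft)) by ring.
    intros e He; destruct (H e He) as [d [Hd L]]; exists d; split; [assumption|].
    intros w Hw; specialize (L (w - z)).
    replace (w - z - C0) with (w - z) in L by ring; specialize (L Hw).
    replace (- z + C1 * w) with (w - z) by ring; replace (- z + C1 * z) with C0 by ring.
    replace (C1 * (C1 * fz + C0 * ft)) with (C1 * fz + C0 * ft) by ring; exact L.
Qed.

Lemma Der2_invpow (c z tau : Cplx) (k : nat) : z <> C0 ->
  Der2 (fun z _ => c / z ^ k) z tau (- (Cnat k * c) / z ^ S k) C0.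
Proof.
  intros Nz a b; induction k as [|k IH].
  - eapply Cder_eq; [apply Cder_ext with (fun _ => c); [|apply Cder_const]|].
    + apply near_true; intros; simpl; field; apply C1_neq_C0.
    + unfold Cnat; simpl; field; assumption.
  - assert (Nz0 : z + C0 * a <> C0) by (replace (z + C0 * a) with z by ring; assumption).
    eapply Cder_eq; [apply Cder_ext with (fun h => c / (z + h * a) ^ k * (C1 / (z + h * a)))|].
    + generalize (Ccont_neq0 _ _ (Cder_cont _ _ _ (Cder_path z a)) Nz0); apply near_imp; intros h Hh.
      simpl; assert (Np := Cpow_neq0 _ k Hh); cfield.
    + apply Cder_mult; [exact IH|]; apply Cder_inv; [apply Cder_path | exact Nz0].
    + simpl; replace (z + C0 * a) with z by ring.
      assert (Np := Cpow_neq0 z k Nz).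
      replace (Cnat (S k)) with (Cnat k + C1) by (unfold Cnat; rewrite S_INR; apply Cplx_eq; simpl; ring).
      cfield.
Qed.

(* Partial derivatives of [wzeta], [wp] and [wp'] in [tau] at fixed [z]. *)
Definition zt (z tau : Cplx) : Cplx :=
  lsum' (fun m n => ZtoC n * (C1 / (z - lat tau m n) ^ 2 - C1 / lat tau m n ^ 2
    - RtoC 2 * z / lat tau m n ^ 3)).
Definition wpt (z tau : Cplx) : Cplx :=
  lsum' (fun m n => ZtoC n * (RtoC 2 / (z - lat tau m n) ^ 3 + RtoC 2 / lat tau m n ^ 3)).
Definition wpt' (z tau : Cplx) : Cplx :=
  lsum' (fun m n => ZtoC n * (- RtoC 6 / (z - lat tau m n) ^ 4)).
Definition wp2 (z tau : Cplx) : Cplx :=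
  RtoC 6 / z ^ 4 + lsum' (fun m n => RtoC 6 / (z - lat tau m n) ^ 4).
Definition wp3 (z tau : Cplx) : Cplx :=
  - RtoC 24 / z ^ 5 + lsum' (fun m n => - RtoC 24 / (z - lat tau m n) ^ 5).

Lemma path_good (z tau a b : Cplx) : upper_half tau -> offlat z tau ->
  near C0 (fun h => upper_half (tau + h * b) /\ offlat (z + h * a) (tau + h * b)).
Proof. intros Ht Hz; apply near_and; [apply upper_half_path | apply offlat_path]; assumption. Qed.

Ltac fam_value G :=
  generalize G; apply near_imp; let h := fresh in let Hw := fresh in let Hu := fresh in let N := fresh in
  intros h [Hw Hu] m n N;
  assert (Hw2 := lat_neq0 _ m n Hw N); assert (Hu2 := Csub_neq0 _ _ (Hu m n N)); simpl; cfield.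
Ltac path_at0 := repeat match goal with |- context [?x + C0 * ?y] => replace (x + C0 * y) with x by ring end.
Ltac fam_deriv Ht Hz :=
  let N := fresh in intros m n N; assert (Hw2 := lat_neq0 _ m n Ht N);
  assert (Hu2 := Csub_neq0 _ _ (Hz m n N)); simpl; path_at0; cfield.

(** * The lattice series and their termwise derivatives *)

Section LatticeFamilies.
Variables z tau a b : Cplx.
Hypothesis Ht : upper_half tau.
Hypothesis Hz : offlat z tau.

Local Notation "x ** y" := (fam_mult _ _ _ _ _ _ x y) (at level 40, left associativity).
Local Notation "x +++ y" := (fam_plus _ _ _ _ _ x y) (at level 50, left associativity).
Let G := path_good z tau a b Ht Hz.
Let A := fam_A tau b Ht.
Let B := fam_B z tau a b Ht Hz.
Let X := fam_lin z a.
Let c (x : Cplx) := fam_cst x.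

(** The three fractions, each too large on its own, combine into [z^2 / (w^2 (z - w))]. Writing the
    term as this product exhibits its order [-3]; the other families are factored for the same
    purpose. *)
Lemma fam_zeta : fam (-3)
  (fun h m n => C1 / (z + h * a - lat (tau + h * b) m n) + C1 / lat (tau + h * b) m n
     + (z + h * a) / lat (tau + h * b) m n ^ 2)
  (fun m n => a * (- C1 * (C1 / (z - lat tau m n) ^ 2 - C1 / lat tau m n ^ 2))
    + b * (ZtoC n * (C1 / (z - lat tau m n) ^ 2 - C1 / lat tau m n ^ 2 - RtoC 2 * z / lat tau m n ^ 3))).
Proof. eapply fam_eq; [exact (X ** X ** A ** A ** B) | fam_value G | fam_deriv Ht Hz]. Qed.

Lemma fam_wp : fam (-3)
  (fun h m n => C1 / (z + h * a - lat (tau + h * b) m n) ^ 2 - C1 / lat (tau + h * b) m n ^ 2)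
  (fun m n => a * (Copp (RtoC 2) / (z - lat tau m n) ^ 3)
    + b * (ZtoC n * (RtoC 2 / (z - lat tau m n) ^ 3 + RtoC 2 / lat tau m n ^ 3))).
Proof. eapply fam_eq; [exact (X ** A ** B ** (B +++ c (- C1) ** A)) | fam_value G | fam_deriv Ht Hz]. Qed.

Lemma fam_wp' : fam (-3)
  (fun h m n => Copp (RtoC 2) / (z + h * a - lat (tau + h * b) m n) ^ 3)
  (fun m n => a * (RtoC 6 / (z - lat tau m n) ^ 4)
    + b * (ZtoC n * (- RtoC 6 / (z - lat tau m n) ^ 4))).
Proof. eapply fam_eq; [exact (c (- RtoC 2) ** B ** B ** B) | fam_value G | fam_deriv Ht Hz]. Qed.

Lemma fam_zt : fam (-3)
  (fun h m n => ZtoC n * (C1 / (z + h * a - lat (tau + h * b) m n) ^ 2 - C1 / lat (tau + h * b) m n ^ 2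
    - RtoC 2 * (z + h * a) / lat (tau + h * b) m n ^ 3))
  (fun m n => a * (- C1 * (ZtoC n * (RtoC 2 / (z - lat tau m n) ^ 3 + RtoC 2 / lat tau m n ^ 3)))
    + b * (ZtoC n * ZtoC n * (RtoC 2 / (z - lat tau m n) ^ 3 + RtoC 2 / lat tau m n ^ 3 + RtoC 6 * z / lat tau m n ^ 4))).
Proof.
  eapply fam_eq; [exact (fam_n ** X ** X ** A ** A ** B ** (B +++ c (- RtoC 2) ** A))
    | fam_value G | fam_deriv Ht Hz].
Qed.

(** A sum of two cubes: its factor [1 / (z - w) + 1 / w = z / (w (z - w))] gains the power of [ell]
    that the weight [n] costs. *)
Lemma fam_wpt : fam (-3)
  (fun h m n => ZtoC n * (RtoC 2 / (z + h * a - lat (tau + h * b) m n) ^ 3 + RtoC 2 / lat (tau + h * b) m n ^ 3))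
  (fun m n => a * (ZtoC n * (- RtoC 6 / (z - lat tau m n) ^ 4))
    + b * (ZtoC n * ZtoC n * (RtoC 6 / (z - lat tau m n) ^ 4 - RtoC 6 / lat tau m n ^ 4))).
Proof.
  eapply fam_eq; [exact (c (RtoC 2) ** fam_n ** X ** A ** B ** (A ** A +++ c (- C1) ** A ** B +++ B ** B))
    | fam_value G | fam_deriv Ht Hz].
Qed.

Lemma fam_wpt' : fam (-3)
  (fun h m n => ZtoC n * (- RtoC 6 / (z + h * a - lat (tau + h * b) m n) ^ 4))
  (fun m n => a * (ZtoC n * (RtoC 24 / (z - lat tau m n) ^ 5))
    + b * (ZtoC n * ZtoC n * (- RtoC 24 / (z - lat tau m n) ^ 5))).
Proof.
  eapply fam_eq; [exact (c (- RtoC 6) ** fam_n ** B ** B ** B ** B) | fam_value G | fam_deriv Ht Hz].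
Qed.

Lemma fam_wp2 : fam (-3)
  (fun h m n => RtoC 6 / (z + h * a - lat (tau + h * b) m n) ^ 4)
  (fun m n => a * (- RtoC 24 / (z - lat tau m n) ^ 5) + b * (ZtoC n * (RtoC 24 / (z - lat tau m n) ^ 5))).
Proof.
  eapply fam_eq; [apply (fam_weaken (-4) (-3)); [lia | exact (c (RtoC 6) ** B ** B ** B ** B)]
    | fam_value G | fam_deriv Ht Hz].
Qed.

Lemma fam_wp3 : fam (-3)
  (fun h m n => - RtoC 24 / (z + h * a - lat (tau + h * b) m n) ^ 5)
  (fun m n => a * (RtoC 120 / (z - lat tau m n) ^ 6) + b * (ZtoC n * (- RtoC 120 / (z - lat tau m n) ^ 6))).
Proof.
  eapply fam_eq; [apply (fam_weaken (-5) (-3)); [lia | exact (c (- RtoC 24) ** B ** B ** B ** B ** B)]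
    | fam_value G | fam_deriv Ht Hz].
Qed.

(** Of the remainders only convergence and continuity along a line will be asked, so their
    derivative is left existential. *)
Lemma fam_remS : exists F', fam (-3)
  (fun h m n => C1 / (lat (tau + h * b) m n ^ 3 * (z + h * a - lat (tau + h * b) m n))) F'.
Proof.
  eexists; eapply fam_eq; [apply (fam_weaken (-4) (-3)); [lia | exact (A ** A ** A ** B)]
    | fam_value G | reflexivity].
Qed.

Lemma fam_remT : exists F', fam (-3)
  (fun h m n => (C1 / (z + h * a - lat (tau + h * b) m n) - RtoC 2 / lat (tau + h * b) m n)
     / (lat (tau + h * b) m n ^ 2 * (z + h * a - lat (tau + h * b) m n))) F'.
Proof.
  eexists; eapply fam_eq; [apply (fam_weaken (-4) (-3)); [lia | exact (A ** A ** B ** (B +++ c (- RtoC 2) ** A))]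
    | fam_value G | reflexivity].
Qed.

Lemma fam_remU : exists F', fam (-3)
  (fun h m n => (C1 / lat (tau + h * b) m n ^ 2
      - C1 / (lat (tau + h * b) m n * (z + h * a - lat (tau + h * b) m n))
      + C1 / (z + h * a - lat (tau + h * b) m n) ^ 2)
     / (lat (tau + h * b) m n * (z + h * a - lat (tau + h * b) m n))) F'.
Proof.
  eexists; eapply fam_eq; [apply (fam_weaken (-4) (-3)); [lia | exact (A ** B ** (A ** A +++ c (- C1) ** A ** B +++ B ** B))]
    | fam_value G | reflexivity].
Qed.

Lemma fam_invpow4 : exists F', fam (-3) (fun h m n => C1 / lat (tau + h * b) m n ^ 4) F'.
Proof.
  eexists; eapply fam_eq; [apply (fam_weaken (-4) (-3)); [lia | exact (A ** A ** A ** A)]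
    | fam_value G | reflexivity].
Qed.

Lemma fam_invpow3 : exists F', fam (-3) (fun h m n => C1 / lat (tau + h * b) m n ^ 3) F'.
Proof. eexists; eapply fam_eq; [exact (A ** A ** A) | fam_value G | reflexivity]. Qed.

End LatticeFamilies.

(** * Laurent expansions at the origin *)

(** [remS], [remT] and [remU] are what is left of [wzeta], [wp] and [wp'] after the polar part,
    divided by [z^3], [z^2] and [- 2 z]. Being regular at the origin, they turn the cancellation of
    poles into polynomial algebra. *)
Definition remS (z tau : Cplx) : Cplx :=
  lsum' (fun m n => C1 / (lat tau m n ^ 3 * (z - lat tau m n))).
Definition remT (z tau : Cplx) : Cplx :=
  lsum' (fun m n => (C1 / (z - lat tau m n) - RtoC 2 / lat tau m n) / (lat tau m n ^ 2 * (z - lat tau m n))).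
Definition remU (z tau : Cplx) : Cplx :=
  lsum' (fun m n => (C1 / lat tau m n ^ 2 - C1 / (lat tau m n * (z - lat tau m n)) + C1 / (z - lat tau m n) ^ 2)
     / (lat tau m n * (z - lat tau m n))).

Lemma fam_dominated (F : Cplx -> Z -> Z -> Cplx) (F' : Z -> Z -> Cplx) :
  fam (-3) F F' -> exists K, dominated (F C0) K.
Proof. intros H; destruct (fam_sum _ _ H) as [_ [K [_ [_ D]]]]; exists K; exact (near_pt _ _ D). Qed.

Lemma fam_ex_dominated (F : Cplx -> Z -> Z -> Cplx) :
  (exists F', fam (-3) F F') -> exists K, dominated (F C0) K.
Proof. intros [F' H]; exact (fam_dominated _ _ H). Qed.

Lemma fam_ex_Cder (F : Cplx -> Z -> Z -> Cplx) :
  (exists F', fam (-3) F F') -> exists l, Cder (fun h => lsum' (F h)) C0 l.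
Proof. intros [F' H]; exists (lsum' F'); apply (fam_sum _ _ H). Qed.

Lemma path0 (z a : Cplx) : z + C0 * a = z.
Proof. ring. Qed.

Lemma lat_opp (tau : Cplx) (m n : Z) : lat tau (- m) (- n) = - lat tau m n.
Proof. unfold lat, ZtoC, RtoC; rewrite !opp_IZR; apply Cplx_eq; simpl; ring. Qed.

Lemma ZtoC_opp (n : Z) : ZtoC (- n) = - ZtoC n.
Proof. unfold ZtoC, RtoC; rewrite opp_IZR; apply Cplx_eq; simpl; ring. Qed.

Lemma dominated_invpow3 (tau : Cplx) : upper_half tau -> exists K, dominated (fun m n => C1 / lat tau m n ^ 3) K.
Proof.
  intros Ht; destruct (fam_ex_dominated _ (fam_invpow3 C0 tau C0 C0 Ht (offlat_0 tau Ht))) as [K D].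
  exists K; rewrite path0 in D; exact D.
Qed.

Lemma lsum_invpow3 (tau : Cplx) : upper_half tau -> lsum' (fun m n => C1 / lat tau m n ^ 3) = C0.
Proof.
  intros Ht; destruct (dominated_invpow3 tau Ht) as [K D].
  set (s := lsum' _) in *.
  assert (E : s = - C1 * s).
  { unfold s at 2; rewrite <- (lsum_scal _ _ _ D), <- lsum_reflect; apply lsum_ext; intros m n N.
    assert (W := lat_neq0 tau m n Ht N); rewrite lat_opp; simpl; cfield.
    intros E; apply W; replace (lat tau m n) with (- - lat tau m n) by ring; rewrite E; ring. }
  replace s with ((s - - C1 * s) / RtoC 2) by (cfield).
  rewrite <- E; replace (s - s) with C0 by ring; cfield.
Qed.

Section ExpansionsAtZero.
Variables z tau : Cplx.
Hypothesis Ht : upper_half tau.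
Hypothesis Hz : offlat z tau.

Lemma wzeta_expand : wzeta z tau = C1 / z + z ^ 3 * remS z tau.
Proof.
  destruct (dominated_invpow3 tau Ht) as [K D].
  destruct (fam_ex_dominated _ (fam_remS z tau C0 C0 Ht Hz)) as [L D2]; rewrite !path0 in D2.
  unfold wzeta; f_equal.
  (* Splitting off the odd term [1 / w^3], whose sum vanishes, gains one more power of [z]. *)
  transitivity (lsum' (fun m n => z ^ 3 * (C1 / (lat tau m n ^ 3 * (z - lat tau m n))) + - z ^ 2 * (C1 / lat tau m n ^ 3))).
  - apply lsum_ext; intros m n N; assert (W := lat_neq0 tau m n Ht N); assert (W2 := Csub_neq0 _ _ (Hz m n N)); simpl; cfield.
  - rewrite (lsum_plus _ _ _ _ (dominated_scal _ _ _ D2) (dominated_scal _ _ _ D)), (lsum_scal _ _ _ D), (lsum_scal _ _ _ D2).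
    rewrite lsum_invpow3 by assumption; unfold remS; ring.
Qed.

Lemma wp_expand : wp z tau = C1 / z ^ 2 + z ^ 2 * remT z tau.
Proof.
  destruct (dominated_invpow3 tau Ht) as [K D].
  destruct (fam_ex_dominated _ (fam_remT z tau C0 C0 Ht Hz)) as [L D2]; rewrite !path0 in D2.
  unfold wp; f_equal.
  transitivity (lsum' (fun m n => z ^ 2 * ((C1 / (z - lat tau m n) - RtoC 2 / lat tau m n) / (lat tau m n ^ 2 * (z - lat tau m n))) + RtoC 2 * z * (C1 / lat tau m n ^ 3))).
  - apply lsum_ext; intros m n N; assert (W := lat_neq0 tau m n Ht N); assert (W2 := Csub_neq0 _ _ (Hz m n N)); simpl; cfield.
  - rewrite (lsum_plus _ _ _ _ (dominated_scal _ _ _ D2) (dominated_scal _ _ _ D)), (lsum_scal _ _ _ D), (lsum_scal _ _ _ D2).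
    rewrite lsum_invpow3 by assumption; unfold remT; ring.
Qed.

Lemma wp'_expand : wp' z tau = - RtoC 2 / z ^ 3 + - (RtoC 2 * z) * remU z tau.
Proof.
  destruct (dominated_invpow3 tau Ht) as [K D].
  destruct (fam_ex_dominated _ (fam_remU z tau C0 C0 Ht Hz)) as [L D2]; rewrite !path0 in D2.
  unfold wp'; f_equal.
  transitivity (lsum' (fun m n => - (RtoC 2 * z) * ((C1 / lat tau m n ^ 2 - C1 / (lat tau m n * (z - lat tau m n)) + C1 / (z - lat tau m n) ^ 2)
     / (lat tau m n * (z - lat tau m n))) + RtoC 2 * (C1 / lat tau m n ^ 3))).
  - apply lsum_ext; intros m n N; assert (W := lat_neq0 tau m n Ht N); assert (W2 := Csub_neq0 _ _ (Hz m n N)); simpl; cfield.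
  - rewrite (lsum_plus _ _ _ _ (dominated_scal _ _ _ D2) (dominated_scal _ _ _ D)), (lsum_scal _ _ _ D), (lsum_scal _ _ _ D2).
    rewrite lsum_invpow3 by assumption; unfold remU; ring.
Qed.
End ExpansionsAtZero.

Lemma lsum_multiple (tau c : Cplx) (f : Z -> Z -> Cplx) : upper_half tau ->
  (forall m n, (m, n) <> (0, 0)%Z -> f m n = c * (C1 / lat tau m n ^ 4)) ->
  lsum' f = c / RtoC 60 * g2 tau.
Proof.
  intros Ht E.
  destruct (fam_ex_dominated _ (fam_invpow4 C0 tau C0 C0 Ht (offlat_0 tau Ht))) as [K D]; rewrite path0 in D.
  rewrite (lsum_ext _ _ E), (lsum_scal _ _ _ D); unfold g2; cfield.
Qed.

Lemma Copp_invol (z : Cplx) : - - z = z.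
Proof. ring. Qed.

Ltac rem_at0 Ht := apply lsum_multiple; [exact Ht|]; intros m n N; assert (W := lat_neq0 _ m n Ht N);
  assert (W2 : - lat _ m n <> C0) by (intros E; apply W; rewrite <- (Copp_invol (lat _ m n)), E; ring); simpl; cfield.

(** At [z = 0] each remainder is an integer multiple of the sum of [1 / w^4]; the denominator 60 is
    the normalisation of [g2]. These are the first Laurent coefficients. *)
Lemma remS_0 (tau : Cplx) : upper_half tau -> remS C0 tau = - C1 / RtoC 60 * g2 tau.
Proof. intros Ht; rem_at0 Ht. Qed.
Lemma remT_0 (tau : Cplx) : upper_half tau -> remT C0 tau = RtoC 3 / RtoC 60 * g2 tau.
Proof. intros Ht; rem_at0 Ht. Qed.
Lemma remU_0 (tau : Cplx) : upper_half tau -> remU C0 tau = - RtoC 3 / RtoC 60 * g2 tau.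
Proof. intros Ht; rem_at0 Ht. Qed.
Lemma wp2_rem_0 (tau : Cplx) : upper_half tau ->
  lsum' (fun m n => RtoC 6 / (C0 - lat tau m n) ^ 4) = RtoC 6 / RtoC 60 * g2 tau.
Proof. intros Ht; rem_at0 Ht. Qed.

Lemma wpt_0 (tau : Cplx) : upper_half tau -> wpt C0 tau = C0.
Proof.
  intros Ht; replace C0 with (C0 / RtoC 60 * g2 tau) at 2 by cfield.
  rem_at0 Ht.
Qed.

(** * Derivatives of zeta, wp and wp' *)

Lemma Cnat_Z (k : nat) : Cnat k = ZtoC (Z.of_nat k).
Proof. unfold Cnat, ZtoC; rewrite INR_IZR_INZ; reflexivity. Qed.

Section Derivatives.
Variables z tau : Cplx.
Hypothesis Ht : upper_half tau.
Hypothesis Hz : ~ in_lattice z tau.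

Let Ho := notin_offlat z tau Hz.
Let Nz := notin_neq0 z tau Hz.

Lemma lsum_opp_fam (F : Cplx -> Z -> Z -> Cplx) (F' : Z -> Z -> Cplx) :
  fam (-3) F F' -> lsum' (fun m n => - C1 * F C0 m n) = - lsum' (F C0).
Proof.
  intros H; destruct (fam_dominated _ _ H) as [K D]; rewrite (lsum_scal _ _ _ D); ring.
Qed.

Lemma Der2_wzeta : Der2 wzeta z tau (- wp z tau) (zt z tau).
Proof.
  assert (E := lsum_opp_fam _ _ (fam_wp z tau C0 C0 Ht Ho)); cbv beta in E; rewrite ?path0 in E.
  eapply Der2_eq; [apply Der2_plus;
    [|apply (Der2_sum (fun z tau m n => C1 / (z - lat tau m n) + C1 / lat tau m n + z / lat tau m n ^ 2));
      intros a b; exact (fam_zeta z tau a b Ht Ho)] | |].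
  - intros a b; eapply Cder_eq;
      [apply Cder_inv; [apply Cder_path | rewrite path0; assumption] | cbv beta; rewrite path0].
    instantiate (1 := C0); instantiate (1 := - C1 / z ^ 2); simpl; cfield.
  - rewrite E; unfold wp; simpl; cfield.
  - unfold zt; ring.
Qed.

Lemma Der2_wp : Der2 wp z tau (wp' z tau) (wpt z tau).
Proof.
  eapply Der2_eq; [apply Der2_plus; [apply Der2_invpow; assumption
    | apply (Der2_sum (fun z tau m n => C1 / (z - lat tau m n) ^ 2 - C1 / lat tau m n ^ 2));
      intros a b; exact (fam_wp z tau a b Ht Ho)] | |].
  - unfold wp'; f_equal; rewrite Cnat_Z; simpl; cfield.
  - unfold wpt; ring.
Qed.

Lemma Der2_wp' : Der2 wp' z tau (wp2 z tau) (wpt' z tau).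
Proof.
  eapply Der2_eq; [apply Der2_plus; [apply Der2_invpow; assumption
    | apply (Der2_sum (fun z tau m n => Copp (RtoC 2) / (z - lat tau m n) ^ 3));
      intros a b; exact (fam_wp' z tau a b Ht Ho)] | |].
  - unfold wp2; f_equal; rewrite Cnat_Z; simpl; cfield.
  - unfold wpt'; ring.
Qed.

Lemma Cder_wp2 : Cder (fun w => wp2 w tau) z (wp3 z tau).
Proof.
  eapply Der2_z, Der2_eq; [apply Der2_plus; [apply Der2_invpow; assumption
    | apply (Der2_sum (fun z tau m n => RtoC 6 / (z - lat tau m n) ^ 4));
      intros a b; exact (fam_wp2 z tau a b Ht Ho)] | | reflexivity].
  unfold wp3; f_equal; rewrite Cnat_Z; simpl; cfield.
Qed.

(** Liouville's theorem differentiates under an integral sign and so asks for a continuous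
    derivative; [wp3] occurs in the derivative of [wp2 - 6 wp^2]. *)
Lemma Ccont_wp3 : Ccont (fun w => wp3 w tau) z.
Proof.
  eapply Cder_cont, Der2_z, Der2_plus; [apply Der2_invpow; assumption
    | apply (Der2_sum (fun z tau m n => - RtoC 24 / (z - lat tau m n) ^ 5));
      intros a b; exact (fam_wp3 z tau a b Ht Ho)].
Qed.

Lemma Cder_zt : Cder (fun w => zt w tau) z (- wpt z tau).
Proof.
  assert (E := lsum_opp_fam _ _ (fam_wpt z tau C0 C0 Ht Ho)); cbv beta in E; rewrite ?path0 in E.
  eapply Der2_z, Der2_eq;
    [apply (Der2_sum (fun z tau m n => ZtoC n * (C1 / (z - lat tau m n) ^ 2 - C1 / lat tau m n ^ 2
    - RtoC 2 * z / lat tau m n ^ 3))); intros a b; exact (fam_zt z tau a b Ht Ho) | | reflexivity].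
  exact E.
Qed.

Lemma Cder_wpt : Cder (fun w => wpt w tau) z (wpt' z tau).
Proof.
  eapply Der2_z.
  apply (Der2_sum (fun z tau m n => ZtoC n * (RtoC 2 / (z - lat tau m n) ^ 3 + RtoC 2 / lat tau m n ^ 3)));
    intros a b; exact (fam_wpt z tau a b Ht Ho).
Qed.

Lemma Ccont_wpt' : Ccont (fun w => wpt' w tau) z.
Proof.
  eapply Cder_cont, Der2_z.
  apply (Der2_sum (fun z tau m n => ZtoC n * (- RtoC 6 / (z - lat tau m n) ^ 4)));
    intros a b; exact (fam_wpt' z tau a b Ht Ho).
Qed.

End Derivatives.

(** * The lattice and its complement *)

Lemma notin_near (z tau : Cplx) : upper_half tau -> ~ in_lattice z tau ->
  near z (fun w => ~ in_lattice w tau).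
Proof.
  intros Ht Hz; assert (Ho := notin_offlat z tau Hz); assert (Nz := notin_neq0 z tau Hz).
  destruct (lattice_gap tau z Ht Ho) as [c [d [Hc [Hd H]]]].
  generalize (near_and _ _ _ (near_ball z d Hd) (Ccont_neq0 (fun w => w) z (Clim_at_id z) Nz)).
  apply near_imp; intros w [H1 H2]; apply offlat_notin; [|assumption].
  intros m n N E; specialize (H w tau H1).
  replace (tau - tau) with C0 in H by ring; rewrite Cabs_C0 in H; specialize (H Hd m n N).
  rewrite E in H; replace (lat tau m n - lat tau m n) with C0 in H by ring; rewrite Cabs_C0 in H.
  generalize (ell_ge1 m n); nra.
Qed.

Lemma notin_path (z tau a b : Cplx) : upper_half tau -> ~ in_lattice z tau ->
  near C0 (fun h => upper_half (tau + h * b) /\ ~ in_lattice (z + h * a) (tau + h * b)).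
Proof.
  intros Ht Hz; assert (Ho := notin_offlat z tau Hz); assert (Nz := notin_neq0 z tau Hz).
  assert (N0 : z + C0 * a <> C0) by (rewrite path0; assumption).
  generalize (near_and _ _ _ (path_good z tau a b Ht Ho) (Ccont_neq0 _ _ (Cder_cont _ _ _ (Cder_path z a)) N0)).
  apply near_imp; intros h [[H1 H2] H3]; split; [assumption | apply offlat_notin; assumption].
Qed.

Lemma small_notin (tau : Cplx) : upper_half tau -> near C0 (fun z => offlat z tau).
Proof.
  intros Ht; generalize (offlat_path C0 tau C1 C0 Ht (offlat_0 tau Ht)); apply near_imp; intros z.
  replace (C0 + z * C1) with z by ring; replace (tau + z * C0) with tau by ring; auto.
Qed.

Lemma in_lattice_shift (z tau : Cplx) (m n : Z) :
  in_lattice (z + lat tau m n) tau <-> in_lattice z tau.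
Proof.
  assert (P : forall w m n, in_lattice w tau -> in_lattice (w + lat tau m n) tau).
  { intros w p q [a [b ->]]; exists (a + p)%Z, (b + q)%Z.
    unfold lat, ZtoC, RtoC; rewrite !plus_IZR; apply Cplx_eq; simpl; ring. }
  split; [|apply P]; intros H; apply (P _ (- m)%Z (- n)%Z) in H.
  rewrite lat_opp in H; replace (z + lat tau m n + - lat tau m n) with z in H by ring; exact H.
Qed.

Lemma lat_10 (tau : Cplx) : lat tau 1 0 = C1.
Proof. unfold lat; ring. Qed.
Lemma lat_01 (tau : Cplx) : lat tau 0 1 = tau.
Proof. unfold lat; ring. Qed.

Lemma in_lattice_1 (z tau : Cplx) : in_lattice (z + C1) tau <-> in_lattice z tau.
Proof. rewrite <- (lat_10 tau); apply in_lattice_shift. Qed.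
Lemma in_lattice_tau (z tau : Cplx) : in_lattice (z + tau) tau <-> in_lattice z tau.
Proof. rewrite <- (lat_01 tau) at 1; apply in_lattice_shift. Qed.

Lemma in_lattice_opp (z tau : Cplx) : in_lattice (- z) tau <-> in_lattice z tau.
Proof.
  assert (P : forall w, in_lattice w tau -> in_lattice (- w) tau).
  { intros w [m [n ->]]; exists (- m)%Z, (- n)%Z; symmetry; apply lat_opp. }
  split; [|apply P]; intros H; apply P in H; rewrite Copp_invol in H; exact H.
Qed.

Lemma in_lattice_coords (tau : Cplx) (x y : R) : upper_half tau ->
  in_lattice (RtoC x + RtoC y * tau) tau -> exists m n : Z, x = IZR m /\ y = IZR n.
Proof.
  unfold upper_half; intros Ht [m [n E]]; exists m, n.
  assert (EI := f_equal Im E); assert (ER := f_equal Re E).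
  unfold lat, ZtoC, RtoC in *; simpl in *.
  assert (y = IZR n) by (apply Rmult_eq_reg_r with (Im tau); lra).
  subst; split; lra.
Qed.

Lemma half_not_IZR (m : Z) : (1 / 2)%R <> IZR m.
Proof.
  intros E; assert (E2 : IZR (2 * m) = IZR 1) by (rewrite mult_IZR; lra).
  apply eq_IZR in E2; lia.
Qed.

Lemma half1_notin (tau : Cplx) : upper_half tau -> ~ in_lattice (RtoC (1 / 2)) tau.
Proof.
  intros Ht H; destruct (in_lattice_coords tau (1 / 2) 0 Ht) as [m [n [E _]]].
  - replace (RtoC (1 / 2) + RtoC 0 * tau) with (RtoC (1 / 2)) by ring; exact H.
  - exact (half_not_IZR m E).
Qed.

Lemma half2_eq (tau : Cplx) : tau / RtoC 2 = RtoC 0 + RtoC (1 / 2) * tau.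
Proof.
  replace (RtoC (1 / 2)) with (C1 / RtoC 2); [cfield|].
  apply Cplx_eq; unfold Cdiv, Cinv, Cnorm2; simpl; field.
Qed.

Lemma half2_notin (tau : Cplx) : upper_half tau -> ~ in_lattice (tau / RtoC 2) tau.
Proof.
  intros Ht H; rewrite half2_eq in H.
  destruct (in_lattice_coords tau 0 (1 / 2) Ht H) as [m [n [_ E]]]; exact (half_not_IZR n E).
Qed.

Lemma Copp_neq0 (z : Cplx) : z <> C0 -> - z <> C0.
Proof. intros N E; apply N; rewrite <- (Copp_invol z), E; ring. Qed.

(** * Parity *)

Section Parity.
Variables z tau : Cplx.
Hypothesis Ht : upper_half tau.
Hypothesis Hz : ~ in_lattice z tau.
Let Ho := notin_offlat z tau Hz.
Let Nz := notin_neq0 z tau Hz.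

Ltac reflect_term := rewrite <- lsum_reflect; apply lsum_ext; intros m n Nmn;
  assert (W := lat_neq0 tau m n Ht Nmn); assert (W2 := Csub_neq0 _ _ (Ho m n Nmn));
  rewrite ?lat_opp, ?ZtoC_opp; simpl;
  replace (- z - - lat tau m n) with (- (z - lat tau m n)) by ring;
  assert (W3 : - (z - lat tau m n) <> C0) by (apply Copp_neq0; exact W2);
  assert (W4 : - lat tau m n <> C0) by (apply Copp_neq0; exact W);
  set (u := z - lat tau m n) in *; set (w := lat tau m n) in *; cfield.

Lemma wzeta_odd : wzeta (- z) tau = - wzeta z tau.
Proof.
  assert (N := Copp_neq0 z Nz); assert (E := lsum_opp_fam _ _ (fam_zeta z tau C0 C0 Ht Ho)); cbv beta in E; rewrite ?path0 in E.
  unfold wzeta; transitivity (- C1 / z + - lsum' (fun m n => C1 / (z - lat tau m n) + C1 / lat tau m n + z / lat tau m n ^ 2)).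
  - f_equal; [cfield|]; rewrite <- E; reflect_term.
  - simpl; cfield.
Qed.

Lemma wp_even : wp (- z) tau = wp z tau.
Proof.
  assert (N := Copp_neq0 z Nz); unfold wp; f_equal; [simpl; cfield|]; reflect_term.
Qed.

Lemma wp'_odd : wp' (- z) tau = - wp' z tau.
Proof.
  assert (N := Copp_neq0 z Nz); assert (E := lsum_opp_fam _ _ (fam_wp' z tau C0 C0 Ht Ho)); cbv beta in E; rewrite ?path0 in E.
  unfold wp'; transitivity (RtoC 2 / z ^ 3 + - lsum' (fun m n => - RtoC 2 / (z - lat tau m n) ^ 3)).
  - f_equal; [simpl; cfield|]; rewrite <- E; reflect_term.
  - simpl; cfield.
Qed.

Lemma zt_odd : zt (- z) tau = - zt z tau.
Proof.
  assert (N := Copp_neq0 z Nz); assert (E := lsum_opp_fam _ _ (fam_zt z tau C0 C0 Ht Ho)); cbv beta in E; rewrite ?path0 in E.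
  unfold zt; rewrite <- E; reflect_term.
Qed.
End Parity.

(** * Quasi-periodicity *)

Lemma zsum_delta (N : nat) (c : Cplx) : zsum N (fun i => if Z.eqb i 0 then c else C0) = c.
Proof.
  induction N; [reflexivity|]; cbn [zsum]; rewrite IHN.
  destruct (Z.eqb_spec (- Z.of_nat (S N)) 0); [lia|]; destruct (Z.eqb_spec (Z.of_nat (S N)) 0); [lia|]; ring.
Qed.

Lemma sqsum_mask (N : nat) (f : Z -> Z -> Cplx) : sqsum N f = f 0%Z 0%Z + sqsum N (mask f).
Proof.
  rewrite (sqsum_ext N f (fun m n => (if Z.eqb m 0 && Z.eqb n 0 then f 0%Z 0%Z else C0)%bool + mask f m n)).
  - rewrite sqsum_plus; f_equal; unfold sqsum.
    rewrite (zsum_ext N _ (fun m => if Z.eqb m 0 then f 0%Z 0%Z else C0)); [apply zsum_delta|].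
    intros m; destruct (Z.eqb m 0); simpl; [apply zsum_delta | apply zsum_C0].
  - intros m n; unfold mask; destruct (Z.eqb_spec m 0), (Z.eqb_spec n 0); simpl; subst; ring.
Qed.

Lemma sqsum_odd (N : nat) (f : Z -> Z -> Cplx) :
  (forall m n, f (- m)%Z (- n)%Z = - f m n) -> sqsum N f = C0.
Proof.
  intros H; assert (E : sqsum N f = - C1 * sqsum N f).
  { rewrite <- sqsum_scal, <- sqsum_opp; apply sqsum_ext; intros; rewrite H; ring. }
  replace (sqsum N f) with ((sqsum N f - - C1 * sqsum N f) / RtoC 2) by cfield.
  rewrite <- E; cfield.
Qed.

(** Separates the part of the zeta series that telescopes under translation from [square_inv]. The
    latter enters the increments along [1] and [tau] with weights [1] and [tau], so it cancels from
    [kappa] and from the comparison of increments at two points. *)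
Definition pole_sum (N : nat) (z tau : Cplx) : Cplx := sqsum N (fun m n => C1 / (z - lat tau m n)).
Definition square_inv (N : nat) (tau : Cplx) : Cplx := sqsum N (mask (fun m n => C1 / lat tau m n ^ 2)).

(** The terms [1 / w] cancel exactly over each symmetric square, before any limit is taken. *)
Lemma wzeta_partial (z tau : Cplx) : upper_half tau -> ~ in_lattice z tau ->
  Ccv (fun N => pole_sum N z tau + z * square_inv N tau) (wzeta z tau).
Proof.
  intros Ht Hz; assert (Ho := notin_offlat z tau Hz); assert (Nz := notin_neq0 z tau Hz).
  destruct (fam_dominated _ _ (fam_zeta z tau C0 C0 Ht Ho)) as [K D]; rewrite !path0 in D.
  unfold wzeta; eapply Ccv_ext; [|apply Ccv_plus; [apply Ccv_const | exact (lsum_cv _ _ D)]].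
  intros N; simpl; unfold pole_sum; rewrite (sqsum_mask N (fun m n => C1 / (z - lat tau m n))), lat_00; unfold square_inv; rewrite <- sqsum_scal.
  replace (z - C0) with z by ring.
  rewrite (sqsum_ext N _ (fun m n => mask (fun m n => C1 / (z - lat tau m n)) m n
     + (mask (fun m n => C1 / lat tau m n) m n + z * mask (fun m n => C1 / lat tau m n ^ 2) m n))).
  - rewrite !sqsum_plus, (sqsum_odd N (mask (fun m n => C1 / lat tau m n))); [ring|].
    intros m n; unfold mask; destruct (Z.eqb_spec m 0), (Z.eqb_spec n 0), (Z.eqb_spec (- m) 0), (Z.eqb_spec (- n) 0);
      simpl; try lia; try ring; rewrite lat_opp;
      assert (W : lat tau m n <> C0) by (apply lat_neq0; [exact Ht | intros E; injection E; lia]);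
      assert (W2 := Copp_neq0 _ W); cfield.
  - intros m n; destruct (classic ((m, n) = (0, 0)%Z)) as [E|E].
    + injection E; intros -> ->; unfold mask; simpl; ring.
    + rewrite !mask_neq by assumption; assert (W := lat_neq0 tau m n Ht E); assert (W2 := Csub_neq0 _ _ (Ho m n E)).
      simpl; cfield.
Qed.

Definition edge1 (N : nat) (z tau : Cplx) : Cplx :=
  zsum N (fun n => C1 / (z - lat tau (- Z.of_nat N - 1) n)) - zsum N (fun n => C1 / (z - lat tau (Z.of_nat N) n)).
Definition edge2 (N : nat) (z tau : Cplx) : Cplx :=
  zsum N (fun m => C1 / (z - lat tau m (- Z.of_nat N - 1)) - C1 / (z - lat tau m (Z.of_nat N))).

Lemma lat_pred1 (tau : Cplx) (m n : Z) : lat tau (m - 1) n = lat tau m n - C1.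
Proof. unfold lat, ZtoC, RtoC; rewrite minus_IZR; apply Cplx_eq; simpl; ring. Qed.
Lemma lat_pred2 (tau : Cplx) (m n : Z) : lat tau m (n - 1) = lat tau m n - tau.
Proof. unfold lat, ZtoC, RtoC; rewrite minus_IZR; apply Cplx_eq; simpl; ring. Qed.

Lemma zsum_minus (N : nat) (f g : Z -> Cplx) : zsum N (fun i => f i - g i) = zsum N f - zsum N g.
Proof. induction N; simpl; rewrite ?IHN; ring. Qed.

(** Translation by a period shifts one index, so the sum over that index telescopes to two boundary
    columns. *)
Lemma pole_sum_1 (N : nat) (z tau : Cplx) :
  pole_sum N (z + C1) tau - pole_sum N z tau = edge1 N z tau.
Proof.
  unfold pole_sum, sqsum, edge1; rewrite <- zsum_minus.
  rewrite <- (zsum_tele N (fun m => zsum N (fun n => C1 / (z - lat tau m n)))).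
  apply zsum_ext; intros m; f_equal; apply zsum_ext; intros n; rewrite lat_pred1; f_equal; ring.
Qed.

Lemma pole_sum_tau (N : nat) (z tau : Cplx) :
  pole_sum N (z + tau) tau - pole_sum N z tau = edge2 N z tau.
Proof.
  unfold pole_sum, sqsum, edge2; rewrite <- zsum_minus.
  apply zsum_ext; intros m; rewrite <- (zsum_tele N (fun n => C1 / (z - lat tau m n))), <- zsum_minus.
  apply zsum_ext; intros n; rewrite lat_pred2; f_equal; f_equal; ring.
Qed.

Lemma increment_1 (z tau : Cplx) : upper_half tau -> ~ in_lattice z tau ->
  Ccv (fun N => edge1 N z tau + square_inv N tau) (wzeta (z + C1) tau - wzeta z tau).
Proof.
  intros Ht Hz; assert (Hz1 : ~ in_lattice (z + C1) tau) by (rewrite in_lattice_1; exact Hz).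
  replace (wzeta (z + C1) tau - wzeta z tau) with (wzeta (z + C1) tau + - C1 * wzeta z tau) by ring.
  eapply Ccv_ext; [|apply Ccv_plus; [exact (wzeta_partial _ _ Ht Hz1) | apply Ccv_scal; exact (wzeta_partial _ _ Ht Hz)]].
  intros N; simpl; rewrite <- pole_sum_1; ring.
Qed.

Lemma increment_tau (z tau : Cplx) : upper_half tau -> ~ in_lattice z tau ->
  Ccv (fun N => edge2 N z tau + tau * square_inv N tau) (wzeta (z + tau) tau - wzeta z tau).
Proof.
  intros Ht Hz; assert (Hz1 : ~ in_lattice (z + tau) tau) by (rewrite in_lattice_tau; exact Hz).
  replace (wzeta (z + tau) tau - wzeta z tau) with (wzeta (z + tau) tau + - C1 * wzeta z tau) by ring.
  eapply Ccv_ext; [|apply Ccv_plus; [exact (wzeta_partial _ _ Ht Hz1) | apply Ccv_scal; exact (wzeta_partial _ _ Ht Hz)]].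
  intros N; simpl; rewrite <- pole_sum_tau; ring.
Qed.

Lemma inv_diff_bound (u v : Cplx) (q : R) : 0 < q -> q <= Cabs u -> q <= Cabs v ->
  Cabs (C1 / u - C1 / v) <= Cabs (u - v) / (q * q).
Proof.
  intros Hq Hu Hv.
  assert (Nu : u <> C0) by (apply Cabs_gt0_neq; lra); assert (Nv : v <> C0) by (apply Cabs_gt0_neq; lra).
  replace (C1 / u - C1 / v) with ((v - u) / (u * v)) by cfield.
  rewrite Cabs_div by (apply Cmul_neq0; assumption); rewrite Cabs_mul, (Cabs_sub_sym v u).
  unfold Rdiv; apply Rmult_le_compat_l; [apply Cabs_ge0|].
  apply Rinv_le_contravar; [nra|]; apply Rmult_le_compat; lra.
Qed.

Section EdgeLimits.
Variables z z' tau : Cplx.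
Hypothesis Ht : upper_half tau.
Hypothesis Hz : offlat z tau.
Hypothesis Hz' : offlat z' tau.

Lemma edge_terms : exists K, 0 <= K /\ forall N m n, (INR N + 1 <= ell m n)%R -> (m, n) <> (0, 0)%Z ->
  Cabs (C1 / (z - lat tau m n) - C1 / (z' - lat tau m n)) <= K / ((INR N + 1) * (INR N + 1)).
Proof.
  destruct (lattice_gap_pt tau z Ht Hz) as [c [Hc H]]; destruct (lattice_gap_pt tau z' Ht Hz') as [c' [Hc' H']].
  set (q := Rmin c c'); assert (Hq : 0 < q) by (apply Rmin_pos; assumption).
  exists (Cabs (z - z') / (q * q))%R; split.
  { apply Rdiv_le_0_compat; [apply Cabs_ge0 | nra]. }
  intros N m n L Nmn; assert (PN := pos_INR N).
  eapply Rle_trans; [apply (inv_diff_bound _ _ (q * (INR N + 1))%R)|].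
  - nra.
  - eapply Rle_trans; [|apply H, Nmn]; apply Rmult_le_compat; try lra; apply Rmin_l.
  - eapply Rle_trans; [|apply H', Nmn]; apply Rmult_le_compat; try lra; apply Rmin_r.
  - replace (z - lat tau m n - (z' - lat tau m n)) with (z - z') by ring.
    apply Req_le; field; split; lra.
Qed.

Lemma ell_edge (N : nat) (m n : Z) : (Z.abs m >= Z.of_nat N \/ Z.abs n >= Z.of_nat N)%Z -> INR N + 1 <= ell m n.
Proof.
  rewrite INR_IZR_INZ; unfold ell; generalize (Rabs_pos (IZR m)) (Rabs_pos (IZR n)); rewrite <- !abs_IZR.
  intros ? ? [H0|H0]; apply Z.ge_le, IZR_le in H0; lra.
Qed.

Lemma edge_sum_cv (f : nat -> Z -> Cplx) (K : R) : 0 <= K ->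
  (forall N i, (N >= 1)%nat -> Cabs (f N i) <= K / ((INR N + 1) * (INR N + 1))) ->
  Ccv (fun N => zsum N (f N)) C0.
Proof.
  (* Starting at [N = 1] keeps the edge of index [N] away from the origin, a lattice point that
     [offlat] does not exclude. *)
  intros HK H; apply Ccv_squeeze with (2 * K)%R 1%nat; intros N HN.
  replace (zsum N (f N) - C0) with (zsum N (f N)) by ring.
  eapply Rle_trans; [apply zsum_bound; intros; apply H, HN|].
  assert (PN := pos_INR N).
  apply Rmult_le_reg_r with ((INR N + 1) * (INR N + 1))%R; [nra|].
  replace ((2 * INR N + 1) * (K / ((INR N + 1) * (INR N + 1))) * ((INR N + 1) * (INR N + 1)))%R with ((2 * INR N + 1) * K)%R by (field; lra).
  replace (2 * K / (INR N + 1) * ((INR N + 1) * (INR N + 1)))%R with (2 * K * (INR N + 1))%R by (field; lra).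
  nra.
Qed.

(** Each edge has [2 N + 1] terms, and replacing [z] by [z'] changes each by [O(1 / N^2)]. Hence the
    increment of zeta over a period does not depend on the point. *)
Lemma edge1_indep : Ccv (fun N => edge1 N z tau - edge1 N z' tau) C0.
Proof.
  destruct edge_terms as [K [HK H]].
  eapply Ccv_ext; [|replace C0 with (C0 + - C1 * C0) by ring; apply Ccv_plus; [|apply Ccv_scal];
    [apply (edge_sum_cv (fun N n => C1 / (z - lat tau (- Z.of_nat N - 1) n) - C1 / (z' - lat tau (- Z.of_nat N - 1) n)) K)
    |apply (edge_sum_cv (fun N n => C1 / (z - lat tau (Z.of_nat N) n) - C1 / (z' - lat tau (Z.of_nat N) n)) K)]].
  - intros N; simpl; unfold edge1; rewrite !zsum_minus; ring.
  - exact HK.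
  - intros N i HN; apply H; [apply ell_edge; lia | intros E; injection E; lia].
  - exact HK.
  - intros N i HN; apply H; [apply ell_edge; lia | intros E; injection E; lia].
Qed.

Lemma edge2_indep : Ccv (fun N => edge2 N z tau - edge2 N z' tau) C0.
Proof.
  destruct edge_terms as [K [HK H]].
  eapply Ccv_ext; [|replace C0 with (C0 + - C1 * C0) by ring; apply Ccv_plus; [|apply Ccv_scal];
    [apply (edge_sum_cv (fun N m => C1 / (z - lat tau m (- Z.of_nat N - 1)) - C1 / (z' - lat tau m (- Z.of_nat N - 1))) K)
    |apply (edge_sum_cv (fun N m => C1 / (z - lat tau m (Z.of_nat N)) - C1 / (z' - lat tau m (Z.of_nat N))) K)]].
  - intros N; simpl; unfold edge2; rewrite !zsum_minus; ring.
  - exact HK.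
  - intros N i HN; apply H; [apply ell_edge; lia | intros E; injection E; lia].
  - exact HK.
  - intros N i HN; apply H; [apply ell_edge; lia | intros E; injection E; lia].
Qed.
End EdgeLimits.

Section QuasiPeriods.
Variables z tau : Cplx.
Hypothesis Ht : upper_half tau.
Hypothesis Hz : ~ in_lattice z tau.

Lemma minus_half1 : - RtoC (1 / 2) + C1 = RtoC (1 / 2).
Proof. apply Cplx_eq; simpl; field. Qed.

Lemma minus_half2 : - (tau / RtoC 2) + tau = tau / RtoC 2.
Proof. cfield. Qed.

Lemma mhalf1_notin : ~ in_lattice (- RtoC (1 / 2)) tau.
Proof. rewrite in_lattice_opp; apply half1_notin, Ht. Qed.
Lemma mhalf2_notin : ~ in_lattice (- (tau / RtoC 2)) tau.
Proof. rewrite in_lattice_opp; apply half2_notin, Ht. Qed.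

(** From [- 1/2], adding the period is a change of sign, so oddness yields twice the value at [1/2];
    this links the definition of [eta1] to increments. *)
Lemma eta1_increment : wzeta (- RtoC (1 / 2) + C1) tau - wzeta (- RtoC (1 / 2)) tau = eta1 tau.
Proof.
  rewrite minus_half1, wzeta_odd by (try apply half1_notin; exact Ht); unfold eta1; ring.
Qed.

Lemma eta2_increment : wzeta (- (tau / RtoC 2) + tau) tau - wzeta (- (tau / RtoC 2)) tau = eta2 tau.
Proof.
  rewrite minus_half2, wzeta_odd by (try apply half2_notin; exact Ht); unfold eta2; ring.
Qed.

Lemma wzeta_1 : wzeta (z + C1) tau = wzeta z tau + eta1 tau.
Proof.
  assert (E : wzeta (z + C1) tau - wzeta z tau + - C1 * eta1 tau = C0).
  { rewrite <- eta1_increment; eapply Ccv_unique.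
    - apply Ccv_plus; [apply increment_1; assumption | apply Ccv_scal, increment_1; [exact Ht | exact mhalf1_notin]].
    - eapply Ccv_ext; [|exact (edge1_indep z (- RtoC (1 / 2)) tau Ht (notin_offlat _ _ Hz) (notin_offlat _ _ mhalf1_notin))].
      intros N; simpl; ring. }
  replace (wzeta (z + C1) tau) with (wzeta (z + C1) tau - wzeta z tau + - C1 * eta1 tau + wzeta z tau + eta1 tau) by ring.
  rewrite E; ring.
Qed.

Lemma wzeta_tau : wzeta (z + tau) tau = wzeta z tau + eta2 tau.
Proof.
  assert (E : wzeta (z + tau) tau - wzeta z tau + - C1 * eta2 tau = C0).
  { rewrite <- eta2_increment; eapply Ccv_unique.
    - apply Ccv_plus; [apply increment_tau; assumption | apply Ccv_scal, increment_tau; [exact Ht | exact mhalf2_notin]].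
    - eapply Ccv_ext; [|exact (edge2_indep z (- (tau / RtoC 2)) tau Ht (notin_offlat _ _ Hz) (notin_offlat _ _ mhalf2_notin))].
      intros N; simpl; ring. }
  replace (wzeta (z + tau) tau) with (wzeta (z + tau) tau - wzeta z tau + - C1 * eta2 tau + wzeta z tau + eta2 tau) by ring.
  rewrite E; ring.
Qed.
End QuasiPeriods.

(** * Nonvanishing of kappa *)

Lemma zsum_Im_ge (N : nat) (f : Z -> Cplx) (b : R) :
  (forall i, (Z.abs i <= Z.of_nat N)%Z -> b <= Im (f i)) -> (2 * INR N + 1) * b <= Im (zsum N f).
Proof.
  induction N; intros H; [simpl; specialize (H 0%Z ltac:(lia)); lra|].
  cbn [zsum]; rewrite S_INR.
  assert (H1 := H (- Z.of_nat (S N))%Z ltac:(lia)); assert (H2 := H (Z.of_nat (S N)) ltac:(lia)).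
  assert (H3 : (2 * INR N + 1) * b <= Im (zsum N f)) by (apply IHN; intros; apply H; lia).
  change (Im (f (- Z.of_nat (S N))%Z + zsum N f + f (Z.of_nat (S N)))) with
    (Im (f (- Z.of_nat (S N))%Z) + Im (zsum N f) + Im (f (Z.of_nat (S N))))%R; lra.
Qed.

Lemma Im_inv (u : Cplx) : Im (C1 / u) = (- Im u / Cnorm2 u)%R.
Proof. unfold Cdiv, Cinv; simpl; unfold Rdiv; ring. Qed.

Lemma Im_div (t u : Cplx) : Im (t / u) = ((Im t * Re u - Re t * Im u) / Cnorm2 u)%R.
Proof. unfold Cdiv, Cinv; simpl; unfold Rdiv; ring. Qed.

(* The telescoped boundary sums form a Riemann sum of [dw / w] around a parallelogram;
   each of its terms contributes a positive imaginary part. *)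
Lemma edges_Im (N : nat) (tau : Cplx) : upper_half tau ->
  4 * Im tau / ((1 + Cabs tau) * (1 + Cabs tau))
    <= Im (tau * edge1 N (- RtoC (1 / 2)) tau - edge2 N (- (tau / RtoC 2)) tau).
Proof.
  intros Ht; assert (Ti : 0 < Im tau) by exact Ht; assert (Ta := Cabs_ge0 tau); assert (PN := pos_INR N).
  (* Centred at minus half a period, the edges become opposite sides of the parallelogram with
     vertices [M (+-1 +- tau)]. *)
  set (M := (INR N + 1 / 2)%R); assert (HM : 0 < M) by (unfold M; lra).
  set (b := (Im tau / (M * ((1 + Cabs tau) * (1 + Cabs tau))))%R).
  assert (Hb : 0 < b) by (apply Rdiv_lt_0_compat; [assumption | repeat apply Rmult_lt_0_compat; lra]).
  assert (IM : IZR (Z.of_nat N) = (M - 1 / 2)%R) by (rewrite <- INR_IZR_INZ; unfold M; ring).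
  assert (IM1 : IZR (- Z.of_nat N - 1) = (- M - 1 / 2)%R) by (rewrite minus_IZR, opp_IZR, IM; lra).
  assert (Hn : forall i, (Z.abs i <= Z.of_nat N)%Z -> Rabs (IZR i) <= M)
    by (intros i Hi; apply IZR_le in Hi; rewrite abs_IZR, IM in Hi; lra).
  assert (T : forall s i, (s = M \/ s = - M)%R -> (Z.abs i <= Z.of_nat N)%Z ->
     b <= Im (tau / (RtoC M - RtoC (s / M * IZR i) * tau))).
  { intros s i Hs Hi; rewrite Im_div; set (u := RtoC M - RtoC (s / M * IZR i) * tau).
    (* The numerator is the same for all points of the side, while [Cabs u <= M (1 + Cabs tau)]; the
       [2 M] points of the side then give a bound free of [N]. *)
    replace (Im tau * Re u - Re tau * Im u)%R with (M * Im tau)%R by (unfold u; simpl; ring).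
    assert (Ha : Rabs (s / M * IZR i) <= M).
    { destruct Hs as [-> | ->]; [replace (M / M * IZR i)%R with (IZR i) by (field; lra)
       | replace (- M / M * IZR i)%R with (- IZR i)%R by (field; lra); rewrite Rabs_Ropp]; apply Hn, Hi. }
    assert (Cu : Cabs u <= M * (1 + Cabs tau)).
    { eapply Rle_trans; [apply Cabs_sub_triang|]; rewrite Cabs_mul, !Cabs_RtoC, (Rabs_pos_eq M) by lra; nra. }
    assert (Nu : u <> C0).
    { intros E; assert (EI := f_equal Im E); assert (ER := f_equal Re E); unfold u in EI, ER; simpl in EI, ER.
      assert (E0 : (s / M * IZR i = 0)%R) by nra; rewrite E0 in ER; nra. }
    assert (Pu := Cabs_gt0 u Nu); rewrite <- Cabs_sqr.
    apply Rmult_le_reg_r with (Cabs u * Cabs u)%R; [nra|].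
    replace (M * Im tau / (Cabs u * Cabs u) * (Cabs u * Cabs u))%R with (M * Im tau)%R by (field; lra).
    apply Rle_trans with (b * ((M * (1 + Cabs tau)) * (M * (1 + Cabs tau))))%R.
    - apply Rmult_le_compat_l; [lra|]; apply Rmult_le_compat; lra.
    - apply Req_le; unfold b; field; split; lra. }
  assert (E1 : tau * edge1 N (- RtoC (1 / 2)) tau =
     zsum N (fun n => tau / (RtoC M - RtoC (M / M * IZR n) * tau) + tau / (RtoC M - RtoC (- M / M * IZR n) * tau))).
  { unfold edge1; rewrite <- zsum_minus, <- zsum_scal; apply zsum_ext; intros n.
    replace (M / M)%R with 1%R by (field; lra); replace (- M / M)%R with (-1)%R by (field; lra).
    unfold lat, ZtoC; rewrite IM, IM1.
    replace (- RtoC (1 / 2) - (RtoC (- M - 1 / 2) + RtoC (IZR n) * tau)) with (RtoC M - RtoC (1 * IZR n) * tau)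
      by (apply Cplx_eq; simpl; field).
    replace (- RtoC (1 / 2) - (RtoC (M - 1 / 2) + RtoC (IZR n) * tau)) with (- (RtoC M - RtoC (-1 * IZR n) * tau))
      by (apply Cplx_eq; simpl; field).
    assert (NN : forall x, RtoC M - RtoC x * tau <> C0).
    { intros x E; assert (EI := f_equal Im E); assert (ER := f_equal Re E); simpl in EI, ER.
      assert (E0 : x = 0%R) by nra; rewrite E0 in ER; nra. }
    assert (N1 := NN (1 * IZR n)%R); assert (N2 := NN (-1 * IZR n)%R); assert (N3 := Copp_neq0 _ N2).
    set (p := RtoC M - RtoC (1 * IZR n) * tau) in *; set (q := RtoC M - RtoC (-1 * IZR n) * tau) in *.
    cfield. }
  assert (G1 : (2 * INR N + 1) * (2 * b) <= Im (tau * edge1 N (- RtoC (1 / 2)) tau)).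
  { rewrite E1; apply zsum_Im_ge; intros i Hi.
    change (Im (tau / (RtoC M - RtoC (M / M * IZR i) * tau) + tau / (RtoC M - RtoC (- M / M * IZR i) * tau))) with
     (Im (tau / (RtoC M - RtoC (M / M * IZR i) * tau)) + Im (tau / (RtoC M - RtoC (- M / M * IZR i) * tau)))%R.
    generalize (T M i ltac:(auto) Hi) (T (- M)%R i ltac:(auto) Hi); lra. }
  assert (E2 : - edge2 N (- (tau / RtoC 2)) tau = zsum N (fun m => - (C1 / (RtoC M * tau - RtoC (IZR m)) + C1 / (RtoC M * tau + RtoC (IZR m))))).
  { replace (- edge2 N (- (tau / RtoC 2)) tau) with (- C1 * edge2 N (- (tau / RtoC 2)) tau) by ring.
    unfold edge2; rewrite <- zsum_scal; apply zsum_ext; intros m.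
    rewrite half2_eq; unfold lat, ZtoC; rewrite IM, IM1.
    replace (- (RtoC 0 + RtoC (1 / 2) * tau) - (RtoC (IZR m) + RtoC (- M - 1 / 2) * tau)) with (RtoC M * tau - RtoC (IZR m))
      by (apply Cplx_eq; simpl; field).
    replace (- (RtoC 0 + RtoC (1 / 2) * tau) - (RtoC (IZR m) + RtoC (M - 1 / 2) * tau)) with (- (RtoC M * tau + RtoC (IZR m)))
      by (apply Cplx_eq; simpl; field).
    assert (N1 : RtoC M * tau - RtoC (IZR m) <> C0) by (intros E; assert (EI := f_equal Im E); simpl in EI; nra).
    assert (N2 : RtoC M * tau + RtoC (IZR m) <> C0) by (intros E; assert (EI := f_equal Im E); simpl in EI; nra).
    assert (N3 := Copp_neq0 _ N2).
    set (p := RtoC M * tau - RtoC (IZR m)) in *; set (q := RtoC M * tau + RtoC (IZR m)) in *; cfield. }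
  (* For this pair of sides the sign is enough: the other pair already supplies the lower bound. *)
  assert (G2 : (2 * INR N + 1) * 0 <= Im (- edge2 N (- (tau / RtoC 2)) tau)).
  { rewrite E2; apply zsum_Im_ge; intros i Hi.
    change (Im (- (C1 / (RtoC M * tau - RtoC (IZR i)) + C1 / (RtoC M * tau + RtoC (IZR i))))) with
      (- (Im (C1 / (RtoC M * tau - RtoC (IZR i))) + Im (C1 / (RtoC M * tau + RtoC (IZR i)))))%R.
    assert (Q : forall u, 0 < Im u -> Im (C1 / u) <= 0).
    { intros u Hu; rewrite Im_inv; assert (0 < Cnorm2 u) by (unfold Cnorm2; nra).
      unfold Rdiv; assert (0 < / Cnorm2 u) by (apply Rinv_0_lt_compat; assumption); nra. }
    assert (Q1 := Q (RtoC M * tau - RtoC (IZR i)) ltac:(simpl; nra)).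
    assert (Q2 := Q (RtoC M * tau + RtoC (IZR i)) ltac:(simpl; nra)); lra. }
  change (Im (tau * edge1 N (- RtoC (1 / 2)) tau - edge2 N (- (tau / RtoC 2)) tau)) with
    (Im (tau * edge1 N (- RtoC (1 / 2)) tau) + Im (- edge2 N (- (tau / RtoC 2)) tau))%R.
  replace (4 * Im tau / ((1 + Cabs tau) * (1 + Cabs tau)))%R with ((2 * INR N + 1) * (2 * b))%R; [lra|].
  unfold b; replace (2 * INR N + 1)%R with (2 * M)%R by (unfold M; field); field; split; lra.
Qed.

(* Equal to [2 * PI * i] by Legendre's relation. *)
Definition kappa (tau : Cplx) : Cplx := eta1 tau * tau - eta2 tau.

(** In [tau * eta1 - eta2] the sums [square_inv] cancel, and the bound of [edges_Im], uniform in
    [N], survives the limit. *)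
Lemma kappa_neq0 (tau : Cplx) : upper_half tau -> kappa tau <> C0.
Proof.
  intros Ht E.
  set (q := (4 * Im tau / ((1 + Cabs tau) * (1 + Cabs tau)))%R).
  assert (Hq : 0 < q).
  { unfold q; generalize (Cabs_ge0 tau); unfold upper_half in Ht; intros; apply Rdiv_lt_0_compat; nra. }
  assert (L : Ccv (fun N => tau * edge1 N (- RtoC (1 / 2)) tau - edge2 N (- (tau / RtoC 2)) tau) C0).
  { rewrite <- E; unfold kappa.
    replace (eta1 tau * tau - eta2 tau) with (tau * eta1 tau + - C1 * eta2 tau) by ring.
    rewrite <- eta1_increment, <- eta2_increment by exact Ht.
    eapply Ccv_ext; [|apply Ccv_plus; apply Ccv_scal;
      [apply increment_1, mhalf1_notin; exact Ht | apply increment_tau, mhalf2_notin; exact Ht]].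
    intros N; simpl; ring. }
  destruct (L q Hq) as [N H]; specialize (H N ltac:(lia)).
  assert (B := edges_Im N tau Ht); fold q in B.
  set (x := tau * edge1 N (- RtoC (1 / 2)) tau - edge2 N (- (tau / RtoC 2)) tau) in *.
  replace (x - C0) with x in H by ring.
  generalize (Im_le_Cabs x) (Rle_abs (Im x)); lra.
Qed.

(** * Complex-valued functions of a real variable *)

Definition Rder (g : R -> Cplx) (t : R) (v : Cplx) : Prop :=
  forall eps, 0 < eps -> exists del, 0 < del /\ forall s, Rabs (s - t) < del ->
    Cabs (g s - g t - RtoC (s - t) * v) <= eps * Rabs (s - t).

Lemma derivable_pt_lim_eq (f : R -> R) (t l m : R) : derivable_pt_lim f t l -> l = m -> derivable_pt_lim f t m.
Proof. intros H <-; exact H. Qed.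

Lemma derivable_pt_lim_iff (f : R -> R) (t l : R) :
  derivable_pt_lim f t l <-> forall eps, 0 < eps -> exists del, 0 < del /\ forall s, Rabs (s - t) < del ->
    Rabs (f s - f t - (s - t) * l) <= eps * Rabs (s - t).
Proof.
  split.
  - intros H e He; destruct (H e He) as [[d Hd] G]; exists d; split; [exact Hd|]; intros s Hs.
    destruct (Req_dec s t) as [->|N].
    + replace (f t - f t - (t - t) * l)%R with 0%R by ring; replace (t - t)%R with 0%R by ring; rewrite Rabs_R0; lra.
    + specialize (G (s - t)%R ltac:(lra) Hs); replace (t + (s - t))%R with s in G by ring.
      replace (f s - f t - (s - t) * l)%R with (((f s - f t) / (s - t) - l) * (s - t))%R by (field; lra).
      rewrite Rabs_mult; apply Rmult_le_compat_r; [apply Rabs_pos | lra].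
  - intros H e He; destruct (H (e / 2)%R ltac:(lra)) as [d [Hd G]]; exists (mkposreal d Hd); intros h Nh Hh; simpl in Hh.
    specialize (G (t + h)%R); replace (t + h - t)%R with h in G by ring; specialize (G Hh).
    replace ((f (t + h) - f t) / h - l)%R with ((f (t + h) - f t - h * l) / h)%R by (field; assumption).
    unfold Rdiv; rewrite Rabs_mult, Rabs_inv.
    assert (P : 0 < Rabs h) by (apply Rabs_pos_lt; assumption).
    apply Rmult_lt_reg_r with (Rabs h); [assumption|]; rewrite Rmult_assoc, Rinv_l by lra; nra.
Qed.

Lemma Rder_Re (g : R -> Cplx) (t : R) (v : Cplx) :
  Rder g t v -> is_derive (fun s => Re (g s)) t (Re v).
Proof.
  intros H; apply is_derive_Reals, derivable_pt_lim_iff; intros e He.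
  destruct (H e He) as [d [Hd G]]; exists d; split; [assumption|]; intros s Hs.
  eapply Rle_trans; [|apply G, Hs]; eapply Rle_trans; [|apply Re_le_Cabs].
  apply Req_le; f_equal; simpl; ring.
Qed.

Lemma Rder_Im (g : R -> Cplx) (t : R) (v : Cplx) :
  Rder g t v -> is_derive (fun s => Im (g s)) t (Im v).
Proof.
  intros H; apply is_derive_Reals, derivable_pt_lim_iff; intros e He.
  destruct (H e He) as [d [Hd G]]; exists d; split; [assumption|]; intros s Hs.
  eapply Rle_trans; [|apply G, Hs]; eapply Rle_trans; [|apply Im_le_Cabs].
  apply Req_le; f_equal; simpl; ring.
Qed.

Lemma Rder_of_parts (g : R -> Cplx) (t : R) (v : Cplx) :
  derivable_pt_lim (fun s => Re (g s)) t (Re v) ->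
  derivable_pt_lim (fun s => Im (g s)) t (Im v) -> Rder g t v.
Proof.
  rewrite !derivable_pt_lim_iff; intros HR HI e He.
  destruct (HR (e / 2)%R ltac:(lra)) as [d [Hd G]]; destruct (HI (e / 2)%R ltac:(lra)) as [d' [Hd' G']].
  exists (Rmin d d'); split; [apply Rmin_pos; assumption|]; intros s Hs.
  specialize (G s (lt_Rmin_l _ _ _ Hs)).
  specialize (G' s (lt_Rmin_r _ _ _ Hs)).
  eapply Rle_trans; [apply Cabs_le_ReIm|].
  replace (Re (g s - g t - RtoC (s - t) * v)) with (Re (g s) - Re (g t) - (s - t) * Re v)%R by (simpl; ring).
  replace (Im (g s - g t - RtoC (s - t) * v)) with (Im (g s) - Im (g t) - (s - t) * Im v)%R by (simpl; ring).
  lra.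
Qed.

Lemma Rder_eq (g : R -> Cplx) (t : R) (v w : Cplx) : Rder g t v -> v = w -> Rder g t w.
Proof. intros H <-; exact H. Qed.

Lemma Rder_chain (f : Cplx -> Cplx) (g : R -> Cplx) (t : R) (l v : Cplx) :
  Cder f (g t) l -> Rder g t v -> Rder (fun s => f (g s)) t (l * v).
Proof.
  intros Hf Hg e He.
  assert (Pl := Cabs_ge0 l); assert (Pv := Cabs_ge0 v).
  set (e1 := (e / (2 * (Cabs v + 1)))%R).
  assert (He1 : 0 < e1) by (apply Rdiv_lt_0_compat; lra).
  set (e2 := Rmin 1 (e / (2 * (Cabs l + 1)))).
  assert (He2 : 0 < e2) by (apply Rmin_pos; [lra | apply Rdiv_lt_0_compat; lra]).
  destruct (Cder_linear f (g t) l e1 Hf He1) as [d1 [Hd1 G1]].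
  destruct (Hg e2 He2) as [d2 [Hd2 G2]].
  exists (Rmin d2 (d1 / (Cabs v + 1))); split; [apply Rmin_pos; [assumption | apply Rdiv_lt_0_compat; lra]|].
  intros s Hs.
  specialize (G2 s (lt_Rmin_l _ _ _ Hs)).
  assert (Hs1 : Rabs (s - t) * (Cabs v + 1) < d1).
  { assert (Rabs (s - t) < d1 / (Cabs v + 1)) by (exact (lt_Rmin_r _ _ _ Hs)).
    apply Rmult_lt_reg_r with (/ (Cabs v + 1))%R; [apply Rinv_0_lt_compat; lra|].
    rewrite Rmult_assoc, Rinv_r by lra; rewrite Rmult_1_r; assumption. }
  assert (Ps := Rabs_pos (s - t)).
  assert (D : Cabs (g s - g t) <= (Cabs v + 1) * Rabs (s - t)).
  { replace (g s - g t) with ((g s - g t - RtoC (s - t) * v) + RtoC (s - t) * v) by ring.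
    eapply Rle_trans; [apply Cabs_triang|]; rewrite Cabs_mul, Cabs_RtoC.
    assert (e2 <= 1) by apply Rmin_l; nra. }
  specialize (G1 (g s) ltac:(lra)).
  replace (f (g s) - f (g t) - RtoC (s - t) * (l * v)) with
    ((f (g s) - f (g t) - (g s - g t) * l) + (g s - g t - RtoC (s - t) * v) * l) by ring.
  eapply Rle_trans; [apply Cabs_triang|]; rewrite (Cabs_mul _ l).
  assert (B1 : e1 * Cabs (g s - g t) <= e / 2 * Rabs (s - t)).
  { apply Rle_trans with (e1 * ((Cabs v + 1) * Rabs (s - t)))%R; [apply Rmult_le_compat_l; lra|].
    apply Req_le; unfold e1; field; lra. }
  assert (B2 : e2 * Cabs l <= e / 2).
  { assert (Q : e2 <= e / (2 * (Cabs l + 1))) by apply Rmin_r.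
    apply Rle_trans with (e / (2 * (Cabs l + 1)) * (Cabs l + 1))%R.
    - apply Rmult_le_compat; lra.
    - apply Req_le; field; lra. }
  assert (B3 : Cabs (g s - g t - RtoC (s - t) * v) * Cabs l <= e / 2 * Rabs (s - t)).
  { apply Rle_trans with (e2 * Rabs (s - t) * Cabs l)%R; [apply Rmult_le_compat_r; assumption|].
    replace (e2 * Rabs (s - t) * Cabs l)%R with (e2 * Cabs l * Rabs (s - t))%R by ring.
    apply Rmult_le_compat_r; assumption. }
  lra.
Qed.

Lemma Rder_line (p v : Cplx) (t : R) : Rder (fun s => p + RtoC s * v) t v.
Proof.
  intros e He; exists 1%R; split; [lra|]; intros s _.
  replace (p + RtoC s * v - (p + RtoC t * v) - RtoC (s - t) * v) with C0
    by (apply Cplx_eq; simpl; ring).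
  rewrite Cabs_C0; generalize (Rabs_pos (s - t)); nra.
Qed.

Lemma Rder_minus (f g : R -> Cplx) (t : R) (v w : Cplx) :
  Rder f t v -> Rder g t w -> Rder (fun s => f s - g s) t (v - w).
Proof.
  intros Hf Hg e He; destruct (Hf (e / 2)%R ltac:(lra)) as [d [Hd G]]; destruct (Hg (e / 2)%R ltac:(lra)) as [d' [Hd' G']].
  exists (Rmin d d'); split; [apply Rmin_pos; assumption|]; intros s Hs.
  specialize (G s (lt_Rmin_l _ _ _ Hs)).
  specialize (G' s (lt_Rmin_r _ _ _ Hs)).
  replace (f s - g s - (f t - g t) - RtoC (s - t) * (v - w)) with
    ((f s - f t - RtoC (s - t) * v) - (g s - g t - RtoC (s - t) * w)) by ring.
  eapply Rle_trans; [apply Cabs_sub_triang|]; lra.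
Qed.

Lemma Rder_0_const (g : R -> Cplx) (a b : R) : a < b ->
  (forall t, a <= t <= b -> Rder g t C0) -> g a = g b.
Proof.
  intros L H; apply Cplx_eq.
  - apply (eq_is_derive (fun s => Re (g s)) a b); [|assumption]; intros t Ht; exact (Rder_Re _ _ _ (H t Ht)).
  - apply (eq_is_derive (fun s => Im (g s)) a b); [|assumption]; intros t Ht; exact (Rder_Im _ _ _ (H t Ht)).
Qed.

(** * Paths off the lattice *)

Definition clear_segment (tau p q : Cplx) : Prop :=
  forall t, 0 <= t <= 1 -> ~ in_lattice (p + RtoC t * (q - p)) tau.

Lemma clear_segment_sym (tau p q : Cplx) : clear_segment tau p q -> clear_segment tau q p.
Proof.
  intros H t Ht; replace (q + RtoC t * (p - q)) with (p + RtoC (1 - t) * (q - p)); [apply H; lra|].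
  apply Cplx_eq; simpl; ring.
Qed.

Lemma coords (tau z : Cplx) : upper_half tau -> exists x y : R, z = RtoC x + RtoC y * tau.
Proof.
  unfold upper_half; intros Ht; exists (Re z - Im z / Im tau * Re tau)%R, (Im z / Im tau)%R.
  apply Cplx_eq; simpl; field; lra.
Qed.

(* Any two points off the lattice are joined by segments with constant x or constant y
   in the coordinates z = x + y tau, avoiding the lattice. *)
Lemma lattice_complement_connected (tau : Cplx) (P : Cplx -> Prop) : upper_half tau ->
  (forall p q, clear_segment tau p q -> P p -> P q) ->
  forall z z', ~ in_lattice z tau -> ~ in_lattice z' tau -> P z -> P z'.
Proof.
  intros Ht HP.
  set (pt := fun x y => RtoC x + RtoC y * tau).
  assert (MX : forall x x' y, (forall n, y <> IZR n) -> clear_segment tau (pt x y) (pt x' y)).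
  { intros x x' y Hy t _; unfold pt.
    replace (RtoC x + RtoC y * tau + RtoC t * (RtoC x' + RtoC y * tau - (RtoC x + RtoC y * tau))) with
      (RtoC (x + t * (x' - x)) + RtoC y * tau) by (apply Cplx_eq; simpl; ring).
    intros H; destruct (in_lattice_coords tau _ _ Ht H) as [m [n [_ E]]]; exact (Hy n E). }
  assert (MY : forall x y y', (forall n, x <> IZR n) -> clear_segment tau (pt x y) (pt x y')).
  { intros x y y' Hx t _; unfold pt.
    replace (RtoC x + RtoC y * tau + RtoC t * (RtoC x + RtoC y' * tau - (RtoC x + RtoC y * tau))) with
      (RtoC x + RtoC (y + t * (y' - y)) * tau) by (apply Cplx_eq; simpl; ring).
    intros H; destruct (in_lattice_coords tau _ _ Ht H) as [m [n [E _]]]; exact (Hx m E). }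
  assert (B : forall z, ~ in_lattice z tau -> P z <-> P (pt (1 / 2)%R (1 / 2)%R)).
  { intros z Hz; destruct (coords tau z Ht) as [x [y E]]; fold (pt x y) in E; rewrite E in *.
    assert (S : exists w, clear_segment tau (pt x y) w /\ clear_segment tau w (pt (1 / 2)%R (1 / 2)%R)).
    { destruct (classic (forall n, y <> IZR n)) as [Hy|Hy].
      - exists (pt (1 / 2)%R y); split; [apply MX, Hy | apply MY, half_not_IZR].
      - assert (Hx : forall n, x <> IZR n).
        { intros m Em; apply Hy; intros n En; apply Hz; exists m, n; unfold pt, lat, ZtoC; rewrite Em, En; reflexivity. }
        exists (pt x (1 / 2)%R); split; [apply MY, Hx | apply MX, half_not_IZR]. }
    destruct S as [w [S1 S2]]; split; intros H.
    - apply (HP _ _ S2), (HP _ _ S1), H.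
    - apply (HP _ _ (clear_segment_sym _ _ _ S1)), (HP _ _ (clear_segment_sym _ _ _ S2)), H. }
  intros z z' Hz Hz' H; apply (B z' Hz'), (B z Hz), H.
Qed.

Lemma segment_end (p q : Cplx) : p + RtoC 1 * (q - p) = q.
Proof. apply Cplx_eq; simpl; ring. Qed.
Lemma segment_start (p q : Cplx) : p + RtoC 0 * (q - p) = p.
Proof. apply Cplx_eq; simpl; ring. Qed.

Lemma const_off_lattice (tau : Cplx) (f : Cplx -> Cplx) : upper_half tau ->
  (forall z, ~ in_lattice z tau -> Cder f z C0) ->
  forall z z', ~ in_lattice z tau -> ~ in_lattice z' tau -> f z = f z'.
Proof.
  intros Ht H z z' Hz Hz'.
  apply (lattice_complement_connected tau (fun w => f z = f w) Ht) with z; try assumption; [|reflexivity].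
  intros p q S E; rewrite E.
  rewrite <- (segment_start p q) at 1; rewrite <- (segment_end p q) at 2.
  apply (Rder_0_const (fun t => f (p + RtoC t * (q - p))) 0 1); [lra|]; intros t Hu.
  eapply Rder_eq; [apply (Rder_chain f); [apply H, S, Hu | apply Rder_line] | ring].
Qed.

(** * Uniqueness for linear differential equations of order two *)

Lemma Rder_cont (g : R -> Cplx) (t : R) (v : Cplx) : Rder g t v ->
  forall eps, 0 < eps -> exists del, 0 < del /\ forall s, Rabs (s - t) < del -> Cabs (g s - g t) < eps.
Proof.
  intros H e He; destruct (H 1%R ltac:(lra)) as [d [Hd G]]; assert (Pv := Cabs_ge0 v).
  exists (Rmin d (e / (Cabs v + 2))); split; [apply Rmin_pos; [assumption | apply Rdiv_lt_0_compat; lra]|]; intros s Hs.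
  specialize (G s (lt_Rmin_l _ _ _ Hs)).
  assert (Hs1 : Rabs (s - t) * (Cabs v + 2) < e).
  { assert (Rabs (s - t) < e / (Cabs v + 2)) by (exact (lt_Rmin_r _ _ _ Hs)).
    apply Rmult_lt_reg_r with (/ (Cabs v + 2))%R; [apply Rinv_0_lt_compat; lra|].
    rewrite Rmult_assoc, Rinv_r by lra; rewrite Rmult_1_r; assumption. }
  replace (g s - g t) with ((g s - g t - RtoC (s - t) * v) + RtoC (s - t) * v) by ring.
  eapply Rle_lt_trans; [apply Cabs_triang|]; rewrite Cabs_mul, Cabs_RtoC.
  generalize (Rabs_pos (s - t)); intros.
  destruct (Req_dec (s - t) 0) as [E|E].
  - rewrite E, Rabs_R0 in *; lra.
  - assert (0 < Rabs (s - t)) by (apply Rabs_pos_lt; assumption); nra.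
Qed.

(** Gronwall's argument for the energy [e = |d|^2 + |d1|^2]: since [2 |d| |d1| <= e], its derivative
    is at most [(1 + M) e], so [e t * exp (- (1 + M) t)] cannot increase from its initial value
    0. *)
Lemma linear_ode_unique (d d1 q : R -> Cplx) (T M : R) : 0 < T -> 0 <= M ->
  (forall t, 0 <= t <= T -> Rder d t (d1 t)) ->
  (forall t, 0 <= t <= T -> Rder d1 t (q t * d t)) ->
  (forall t, 0 <= t <= T -> Cabs (q t) <= M) ->
  d 0%R = C0 -> d1 0%R = C0 -> d T = C0 /\ d1 T = C0.
Proof.
  intros HT HM D D1 Q E0 E1.
  set (e := fun t => (Re (d t) * Re (d t) + Im (d t) * Im (d t) + (Re (d1 t) * Re (d1 t) + Im (d1 t) * Im (d1 t)))%R).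
  set (e' := fun t => (2 * (Re (d1 t) * Re (d t) + Im (d1 t) * Im (d t))
     + 2 * (Re (q t * d t) * Re (d1 t) + Im (q t * d t) * Im (d1 t)))%R).
  assert (De : forall t, 0 <= t <= T -> derivable_pt_lim e t (e' t)).
  { intros t Ht; unfold e, e'.
    assert (A1 := proj1 (is_derive_Reals _ _ _) (Rder_Re _ _ _ (D t Ht))).
    assert (A2 := proj1 (is_derive_Reals _ _ _) (Rder_Im _ _ _ (D t Ht))).
    assert (A3 := proj1 (is_derive_Reals _ _ _) (Rder_Re _ _ _ (D1 t Ht))).
    assert (A4 := proj1 (is_derive_Reals _ _ _) (Rder_Im _ _ _ (D1 t Ht))).
    assert (X := derivable_pt_lim_plus _ _ _ _ _
      (derivable_pt_lim_plus _ _ _ _ _ (derivable_pt_lim_mult _ _ _ _ _ A1 A1) (derivable_pt_lim_mult _ _ _ _ _ A2 A2))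
      (derivable_pt_lim_plus _ _ _ _ _ (derivable_pt_lim_mult _ _ _ _ _ A3 A3) (derivable_pt_lim_mult _ _ _ _ _ A4 A4))).
    apply (derivable_pt_lim_eq _ _ _ _ X); ring. }
  assert (Be : forall t, 0 <= t <= T -> e' t <= (1 + M) * e t).
  { intros t Ht; specialize (Q t Ht).
    assert (CS : forall z w, Re z * Re w + Im z * Im w <= Cabs z * Cabs w).
    { intros z w; assert (Pz := Cabs_ge0 z); assert (Pw := Cabs_ge0 w).
      apply Rsqr_incr_0_var; [|nra]; unfold Rsqr.
      replace (Cabs z * Cabs w * (Cabs z * Cabs w))%R with ((Cabs z * Cabs z) * (Cabs w * Cabs w))%R by ring.
      rewrite !Cabs_sqr; unfold Cnorm2.
      assert (0 <= (Re z * Im w - Im z * Re w) * (Re z * Im w - Im z * Re w)) by apply Rle_0_sqr; nra. }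
    assert (C1' := CS (d1 t) (d t)); assert (C2' := CS (q t * d t) (d1 t)); rewrite Cabs_mul in C2'.
    assert (Ee : e t = (Cabs (d t) * Cabs (d t) + Cabs (d1 t) * Cabs (d1 t))%R) by (rewrite !Cabs_sqr; reflexivity).
    rewrite Ee; unfold e'.
    generalize (Cabs_ge0 (d t)) (Cabs_ge0 (d1 t)) (Cabs_ge0 (q t)); intros.
    set (x := Cabs (d t)) in *; set (y := Cabs (d1 t)) in *.
    assert (Cabs (q t) * x * y <= M * (x * y)).
    { rewrite Rmult_assoc; apply Rmult_le_compat_r; [nra | assumption]. }
    assert (0 <= (x - y) * (x - y)) by apply Rle_0_sqr.
    assert (2 * (x * y) <= x * x + y * y) by lra.
    assert (M * (2 * (x * y)) <= M * (x * x + y * y)) by (apply Rmult_le_compat_l; assumption).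
    lra. }
  set (h := fun t => (e t * exp (- (1 + M) * t))%R).
  set (h' := fun t => (e' t * exp (- (1 + M) * t) + e t * (exp (- (1 + M) * t) * (- (1 + M))))%R).
  assert (Dh : forall t, 0 <= t <= T -> derivable_pt_lim h t (h' t)).
  { intros t Ht; unfold h, h'; apply (derivable_pt_lim_mult e (fun t => exp (- (1 + M) * t))); [apply De, Ht|].
    apply (derivable_pt_lim_comp (fun t => - (1 + M) * t)%R exp); [|apply derivable_pt_lim_exp].
    assert (X := derivable_pt_lim_scal id (- (1 + M)) t 1 (derivable_pt_lim_id t)).
    rewrite Rmult_1_r in X; exact X. }
  destruct (MVT_gen h 0 T h') as [c [Hc Ec]].
  { intros t Ht; rewrite Rmin_left, Rmax_right in Ht by lra; apply is_derive_Reals, Dh; lra. }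
  { intros t Ht; rewrite Rmin_left, Rmax_right in Ht by lra.
    apply derivable_continuous_pt; exists (h' t); apply Dh; lra. }
  rewrite Rmin_left, Rmax_right in Hc by lra.
  assert (Hh' : h' c <= 0).
  { unfold h'; generalize (Be c ltac:(lra)) (exp_pos (- (1 + M) * c)); intros B P.
    replace (e' c * exp (- (1 + M) * c) + e c * (exp (- (1 + M) * c) * - (1 + M)))%R with
      ((e' c - (1 + M) * e c) * exp (- (1 + M) * c))%R by ring; nra. }
  assert (Eh0 : h 0%R = 0%R).
  { unfold h, e; rewrite E0, E1; simpl; ring. }
  assert (HhT : h T <= 0) by (rewrite Eh0 in Ec; nra).
  assert (HeT : e T <= 0).
  { unfold h in HhT; generalize (exp_pos (- (1 + M) * T)); intros; apply Rnot_lt_le; intros L.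
    assert (0 < e T * exp (- (1 + M) * T)) by (apply Rmult_lt_0_compat; assumption); lra. }
  unfold e in HeT; split; apply Cnorm2_eq0; unfold Cnorm2;
    generalize (Rle_0_sqr (Re (d T))) (Rle_0_sqr (Im (d T))) (Rle_0_sqr (Re (d1 T))) (Rle_0_sqr (Im (d1 T)));
    unfold Rsqr; intros; lra.
Qed.

(** [T] is the supremum of the initial intervals made of good points. Were [T] itself good, openness
    would extend the interval past it. *)
Lemma first_exit (good : R -> Prop) :
  (forall t, good t -> exists del, 0 < del /\ forall s, Rabs (s - t) < del -> good s) ->
  good 0%R -> ~ good 1%R ->
  exists T, 0 < T /\ ~ good T /\ forall t, 0 <= t < T -> good t.
Proof.
  intros Op G0 G1.
  set (E := fun s => 0 <= s <= 1 /\ forall t, 0 <= t <= s -> good t).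
  destruct (completeness E) as [T [UB LB]].
  { exists 1%R; intros s [H _]; lra. }
  { exists 0%R; split; [lra|]; intros t Ht; replace t with 0%R by lra; exact G0. }
  assert (T0 : 0 <= T) by (apply UB; split; [lra|]; intros t Ht; replace t with 0%R by lra; exact G0).
  assert (T1 : T <= 1) by (apply LB; intros s [H _]; lra).
  assert (Below : forall t, 0 <= t < T -> good t).
  { intros t Ht; apply NNPP; intros N; assert (T <= t); [|lra].
    apply LB; intros s [Hs Gs]; apply Rnot_lt_le; intros L; apply N, Gs; lra. }
  assert (NT : ~ good T).
  { intros GT; destruct (Op T GT) as [d [Hd H]].
    destruct (Rle_lt_or_eq_dec _ _ T1) as [L|Eq]; [|subst; contradiction].
    set (s := Rmin 1 (T + d / 2)).
    assert (Hs : T < s <= 1) by (unfold s; split; [apply Rmin_glb_lt; lra | apply Rmin_l]).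
    assert (s <= T); [|lra].
    assert (Hs2 : s <= T + d / 2) by apply Rmin_r.
    apply UB; split; [lra|]; intros t Ht; destruct (Rlt_le_dec t T) as [Lt|Le]; [apply Below; lra|].
    apply H; rewrite Rabs_pos_eq by lra; lra. }
  exists T; split; [|split; assumption].
  destruct T0 as [L|E0]; [exact L | rewrite <- E0 in NT; contradiction].
Qed.

(** * Liouville's theorem *)

Lemma Ccont_near (f : Cplx -> Cplx) (z : Cplx) (eps : R) : Ccont f z -> 0 < eps ->
  near z (fun w => Cabs (f w - f z) < eps).
Proof.
  intros H He; generalize (Clim_at_near _ _ _ _ H He); apply near_imp; intros w Hw.
  destruct (classic (w = z)) as [-> | N]; [|auto].
  replace (f z - f z) with C0 by ring; rewrite Cabs_C0; exact He.
Qed.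

(** Exceptional points are removed one by one by splitting the interval; continuity glues the two
    halves. *)
Lemma piecewise_const (f : R -> R) (l : list R) (a b : R) : a < b ->
  (forall t, a <= t <= b -> continuity_pt f t) ->
  (forall t, a < t < b -> ~ In t l -> is_derive f t 0%R) -> f a = f b.
Proof.
  revert a b; induction l as [|x l IH]; intros a b L HC HD.
  - destruct (MVT_gen f a b (fun _ => 0%R)) as [c [_ E]].
    + intros t Ht; rewrite Rmin_left, Rmax_right in Ht by lra; apply HD; [assumption | simpl; tauto].
    + intros t Ht; rewrite Rmin_left, Rmax_right in Ht by lra; apply HC; assumption.
    + lra.
  - destruct (classic (a < x < b)) as [Hx|Hx].
    + transitivity (f x); apply IH; try lra; intros t Ht; try (apply HC; lra);
        intros N; apply HD; try lra; intros [E|E]; [lra | contradiction | lra | contradiction].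
    + apply IH; [assumption | assumption|]; intros t Ht N; apply HD; [assumption|].
      intros [E|E]; [subst; contradiction | contradiction].
Qed.

Lemma list_avoid (l : list R) (r : R) : ~ In r l ->
  exists d, 0 < d /\ forall u, Rabs (u - r) < d -> ~ In u l.
Proof.
  induction l as [|x l IH]; intros N; [exists 1%R; split; [lra | simpl; tauto]|].
  destruct IH as [d [Hd H]]; [simpl in N; tauto|].
  assert (P : 0 < Rabs (x - r)) by (apply Rabs_pos_lt; intros E; apply N; left; lra).
  exists (Rmin d (Rabs (x - r))); split; [apply Rmin_pos; assumption|]; intros u Hu [E|E].
  - subst; generalize (Rmin_r d (Rabs (u - r))); lra.
  - apply (H u); [exact (lt_Rmin_l _ _ _ Hu) | exact E].
Qed.

Lemma continuity_2d_swap (f : R -> R -> R) (x y : R) :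
  continuity_2d_pt f x y -> continuity_2d_pt (fun v u => f u v) y x.
Proof. intros H e; destruct (H e) as [d G]; exists d; intros u v Hu Hv; apply G; assumption. Qed.

Lemma continuity_2d_right (f : R -> R -> R) (x y : R) :
  continuity_2d_pt f x y -> continuous (fun v => f x v) y.
Proof.
  intros H; apply continuity_pt_filterlim, continuity_pt_locally; intros e; destruct (H e) as [d G].
  exists d; intros v Hv; apply G; [replace (x - x)%R with 0%R by ring; rewrite Rabs_R0; apply cond_pos | exact Hv].
Qed.

Definition cis (t : R) : Cplx := mkC (cos t) (sin t).
Definition cisN (t : R) : Cplx := mkC (cos t) (- sin t).

Lemma cis_cisN (t : R) : cis t * cisN t = C1.
Proof. generalize (sin2_cos2 t); unfold Rsqr; intros; apply Cplx_eq; simpl; lra. Qed.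

Lemma Cabs_cis (t : R) : Cabs (cis t) = 1%R.
Proof. unfold Cabs, Cnorm2; simpl; generalize (sin2_cos2 t); unfold Rsqr; intros E; rewrite Rplus_comm, E; apply sqrt_1. Qed.

Lemma Cabs_cisN (t : R) : Cabs (cisN t) = 1%R.
Proof.
  unfold Cabs, Cnorm2; simpl; generalize (sin2_cos2 t); unfold Rsqr; intros E.
  replace (cos t * cos t + - sin t * - sin t)%R with 1%R by lra; apply sqrt_1.
Qed.

Lemma cos_lip (a b : R) : Rabs (cos a - cos b) <= Rabs (a - b).
Proof.
  destruct (MVT_abs cos (fun t => (- sin t)%R) b a) as [c [E _]]; [intros; apply derivable_pt_lim_cos|].
  rewrite E, Rabs_Ropp; generalize (SIN_bound c); intros; assert (Rabs (sin c) <= 1) by (apply Rabs_le; lra).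
  generalize (Rabs_pos (a - b)); nra.
Qed.

Lemma sin_lip (a b : R) : Rabs (sin a - sin b) <= Rabs (a - b).
Proof.
  destruct (MVT_abs sin cos b a) as [c [E _]]; [intros; apply derivable_pt_lim_sin|].
  rewrite E; generalize (COS_bound c); intros; assert (Rabs (cos c) <= 1) by (apply Rabs_le; lra).
  generalize (Rabs_pos (a - b)); nra.
Qed.

Lemma cis_lip (a b : R) : Cabs (cis a - cis b) <= 2 * Rabs (a - b).
Proof.
  eapply Rle_trans; [apply Cabs_le_ReIm|]; simpl.
  generalize (cos_lip a b) (sin_lip a b); unfold Rminus; lra.
Qed.

Lemma cisN_lip (a b : R) : Cabs (cisN a - cisN b) <= 2 * Rabs (a - b).
Proof.
  eapply Rle_trans; [apply Cabs_le_ReIm|]; simpl.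
  replace (- sin a + - - sin b)%R with (- (sin a - sin b))%R by ring; rewrite Rabs_Ropp.
  generalize (cos_lip a b) (sin_lip a b); unfold Rminus; lra.
Qed.

Section Liouville.
Variables (tau z0 : Cplx) (F F' : Cplx -> Cplx) (M : R).
Hypothesis Ht : upper_half tau.
Hypothesis HF : forall z, Ccont F z.
Hypothesis HD : forall z, ~ in_lattice z tau -> Cder F z (F' z).
Hypothesis HC : forall z, ~ in_lattice z tau -> Ccont F' z.
Hypothesis HM : forall z, Cabs (F z) <= M.
Hypothesis Hz0 : ~ in_lattice z0 tau.

(** [K r] below is the real part of the first Fourier coefficient of [F] on this circle. For
    holomorphic [F] it equals [2 * PI * r * Re (F' z0)]; being linear in [r], it stays bounded only
    if that derivative vanishes. *)
Let circ (r t : R) : Cplx := z0 + RtoC r * cis t.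
Let g (r t : R) : R := Re (F (circ r t) * cisN t).
(** The factor [C1] is the constant weight that lets [circ_cont2d] apply to [phi] as it does to
    [g]. *)
Let phi (r t : R) : R := Re (F' (circ r t) * C1).
Let K (r : R) : R := RInt (fun t => g r t) 0 (2 * PI).

Lemma circ_dist (u v r t : R) : Cabs (circ u v - circ r t) <= Rabs (u - r) + Rabs r * (2 * Rabs (v - t)).
Proof.
  unfold circ; replace (z0 + RtoC u * cis v - (z0 + RtoC r * cis t)) with
    (RtoC (u - r) * cis v + RtoC r * (cis v - cis t)) by (apply Cplx_eq; simpl; ring).
  eapply Rle_trans; [apply Cabs_triang|]; rewrite !Cabs_mul, !Cabs_RtoC, Cabs_cis, Rmult_1_r.
  apply Rplus_le_compat_l, Rmult_le_compat_l; [apply Rabs_pos | apply cis_lip].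
Qed.

Lemma circ_cont2d (G : Cplx -> Cplx) (c : R -> Cplx) (r t : R) : Ccont G (circ r t) ->
  (forall a b, Cabs (c a - c b) <= 2 * Rabs (a - b)) -> (forall a, Cabs (c a) = 1%R) ->
  continuity_2d_pt (fun u v => Re (G (circ u v) * c v)) r t.
Proof.
  intros HG Hc H1 e; assert (He := cond_pos e).
  destruct (Ccont_near _ _ (e / 2)%R HG ltac:(lra)) as [d [Hd B]].
  set (A := (1 + 2 * Rabs r)%R); assert (HA : 0 < A) by (unfold A; generalize (Rabs_pos r); lra).
  set (Q := (4 * (Cabs (G (circ r t)) + 1))%R); assert (HQ : 0 < Q) by (unfold Q; generalize (Cabs_ge0 (G (circ r t))); lra).
  assert (Hd' : 0 < Rmin (d / A) (e / Q)) by (apply Rmin_pos; apply Rdiv_lt_0_compat; assumption).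
  exists (mkposreal _ Hd'); intros u v Hu Hv; cbn [pos] in Hu, Hv.
  assert (Hu1 : Rabs (u - r) < d / A) by (exact (lt_Rmin_l _ _ _ Hu)).
  assert (Hv1 : Rabs (v - t) < d / A) by (exact (lt_Rmin_l _ _ _ Hv)).
  assert (Hv2 : Rabs (v - t) < e / Q) by (exact (lt_Rmin_r _ _ _ Hv)).
  assert (Near : Cabs (circ u v - circ r t) < d).
  { eapply Rle_lt_trans; [apply circ_dist|].
    replace d with (d / A + Rabs r * (2 * (d / A)))%R by (unfold A; field; fold A; lra).
    apply Rplus_lt_le_compat; [assumption|]; apply Rmult_le_compat_l; [apply Rabs_pos | lra]. }
  specialize (B _ Near).
  replace (Re (G (circ u v) * c v) - Re (G (circ r t) * c t))%R with
    (Re ((G (circ u v) - G (circ r t)) * c v + G (circ r t) * (c v - c t))) by (simpl; ring).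
  eapply Rle_lt_trans; [apply Re_le_Cabs|]; eapply Rle_lt_trans; [apply Cabs_triang|].
  rewrite !Cabs_mul, H1, Rmult_1_r.
  assert (B2 : Cabs (G (circ r t)) * Cabs (c v - c t) <= e / 2); [|lra].
  apply Rle_trans with ((Cabs (G (circ r t)) + 1) * (2 * (e / Q)))%R.
  - apply Rmult_le_compat; try apply Cabs_ge0; [lra|]; generalize (Hc v t); lra.
  - apply Req_le; unfold Q; field; generalize (Cabs_ge0 (G (circ r t))); lra.
Qed.

Lemma g_cont2d (r t : R) : continuity_2d_pt g r t.
Proof. apply circ_cont2d; [apply HF | apply cisN_lip | apply Cabs_cisN]. Qed.

Lemma phi_cont2d (r t : R) : ~ in_lattice (circ r t) tau -> continuity_2d_pt phi r t.
Proof.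
  intros N; apply (circ_cont2d F' (fun _ => C1)); [apply HC, N | | intros; apply Cabs_C1].
  intros; replace (C1 - C1) with C0 by ring; rewrite Cabs_C0; generalize (Rabs_pos (a - b)); lra.
Qed.

Lemma g_int (r : R) : ex_RInt (fun t => g r t) 0 (2 * PI).
Proof. apply (ex_RInt_continuous (V := R_CompleteNormedModule)); intros t _; apply continuity_2d_right, g_cont2d. Qed.

Lemma g_der (r t : R) : ~ in_lattice (circ r t) tau -> is_derive (fun u => g u t) r (phi r t).
Proof.
  intros N; unfold g, phi.
  replace (F' (circ r t) * C1) with ((F' (circ r t) * cisN t + F (circ r t) * C0) * cis t).
  - apply (Rder_Re (fun u => F (circ u t) * cisN t)).
    apply (Rder_chain (fun w => F w * cisN t) (fun u => circ u t)); [|apply Rder_line].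
    apply Cder_mult; [apply HD, N | apply Cder_const].
  - rewrite <- (cis_cisN t); ring.
Qed.

Lemma two_pi_pos : 0 < 2 * PI.
Proof. generalize PI_RGT_0; lra. Qed.

Lemma K_der (r d : R) : 0 < d -> (forall u t, Rabs (u - r) < d -> ~ in_lattice (circ u t) tau) ->
  is_derive K r (RInt (fun t => phi r t) 0 (2 * PI)).
Proof.
  intros Hd Good; assert (P := two_pi_pos).
  assert (Dg : forall u t, Rabs (u - r) < d -> Derive (fun z => g z t) u = phi u t).
  { intros u t Hu; apply is_derive_unique, g_der, Good, Hu. }
  assert (Hr : Rabs (r - r) < d) by (replace (r - r)%R with 0%R by ring; rewrite Rabs_R0; exact Hd).
  assert (X : is_derive K r (RInt (fun t => Derive (fun u => g u t) r) 0 (2 * PI))).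
  { apply is_derive_RInt_param.
    - exists (mkposreal d Hd); intros u Hu t _; exists (phi u t); apply g_der, Good, Hu.
    - intros t _; apply continuity_2d_pt_ext_loc with phi; [|apply phi_cont2d, Good, Hr].
      exists (mkposreal d Hd); intros u v Hu Hv; symmetry; apply Dg, Hu.
    - exists (mkposreal d Hd); intros u _; apply g_int. }
  replace (RInt (fun t => phi r t) 0 (2 * PI)) with (RInt (fun t => Derive (fun u => g u t) r) 0 (2 * PI)); [exact X|].
  apply RInt_ext; intros t _; apply Dg, Hr.
Qed.

(* [phi] integrates to [K r / r] because [r * phi - g] is the derivative in [t] of
   the imaginary part of [F (circ r t) * cisN t]. *)
Lemma K_phi (r : R) : (forall t, ~ in_lattice (circ r t) tau) ->
  (r * RInt (fun t => phi r t) 0 (2 * PI) = K r)%R.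
Proof.
  intros Good; assert (P := two_pi_pos).
  set (m := fun t => (Im (F (circ r t)) * cos t - Re (F (circ r t)) * sin t)%R).
  assert (Hm : forall t, is_derive m t (r * phi r t - g r t)%R).
  { intros t; apply is_derive_Reals.
    assert (Dc : Rder (fun s => circ r s) t (RtoC r * mkC (- sin t) (cos t))).
    { apply Rder_of_parts; unfold circ; simpl.
      - generalize (derivable_pt_lim_plus _ _ _ _ _ (derivable_pt_lim_const (Re z0) t) (derivable_pt_lim_minus _ _ _ _ _ (derivable_pt_lim_scal _ r t _ (derivable_pt_lim_cos t)) (derivable_pt_lim_scal _ 0 t _ (derivable_pt_lim_sin t)))).
        intros X; apply (derivable_pt_lim_eq _ _ _ _ X); ring.
      - generalize (derivable_pt_lim_plus _ _ _ _ _ (derivable_pt_lim_const (Im z0) t) (derivable_pt_lim_plus _ _ _ _ _ (derivable_pt_lim_scal _ r t _ (derivable_pt_lim_sin t)) (derivable_pt_lim_scal _ 0 t _ (derivable_pt_lim_cos t)))).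
        intros X; apply (derivable_pt_lim_eq _ _ _ _ X); ring. }
    assert (D := Rder_chain F _ _ _ _ (HD _ (Good t)) Dc).
    assert (A := proj1 (is_derive_Reals _ _ _) (Rder_Re _ _ _ D)).
    assert (B := proj1 (is_derive_Reals _ _ _) (Rder_Im _ _ _ D)).
    generalize (derivable_pt_lim_minus _ _ _ _ _ (derivable_pt_lim_mult _ _ _ _ _ B (derivable_pt_lim_cos t))
      (derivable_pt_lim_mult _ _ _ _ _ A (derivable_pt_lim_sin t))).
    intros X; apply (derivable_pt_lim_eq _ _ _ _ X).
    unfold phi, g; simpl; set (p := Re (F' (circ r t))); set (q := Im (F' (circ r t))).
    assert (E := sin2_cos2 t); unfold Rsqr in E.
    transitivity (r * p * (sin t * sin t + cos t * cos t) - Re (F (circ r t)) * cos t - Im (F (circ r t)) * sin t)%R; [ring|].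
    rewrite E; ring. }
  assert (Cphi : forall t, continuous (fun t => phi r t) t) by (intros t; apply continuity_2d_right, phi_cont2d, Good).
  assert (Cg : forall t, continuous (fun t => g r t) t) by (intros t; apply continuity_2d_right, g_cont2d).
  assert (Ephi : ex_RInt (fun t => phi r t) 0 (2 * PI)) by (apply (ex_RInt_continuous (V := R_CompleteNormedModule)); intros; apply Cphi).
  assert (I : is_RInt (fun t => r * phi r t - g r t)%R 0 (2 * PI) (minus (m (2 * PI)%R) (m 0%R))).
  { apply (is_RInt_derive (V := R_CompleteNormedModule) m).
    - intros; apply Hm.
    - intros t _; apply (continuous_minus (fun t => r * phi r t)%R (fun t => g r t)); [|apply Cg].
      apply (continuous_mult (fun _ => r) (fun t => phi r t)); [apply continuous_const | apply Cphi]. }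
  apply (is_RInt_unique (V := R_CompleteNormedModule)) in I.
  assert (E : RInt (fun t => r * phi r t - g r t)%R 0 (2 * PI) = (r * RInt (fun t => phi r t) 0 (2 * PI) - K r)%R).
  { unfold K; etransitivity; [apply (RInt_minus (V := R_CompleteNormedModule) (fun t => scal r (phi r t)) (fun t => g r t));
      [apply (ex_RInt_scal (V := R_CompleteNormedModule)); exact Ephi | apply g_int]|].
    rewrite (RInt_scal (V := R_CompleteNormedModule)) by exact Ephi; reflexivity. }
  assert (Em : minus (m (2 * PI)%R) (m 0%R) = 0%R).
  { unfold m, circ, cis; rewrite cos_2PI, sin_2PI, cos_0, sin_0; unfold minus, plus, opp; simpl; ring. }
  rewrite Em in I; rewrite I in E; lra.
Qed.

Lemma K_bound (r : R) : Rabs (K r) <= 2 * PI * M.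
Proof.
  unfold K; replace (2 * PI * M)%R with ((2 * PI - 0) * M)%R by ring.
  apply abs_RInt_le_const; [generalize two_pi_pos; lra | apply g_int|].
  intros t _; eapply Rle_trans; [apply Re_le_Cabs|]; rewrite Cabs_mul, Cabs_cisN, Rmult_1_r; apply HM.
Qed.

(** Holds also at radii whose circle meets the lattice, since [F] itself is continuous there; this
    carries [K r / r] across the bad radii. *)
Lemma K_cont (r : R) : continuity_pt K r.
Proof.
  apply continuity_pt_locally; intros e; assert (He := cond_pos e); assert (P := two_pi_pos).
  assert (He' : 0 < e / (2 * (2 * PI))) by (apply Rdiv_lt_0_compat; lra).
  destruct (uniform_continuity_2d_1d (fun t u => g u t) 0 (2 * PI) r
    ltac:(intros; apply continuity_2d_swap, g_cont2d) (mkposreal _ He')) as [d H].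
  exists d; intros u Hu; assert (Hd := cond_pos d).
  unfold ball in Hu; simpl in Hu; unfold AbsRing_ball, abs, minus, plus, opp in Hu; simpl in Hu.
  apply Rabs_def2 in Hu.
  replace (K u - K r)%R with (RInt (fun t => minus (g u t) (g r t)) 0 (2 * PI)).
  2:{ etransitivity; [apply (RInt_minus (V := R_CompleteNormedModule)); apply g_int | reflexivity]. }
  apply Rle_lt_trans with ((2 * PI - 0) * (e / (2 * (2 * PI))))%R.
  - apply abs_RInt_le_const; [lra | apply (ex_RInt_minus (V := R_CompleteNormedModule)); apply g_int|].
    intros t Hu'; left; apply (H t r t u); try lra.
    replace (t - t)%R with 0%R by ring; rewrite Rabs_R0; exact Hd.
  - replace ((2 * PI - 0) * (e / (2 * (2 * PI))))%R with (e / 2)%R by (field; lra); lra.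
Qed.

(** A circle meets the lattice only when its radius is the distance from [z0] to a lattice point,
    and [lat_lower] leaves finitely many candidates up to [R0]. *)
Lemma bad_radii (R0 : R) : exists l : list R, forall r t, 0 <= r <= R0 -> ~ In r l -> ~ in_lattice (circ r t) tau.
Proof.
  set (A := (1 + (1 + Cabs tau) / Im tau)%R).
  assert (HA : 1 <= A).
  { unfold A; assert (0 <= (1 + Cabs tau) / Im tau); [|lra].
    apply Rdiv_le_0_compat; [generalize (Cabs_ge0 tau); lra | exact Ht]. }
  destruct (INR_unbounded (A * (Cabs z0 + R0))) as [N HN].
  set (zr := map (fun i => Z.of_nat i - Z.of_nat N)%Z (seq 0 (2 * N + 1))).
  assert (Hzr : forall i, Rabs (IZR i) <= INR N -> In i zr).
  { intros i Hi; rewrite <- abs_IZR, INR_IZR_INZ in Hi; apply le_IZR in Hi.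
    apply in_map_iff; exists (Z.to_nat (i + Z.of_nat N)); split; [lia | apply in_seq; lia]. }
  exists (flat_map (fun m => map (fun n => Cabs (lat tau m n - z0)) zr) zr).
  intros r t Hr NI [m [n E]]; apply NI.
  assert (B : Rabs (IZR m) + Rabs (IZR n) <= INR N).
  { eapply Rle_trans; [apply lat_lower, Ht|]; fold A; left; eapply Rle_lt_trans; [|exact HN].
    apply Rmult_le_compat_l; [lra|]; rewrite <- E; unfold circ.
    eapply Rle_trans; [apply Cabs_triang|]; rewrite Cabs_mul, Cabs_RtoC, Cabs_cis, (Rabs_pos_eq r) by lra; lra. }
  apply in_flat_map; exists m; split; [apply Hzr; generalize (Rabs_pos (IZR n)); lra|].
  apply in_map_iff; exists n; split; [|apply Hzr; generalize (Rabs_pos (IZR m)); lra].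
  rewrite <- E; unfold circ; replace (z0 + RtoC r * cis t - z0) with (RtoC r * cis t) by ring.
  rewrite Cabs_mul, Cabs_RtoC, Cabs_cis, Rabs_pos_eq by lra; ring.
Qed.

(** Away from the bad radii [r K' = K], so the quotient has derivative zero there. *)
Lemma K_ratio (a b : R) : 0 < a < b -> (K a / a = K b / b)%R.
Proof.
  intros Hab; destruct (bad_radii (b + 1)) as [l Hl].
  apply (piecewise_const (fun r => K r / r)%R l a b); [lra | |].
  - intros r Hr; apply (continuity_pt_div K id); [apply K_cont | apply derivable_continuous_pt, derivable_pt_id | unfold id; lra].
  - intros r Hr N; destruct (list_avoid l r N) as [d [Hd H]].
    (* The bounds [a] and [1] keep nearby radii between 0 and [b + 1], the range that [l] covers. *)
    assert (Hd' : 0 < Rmin d (Rmin 1 a)) by (repeat apply Rmin_pos; lra).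
    assert (Good : forall u t, Rabs (u - r) < Rmin d (Rmin 1 a) -> ~ in_lattice (circ u t) tau).
    { intros u t Hu; apply Hl.
      - assert (Rabs (u - r) < 1) by (exact (lt_Rmin_l _ _ _ (lt_Rmin_r _ _ _ Hu))).
        assert (Q : Rabs (u - r) < a) by (exact (lt_Rmin_r _ _ _ (lt_Rmin_r _ _ _ Hu))).
        apply Rabs_def2 in H0; apply Rabs_def2 in Q; lra.
      - apply H; exact (lt_Rmin_l _ _ _ Hu). }
    assert (D := K_der r _ Hd' Good).
    assert (Gr : forall t, ~ in_lattice (circ r t) tau).
    { intros t; apply Good; replace (r - r)%R with 0%R by ring; rewrite Rabs_R0; exact Hd'. }
    assert (E := K_phi r Gr).
    assert (X := is_derive_div K (fun r => r) r _ _ D (is_derive_id r) ltac:(lra)).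
    replace 0%R with ((RInt (fun t => phi r t) 0 (2 * PI) * r - K r * one) / r ^ 2)%R; [exact X|].
    unfold one; simpl; rewrite <- E; field; lra.
Qed.

Lemma K_zero (a : R) : 0 < a -> K a = 0%R.
Proof.
  intros Ha; assert (P := two_pi_pos); apply NNPP; intros N.
  assert (Pk : 0 < Rabs (K a)) by (apply Rabs_pos_lt; exact N).
  (* Large enough that [Rabs (K a) * b > 2 * PI * M * a], against linear growth combined with
     [K_bound]. *)
  set (b := (a + a * (2 * PI * M) / Rabs (K a) + 1)%R).
  assert (HM0 : 0 <= M) by (eapply Rle_trans; [apply Cabs_ge0 | apply (HM C0)]).
  assert (Q : 0 <= a * (2 * PI * M) / Rabs (K a)) by (apply Rdiv_le_0_compat; [apply Rmult_le_pos; [lra | apply Rmult_le_pos; lra] | exact Pk]).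
  assert (E := K_ratio a b ltac:(unfold b; lra)).
  assert (E2 : (K a * b = K b * a)%R).
  { assert (K a = K b / b * a)%R by (rewrite <- E; field; lra). rewrite H at 1; field; unfold b; lra. }
  assert (B := K_bound b).
  assert (E3 : (Rabs (K a) * b <= 2 * PI * M * a)%R).
  { replace (Rabs (K a) * b)%R with (Rabs (K b) * a)%R; [apply Rmult_le_compat_r; lra|].
    rewrite <- (Rabs_pos_eq a) at 1 by lra; rewrite <- Rabs_mult, <- E2, Rabs_mult, (Rabs_pos_eq b) by (unfold b; lra); reflexivity. }
  unfold b in E3; rewrite !Rmult_plus_distr_l in E3.
  replace (Rabs (K a) * (a * (2 * PI * M) / Rabs (K a)))%R with (2 * PI * M * a)%R in E3 by (field; lra).
  nra.
Qed.

(** On a small circle of radius [a] the coefficient [K a] lies within half of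
    [2 * PI * a * |Re (F' z0)|] of [2 * PI * a * Re (F' z0)]; as [K a = 0], the derivative must
    vanish. *)
Lemma Re_derivative_zero : Re (F' z0) = 0%R.
Proof.
  apply NNPP; intros N; assert (P := two_pi_pos).
  set (p := Re (F' z0)) in *; assert (Pp : 0 < Rabs p) by (apply Rabs_pos_lt; exact N).
  destruct (Cder_linear F z0 (F' z0) (Rabs p / 2) (HD z0 Hz0) ltac:(lra)) as [d [Hd H]].
  set (a := (d / 2)%R); assert (Ha : 0 < a < d) by (unfold a; lra).
  (* The integrand [g a] with [F] replaced by its affine approximation at [z0]; the trigonometric
     terms integrate to zero. *)
  set (c := fun t => (Re (F z0) * cos t + Im (F z0) * sin t + a * p)%R).
  assert (Ic : is_RInt c 0 (2 * PI) (a * p * (2 * PI))%R).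
  { set (C := fun t => (Re (F z0) * sin t - Im (F z0) * cos t + a * p * t)%R).
    replace (a * p * (2 * PI))%R with (minus (C (2 * PI)%R) (C 0%R)).
    2:{ unfold C; rewrite sin_2PI, cos_2PI, sin_0, cos_0; unfold minus, plus, opp; simpl; ring. }
    apply (is_RInt_derive (V := R_CompleteNormedModule)).
    - intros t _; apply is_derive_Reals; unfold C, c.
      generalize (derivable_pt_lim_plus _ _ _ _ _ (derivable_pt_lim_minus _ _ _ _ _ (derivable_pt_lim_scal _ (Re (F z0)) t _ (derivable_pt_lim_sin t)) (derivable_pt_lim_scal _ (Im (F z0)) t _ (derivable_pt_lim_cos t))) (derivable_pt_lim_scal _ (a * p) t _ (derivable_pt_lim_id t))).
      intros X; apply (derivable_pt_lim_eq _ _ _ _ X); ring.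
    - intros t _; apply continuity_pt_filterlim; unfold c.
      apply (continuity_pt_plus (fun t => Re (F z0) * cos t + Im (F z0) * sin t)%R (fun _ => a * p)%R);
        [|apply continuity_pt_const; intros x y; reflexivity].
      apply (continuity_pt_plus (fun t => Re (F z0) * cos t)%R (fun t => Im (F z0) * sin t)%R);
        apply continuity_pt_scal; [apply continuity_cos | apply continuity_sin]. }
  assert (Ec : ex_RInt c 0 (2 * PI)) by (eexists; exact Ic).
  apply (is_RInt_unique (V := R_CompleteNormedModule)) in Ic.
  assert (B : Rabs (RInt (fun t => minus (g a t) (c t)) 0 (2 * PI)) <= (2 * PI - 0) * (Rabs p / 2 * a)).
  { apply abs_RInt_le_const; [lra | apply (ex_RInt_minus (V := R_CompleteNormedModule)); [apply g_int | exact Ec]|].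
    intros t _.
    assert (Dist : Cabs (circ a t - z0) = a).
    { unfold circ; replace (z0 + RtoC a * cis t - z0) with (RtoC a * cis t) by ring.
      rewrite Cabs_mul, Cabs_RtoC, Cabs_cis, Rabs_pos_eq by lra; ring. }
    specialize (H (circ a t) ltac:(lra)); rewrite Dist in H.
    replace (minus (g a t) (c t)) with (Re ((F (circ a t) - F z0 - (circ a t - z0) * F' z0) * cisN t)).
    - eapply Rle_trans; [apply Re_le_Cabs|]; rewrite Cabs_mul, Cabs_cisN, Rmult_1_r; exact H.
    - replace ((F (circ a t) - F z0 - (circ a t - z0) * F' z0) * cisN t) with
        (F (circ a t) * cisN t - F z0 * cisN t - RtoC a * F' z0).
      + unfold g, c, p, minus, plus, opp; simpl; ring.
      + unfold circ; transitivity (F (z0 + RtoC a * cis t) * cisN t - F z0 * cisN t - RtoC a * (cis t * cisN t) * F' z0); [rewrite cis_cisN; ring | ring]. }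
  assert (EB : RInt (fun t => minus (g a t) (c t)) 0 (2 * PI) = minus (K a) (a * p * (2 * PI))%R).
  { rewrite <- Ic; exact (RInt_minus (V := R_CompleteNormedModule) (fun t => g a t) c 0 (2 * PI) (g_int a) Ec). }
  rewrite EB, (K_zero a) in B by lra.
  unfold minus, plus, opp in B; simpl in B; rewrite Rplus_0_l, Rabs_Ropp, !Rabs_mult in B.
  rewrite (Rabs_pos_eq a), (Rabs_pos_eq 2), (Rabs_pos_eq PI) in B by (generalize PI_RGT_0; lra).
  assert (0 < a * Rabs p * (2 * PI)) by (apply Rmult_lt_0_compat; [apply Rmult_lt_0_compat; lra | lra]); nra.
Qed.
End Liouville.

(** The imaginary part of the derivative is reached through the function [i * F]. *)
Lemma entire_bounded_derivative (tau : Cplx) (F F' : Cplx -> Cplx) (M : R) : upper_half tau ->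
  (forall z, Ccont F z) -> (forall z, ~ in_lattice z tau -> Cder F z (F' z)) ->
  (forall z, ~ in_lattice z tau -> Ccont F' z) -> (forall z, Cabs (F z) <= M) ->
  forall z, ~ in_lattice z tau -> F' z = C0.
Proof.
  intros Ht HF HD HC HM z Hz; apply Cplx_eq.
  - exact (Re_derivative_zero tau z F F' M Ht HF HD HC HM Hz).
  - set (i := mkC 0 1).
    assert (E : Re (i * F' z) = 0%R).
    { apply (Re_derivative_zero tau z (fun w => i * F w) (fun w => i * F' w) M Ht); try assumption.
      - intros w; apply Clim_at_mult; [apply Clim_at_const | apply HF].
      - intros w Hw; eapply Cder_eq; [apply Cder_mult; [apply Cder_const | apply HD, Hw] | simpl; ring].
      - intros w Hw; apply Clim_at_mult; [apply Clim_at_const | apply HC, Hw].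
      - intros w; rewrite Cabs_mul; replace (Cabs i) with 1%R; [rewrite Rmult_1_l; apply HM|].
        unfold Cabs, Cnorm2; simpl; replace (0 * 0 + 1 * 1)%R with 1%R by ring; symmetry; apply sqrt_1. }
    unfold i in E; simpl in *; lra.
Qed.

(** Uniform continuity gives a step length over which [f] rises by at most 1; walking from the
    origin to [(x, y)] in [n] such steps bounds [f] by [f 0 0 + n]. *)
Lemma bounded_square (f : R -> R -> R) :
  (forall x y, continuity_2d_pt f x y) ->
  exists M, forall x y, 0 <= x <= 1 -> 0 <= y <= 1 -> f x y <= M.
Proof.
  intros Hf.
  destruct (uniform_continuity_2d f 0 1 0 1 ltac:(intros; apply Hf) (mkposreal 1 Rlt_0_1)) as [d H]; simpl in H.
  assert (Hd := cond_pos d).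
  destruct (INR_unbounded (/ d)) as [n Hn].
  assert (Pd : 0 < / d) by (apply Rinv_0_lt_compat; exact Hd).
  assert (Pn : 0 < INR n) by lra.
  assert (Pi : 0 < / INR n) by (apply Rinv_0_lt_compat; exact Pn).
  assert (Sm : / INR n < d).
  { rewrite <- (Rinv_inv d); apply Rinv_lt_contravar; [nra | exact Hn]. }
  exists (f 0 0 + INR n)%R; intros x y Hx Hy.
  assert (Ch : forall k, (k <= n)%nat -> f (INR k * / INR n * x)%R (INR k * / INR n * y)%R <= f 0 0 + INR k).
  { induction k; intros Hk.
    - simpl; rewrite !Rmult_0_l; lra.
    - specialize (IHk ltac:(lia)); rewrite S_INR.
      assert (Lk : INR k + 1 <= INR n) by (rewrite <- S_INR; apply le_INR, Hk).
      assert (Pk := pos_INR k).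
      assert (U : forall j, 0 <= j <= INR n -> forall w, 0 <= w <= 1 -> 0 <= j * / INR n * w <= 1).
      { intros j Hj w Hw; assert (0 <= j * / INR n <= 1).
        { split; [apply Rmult_le_pos; lra|]; apply Rmult_le_reg_r with (INR n); [lra|].
          rewrite Rmult_assoc, Rinv_l by lra; lra. }
        split; [apply Rmult_le_pos; lra | nra]. }
      assert (Step : forall w, 0 <= w <= 1 -> Rabs ((INR k + 1) * / INR n * w - INR k * / INR n * w) < d).
      { intros w Hw; replace ((INR k + 1) * / INR n * w - INR k * / INR n * w)%R with (/ INR n * w)%R by ring.
        rewrite Rabs_pos_eq by (apply Rmult_le_pos; lra).
        apply Rle_lt_trans with (/ INR n * 1)%R; [apply Rmult_le_compat_l; lra | lra]. }
      assert (J0 : 0 <= INR k <= INR n) by lra; assert (J1 : 0 <= INR k + 1 <= INR n) by lra.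
      assert (B := H (INR k * / INR n * x)%R (INR k * / INR n * y)%R ((INR k + 1) * / INR n * x)%R ((INR k + 1) * / INR n * y)%R
        (U _ J0 _ Hx) (U _ J0 _ Hy) (U _ J1 _ Hx) (U _ J1 _ Hy) (Step _ Hx) (Step _ Hy)).
      apply Rabs_def2 in B; lra. }
  specialize (Ch n (le_n n)).
  replace (INR n * / INR n * x)%R with x in Ch by (field; lra).
  replace (INR n * / INR n * y)%R with y in Ch by (field; lra); exact Ch.
Qed.

Lemma Zperiod_induct (tau : Cplx) (f : Cplx -> Cplx) :
  (forall z, ~ in_lattice z tau -> f (z + C1) = f z) ->
  (forall z, ~ in_lattice z tau -> f (z + tau) = f z) ->
  forall m n z, ~ in_lattice z tau -> f (z + lat tau m n) = f z.
Proof.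
  intros H1 H2.
  (* The periodicity hypotheses apply off the lattice, so the induction carries along that every
     translate stays off it. *)
  assert (G : forall w, (forall z, ~ in_lattice (z + w) tau <-> ~ in_lattice z tau) ->
    (forall z, ~ in_lattice z tau -> f (z + w) = f z) ->
    forall k z, ~ in_lattice z tau -> f (z + ZtoC k * w) = f z /\ ~ in_lattice (z + ZtoC k * w) tau).
  { intros w Hw Hf k; apply (Z.bi_induction (fun k => forall z, ~ in_lattice z tau -> f (z + ZtoC k * w) = f z /\ ~ in_lattice (z + ZtoC k * w) tau)).
    - intros ? ? ->; tauto.
    - intros z Hz; replace (z + ZtoC 0 * w) with z by ring; tauto.
    - intros j.
      assert (Ej : forall z, z + ZtoC (Z.succ j) * w = z + ZtoC j * w + w).
      { intros z; unfold Z.succ, ZtoC, RtoC; rewrite plus_IZR; apply Cplx_eq; simpl; ring. }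
      split; intros IH z Hz; [|].
      + destruct (IH z Hz) as [E N]; rewrite Ej; split; [rewrite Hf by exact N; exact E | apply Hw; exact N].
      + destruct (IH z Hz) as [E N]; rewrite Ej in E, N; apply (proj1 (Hw _)) in N; split; [|exact N].
        rewrite <- E; symmetry; apply Hf, N. }
  intros m n z Hz; unfold lat.
  replace (z + (ZtoC m + ZtoC n * tau)) with (z + ZtoC m * C1 + ZtoC n * tau) by ring.
  assert (L1 : forall z, ~ in_lattice (z + C1) tau <-> ~ in_lattice z tau) by (intros; rewrite in_lattice_1; tauto).
  assert (L2 : forall z, ~ in_lattice (z + tau) tau <-> ~ in_lattice z tau) by (intros; rewrite in_lattice_tau; tauto).
  destruct (G C1 L1 H1 m z Hz) as [E1 N1]; destruct (G tau L2 H2 n _ N1) as [E2 _].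
  rewrite E2; exact E1.
Qed.

Lemma frac_part_exists (x : R) : exists k : Z, 0 <= x - IZR k <= 1.
Proof. exists (Int_part x); generalize (base_Int_part x); lra. Qed.

(** Filling in the value [L] at all lattice points gives a function that is continuous everywhere,
    because periodicity moves the limit at the origin to each of them, and bounded, because a period
    parallelogram is compact. It is then constant, and continuity at the origin identifies the
    constant. *)
Lemma elliptic_liouville (tau : Cplx) (f f' : Cplx -> Cplx) (L : Cplx) : upper_half tau ->
  (forall z, ~ in_lattice z tau -> Cder f z (f' z)) ->
  (forall z, ~ in_lattice z tau -> Ccont f' z) ->
  (forall z, ~ in_lattice z tau -> f (z + C1) = f z) ->
  (forall z, ~ in_lattice z tau -> f (z + tau) = f z) ->
  Clim_at f C0 L -> forall z, ~ in_lattice z tau -> f z = L.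
Proof.
  intros Ht HD HC H1 H2 HL z Hz.
  assert (Per := Zperiod_induct tau f H1 H2).
  set (F := fun w => if excluded_middle_informative (in_lattice w tau) then L else f w).
  assert (Fin : forall w, in_lattice w tau -> F w = L).
  { intros w Hw; unfold F; destruct (excluded_middle_informative _); tauto. }
  assert (Fout : forall w, ~ in_lattice w tau -> F w = f w).
  { intros w Hw; unfold F; destruct (excluded_middle_informative _); tauto. }
  assert (FD : forall w, ~ in_lattice w tau -> Cder F w (f' w)).
  { intros w Hw; apply Cder_ext with f; [|apply HD, Hw].
    generalize (notin_near w tau Ht Hw); apply near_imp; intros u Hu; symmetry; apply Fout, Hu. }
  assert (FC : forall w, Ccont F w).
  { intros w; destruct (classic (in_lattice w tau)) as [Hw|Hw]; [|exact (Cder_cont _ _ _ (FD w Hw))].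
    unfold Ccont; rewrite (Fin w Hw); apply near_Clim_at; intros e He.
    destruct Hw as [m [n Ew]].
    destruct (near_and _ _ _ (Clim_at_near _ _ _ _ HL He) (small_notin tau Ht)) as [d [Hd H]].
    exists d; split; [exact Hd|]; intros u Hu Nu.
    destruct (H (u - w)) as [A B]; [replace (u - w - C0) with (u - w) by ring; exact Hu|].
    assert (Nuw := Csub_neq0 _ _ Nu).
    assert (Nl := offlat_notin _ _ B Nuw).
    assert (Eu : u = (u - w) + lat tau m n) by (rewrite <- Ew; ring).
    rewrite Fout by (rewrite Eu, in_lattice_shift; exact Nl).
    rewrite Eu, Per by exact Nl; apply A, Nuw. }
  assert (FP : forall w m n, F (w + lat tau m n) = F w).
  { intros w m n; destruct (classic (in_lattice w tau)) as [Hw|Hw].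
    - rewrite !Fin; [reflexivity | exact Hw | rewrite in_lattice_shift; exact Hw].
    - rewrite !Fout; [apply Per, Hw | exact Hw | rewrite in_lattice_shift; exact Hw]. }
  destruct (bounded_square (fun x y => Cabs (F (RtoC x + RtoC y * tau)))) as [M HM].
  { intros x y e; destruct (Ccont_near F (RtoC x + RtoC y * tau) e (FC _) (cond_pos e)) as [d [Hd H]].
    assert (Pt := Cabs_ge0 tau).
    assert (Hd' : 0 < d / (1 + Cabs tau)) by (apply Rdiv_lt_0_compat; lra).
    exists (mkposreal _ Hd'); simpl; intros u v Hu Hv.
    assert (Nr : Cabs (RtoC u + RtoC v * tau - (RtoC x + RtoC y * tau)) < d).
    { replace (RtoC u + RtoC v * tau - (RtoC x + RtoC y * tau)) with (RtoC (u - x) + RtoC (v - y) * tau) by (apply Cplx_eq; simpl; ring).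
      eapply Rle_lt_trans; [apply Cabs_triang|]; rewrite Cabs_mul, !Cabs_RtoC.
      replace d with (d / (1 + Cabs tau) + d / (1 + Cabs tau) * Cabs tau)%R by (field; lra).
      apply Rplus_lt_le_compat; [assumption | apply Rmult_le_compat_r; lra]. }
    specialize (H _ Nr); eapply Rle_lt_trans; [|exact H].
    set (p := F (RtoC u + RtoC v * tau)); set (q := F (RtoC x + RtoC y * tau)).
    apply Rabs_le; generalize (Cabs_sub_ge p q) (Cabs_sub_ge q p); rewrite (Cabs_sub_sym q p); lra. }
  assert (FB : forall w, Cabs (F w) <= M).
  { intros w; destruct (coords tau w Ht) as [x [y ->]].
    destruct (frac_part_exists x) as [m Hm]; destruct (frac_part_exists y) as [n Hn].
    replace (RtoC x + RtoC y * tau) with (RtoC (x - IZR m) + RtoC (y - IZR n) * tau + lat tau m n)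
      by (unfold lat, ZtoC; apply Cplx_eq; simpl; ring).
    rewrite FP; apply HM; assumption. }
  assert (Z0 := entire_bounded_derivative tau F f' M Ht FC FD HC FB).
  assert (Const : forall w, ~ in_lattice w tau -> F w = F z).
  { intros w Hw; apply (const_off_lattice tau F Ht); try assumption.
    intros u Hu; rewrite <- (Z0 u Hu); apply FD, Hu. }
  rewrite <- (Fout z Hz); apply (Clim_at_unique F C0); [|].
  - apply Clim_at_ext with (fun _ => F z); [|apply Clim_at_const].
    generalize (small_notin tau Ht); apply near_imp; intros w Hw N; symmetry; apply Const, offlat_notin; assumption.
  - rewrite <- (Fin C0); [apply FC | exists 0%Z, 0%Z; symmetry; apply lat_00].
Qed.

(** * Behaviour of the derivatives under periods *)

Definition eta1t (tau : Cplx) : Cplx := RtoC 2 * zt (RtoC (1 / 2)) tau.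
(** Total [tau]-derivative of [eta2]: the point [tau / 2] moves as well, whence the term in [wp]. *)
Definition eta2t (tau : Cplx) : Cplx :=
  RtoC 2 * (zt (tau / RtoC 2) tau - wp (tau / RtoC 2) tau / RtoC 2).

Lemma Cder_eta1 (tau b : Cplx) : upper_half tau ->
  Cder (fun h => eta1 (tau + h * b)) C0 (b * eta1t tau).
Proof.
  intros Ht; assert (D := Der2_wzeta _ tau Ht (half1_notin tau Ht) C0 b).
  eapply Cder_eq; [eapply Cder_ext; [|apply (Cder_mult (fun _ => RtoC 2)); [apply Cder_const | exact D]]|].
  - apply near_true; intros h; simpl; unfold eta1; do 2 f_equal; ring.
  - unfold eta1t; simpl; ring.
Qed.

Lemma Cder_eta2 (tau b : Cplx) : upper_half tau ->
  Cder (fun h => eta2 (tau + h * b)) C0 (b * eta2t tau).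
Proof.
  intros Ht; assert (D := Der2_wzeta _ tau Ht (half2_notin tau Ht) (b / RtoC 2) b).
  eapply Cder_eq; [eapply Cder_ext; [|apply (Cder_mult (fun _ => RtoC 2)); [apply Cder_const | exact D]]|].
  - apply near_true; intros h; simpl; unfold eta2; do 2 f_equal; cfield.
  - unfold eta2t; simpl; cfield.
Qed.

Section Periodicity.
Variables z tau : Cplx.
Hypothesis Ht : upper_half tau.
Hypothesis Hz : ~ in_lattice z tau.

Lemma notin_1 : ~ in_lattice (z + C1) tau.
Proof. rewrite in_lattice_1; exact Hz. Qed.
Lemma notin_tau : ~ in_lattice (z + tau) tau.
Proof. rewrite in_lattice_tau; exact Hz. Qed.

Lemma shift_path_1 (f : Cplx -> Cplx -> Cplx) (e : Cplx -> Cplx) (a b : Cplx) :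
  (forall z tau, upper_half tau -> ~ in_lattice z tau -> f (z + C1) tau = f z tau + e tau) ->
  near C0 (fun h => f (z + h * a) (tau + h * b) + e (tau + h * b) = f (z + C1 + h * a) (tau + h * b)).
Proof.
  intros H; generalize (notin_path z tau a b Ht Hz); apply near_imp; intros h [H1 H2].
  rewrite <- H by assumption; f_equal; ring.
Qed.

Lemma shift_path_tau (f : Cplx -> Cplx -> Cplx) (e : Cplx -> Cplx) (a b : Cplx) :
  (forall z tau, upper_half tau -> ~ in_lattice z tau -> f (z + tau) tau = f z tau + e tau) ->
  near C0 (fun h => f (z + h * a) (tau + h * b) + e (tau + h * b) = f (z + tau + h * (a + b)) (tau + h * b)).
Proof.
  intros H; generalize (notin_path z tau a b Ht Hz); apply near_imp; intros h [H1 H2].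
  rewrite <- H by assumption; f_equal; ring.
Qed.

(** The relation [wzeta_1] holds along whole lines in [(z, tau)] and is differentiated there; the
    direction [(- C1, C0)] then yields the periodicity of [wp], and [(C0, C1)] that of [zt] up to
    [eta1t]. *)
Lemma zeta_shift_1 (a b : Cplx) :
  a * - wp (z + C1) tau + b * zt (z + C1) tau = a * - wp z tau + b * zt z tau + b * eta1t tau.
Proof.
  apply (Cder_unique (fun h => wzeta (z + C1 + h * a) (tau + h * b)) C0).
  - exact (Der2_wzeta _ _ Ht notin_1 a b).
  - eapply Cder_ext; [apply (shift_path_1 wzeta eta1 a b); intros; apply wzeta_1; assumption|].
    apply Cder_plus; [exact (Der2_wzeta _ _ Ht Hz a b) | apply Cder_eta1, Ht].
Qed.

(** When [tau] moves with speed [b], the translate [z + tau] moves with speed [a + b]. This produces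
    the extra [wp] in [zt_tau] and, one derivative later, the extra [- wp'] in [wpt_tau]. *)
Lemma zeta_shift_tau (a b : Cplx) :
  (a + b) * - wp (z + tau) tau + b * zt (z + tau) tau = a * - wp z tau + b * zt z tau + b * eta2t tau.
Proof.
  apply (Cder_unique (fun h => wzeta (z + tau + h * (a + b)) (tau + h * b)) C0).
  - exact (Der2_wzeta _ _ Ht notin_tau (a + b) b).
  - eapply Cder_ext; [apply (shift_path_tau wzeta eta2 a b); intros; apply wzeta_tau; assumption|].
    apply Cder_plus; [exact (Der2_wzeta _ _ Ht Hz a b) | apply Cder_eta2, Ht].
Qed.

Lemma wp_1 : wp (z + C1) tau = wp z tau.
Proof.
  assert (E := zeta_shift_1 (- C1) C0); transitivity (- C1 * - wp (z + C1) tau + C0 * zt (z + C1) tau); [ring|].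
  rewrite E; ring.
Qed.

Lemma zt_1 : zt (z + C1) tau = zt z tau + eta1t tau.
Proof.
  assert (E := zeta_shift_1 C0 C1); transitivity (C0 * - wp (z + C1) tau + C1 * zt (z + C1) tau); [ring|].
  rewrite E; ring.
Qed.

Lemma wp_tau : wp (z + tau) tau = wp z tau.
Proof.
  assert (E := zeta_shift_tau (- C1) C0); transitivity ((- C1 + C0) * - wp (z + tau) tau + C0 * zt (z + tau) tau); [ring|].
  rewrite E; ring.
Qed.

Lemma zt_tau : zt (z + tau) tau = zt z tau + eta2t tau + wp z tau.
Proof.
  assert (E := zeta_shift_tau (- C1) C1); transitivity ((- C1 + C1) * - wp (z + tau) tau + C1 * zt (z + tau) tau); [ring|].
  rewrite E; ring.
Qed.
End Periodicity.

Lemma plus_C0 (x y : Cplx) : x = y -> x = y + C0.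
Proof. intros ->; ring. Qed.

Section Periodicity2.
Variables z tau : Cplx.
Hypothesis Ht : upper_half tau.
Hypothesis Hz : ~ in_lattice z tau.

Lemma wp_shift_1 (a b : Cplx) :
  a * wp' (z + C1) tau + b * wpt (z + C1) tau = a * wp' z tau + b * wpt z tau.
Proof.
  apply (Cder_unique (fun h => wp (z + C1 + h * a) (tau + h * b)) C0).
  - exact (Der2_wp _ _ Ht (notin_1 _ _ Hz) a b).
  - eapply Cder_ext; [apply (shift_path_1 z tau Ht Hz wp (fun _ => C0) a b); intros; apply plus_C0, wp_1; assumption|].
    replace (a * wp' z tau + b * wpt z tau) with (a * wp' z tau + b * wpt z tau + C0) by ring.
    apply Cder_plus; [exact (Der2_wp _ _ Ht Hz a b) | apply Cder_const].
Qed.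

Lemma wp_shift_tau (a b : Cplx) :
  (a + b) * wp' (z + tau) tau + b * wpt (z + tau) tau = a * wp' z tau + b * wpt z tau.
Proof.
  apply (Cder_unique (fun h => wp (z + tau + h * (a + b)) (tau + h * b)) C0).
  - exact (Der2_wp _ _ Ht (notin_tau _ _ Hz) (a + b) b).
  - eapply Cder_ext; [apply (shift_path_tau z tau Ht Hz wp (fun _ => C0) a b); intros; apply plus_C0, wp_tau; assumption|].
    replace (a * wp' z tau + b * wpt z tau) with (a * wp' z tau + b * wpt z tau + C0) by ring.
    apply Cder_plus; [exact (Der2_wp _ _ Ht Hz a b) | apply Cder_const].
Qed.

Lemma wp'_1 : wp' (z + C1) tau = wp' z tau.
Proof.
  assert (E := wp_shift_1 C1 C0); transitivity (C1 * wp' (z + C1) tau + C0 * wpt (z + C1) tau); [ring|]; rewrite E; ring.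
Qed.
Lemma wpt_1 : wpt (z + C1) tau = wpt z tau.
Proof.
  assert (E := wp_shift_1 C0 C1); transitivity (C0 * wp' (z + C1) tau + C1 * wpt (z + C1) tau); [ring|]; rewrite E; ring.
Qed.
Lemma wp'_tau : wp' (z + tau) tau = wp' z tau.
Proof.
  assert (E := wp_shift_tau C1 C0); transitivity ((C1 + C0) * wp' (z + tau) tau + C0 * wpt (z + tau) tau); [ring|]; rewrite E; ring.
Qed.
Lemma wpt_tau : wpt (z + tau) tau = wpt z tau - wp' z tau.
Proof.
  assert (E := wp_shift_tau (- C1) C1); transitivity ((- C1 + C1) * wp' (z + tau) tau + C1 * wpt (z + tau) tau); [ring|]; rewrite E; ring.
Qed.
End Periodicity2.

Section Periodicity3.
Variables z tau : Cplx.
Hypothesis Ht : upper_half tau.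
Hypothesis Hz : ~ in_lattice z tau.

Lemma wp2_1 : wp2 (z + C1) tau = wp2 z tau.
Proof.
  transitivity (C1 * wp2 (z + C1) tau + C0 * wpt' (z + C1) tau); [ring|].
  apply (Cder_unique (fun h => wp' (z + C1 + h * C1) (tau + h * C0)) C0).
  - exact (Der2_wp' _ _ Ht (notin_1 _ _ Hz) C1 C0).
  - eapply Cder_ext; [apply (shift_path_1 z tau Ht Hz wp' (fun _ => C0) C1 C0); intros; apply plus_C0, wp'_1; assumption|].
    replace (wp2 z tau) with (C1 * wp2 z tau + C0 * wpt' z tau + C0) by ring.
    apply Cder_plus; [exact (Der2_wp' _ _ Ht Hz C1 C0) | apply Cder_const].
Qed.

Lemma wp2_tau : wp2 (z + tau) tau = wp2 z tau.
Proof.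
  transitivity ((C1 + C0) * wp2 (z + tau) tau + C0 * wpt' (z + tau) tau); [ring|].
  apply (Cder_unique (fun h => wp' (z + tau + h * (C1 + C0)) (tau + h * C0)) C0).
  - exact (Der2_wp' _ _ Ht (notin_tau _ _ Hz) (C1 + C0) C0).
  - eapply Cder_ext; [apply (shift_path_tau z tau Ht Hz wp' (fun _ => C0) C1 C0); intros; apply plus_C0, wp'_tau; assumption|].
    replace (wp2 z tau) with (C1 * wp2 z tau + C0 * wpt' z tau + C0) by ring.
    apply Cder_plus; [exact (Der2_wp' _ _ Ht Hz C1 C0) | apply Cder_const].
Qed.
End Periodicity3.

(** * Limits at the origin *)

Lemma Clim_at_path0 (f : Cplx -> Cplx -> Cplx) (tau l : Cplx) :
  Cder (fun h => f (C0 + h * C1) (tau + h * C0)) C0 l -> Clim_at (fun z => f z tau) C0 (f C0 tau).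
Proof.
  intros D; apply Cder_cont in D; unfold Ccont in D.
  replace (C0 + C0 * C1) with C0 in D by ring; replace (tau + C0 * C0) with tau in D by ring.
  eapply Clim_at_ext; [|exact D]; apply near_true; intros w _; f_equal; ring.
Qed.

Lemma remS_lim (tau : Cplx) : upper_half tau -> Clim_at (fun z => remS z tau) C0 (- C1 / RtoC 60 * g2 tau).
Proof.
  intros Ht; rewrite <- (remS_0 tau Ht).
  destruct (fam_ex_Cder _ (fam_remS C0 tau C1 C0 Ht (offlat_0 tau Ht))) as [l D]; exact (Clim_at_path0 remS tau l D).
Qed.
Lemma remT_lim (tau : Cplx) : upper_half tau -> Clim_at (fun z => remT z tau) C0 (RtoC 3 / RtoC 60 * g2 tau).
Proof.
  intros Ht; rewrite <- (remT_0 tau Ht).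
  destruct (fam_ex_Cder _ (fam_remT C0 tau C1 C0 Ht (offlat_0 tau Ht))) as [l D]; exact (Clim_at_path0 remT tau l D).
Qed.
Lemma remU_lim (tau : Cplx) : upper_half tau -> Clim_at (fun z => remU z tau) C0 (- RtoC 3 / RtoC 60 * g2 tau).
Proof.
  intros Ht; rewrite <- (remU_0 tau Ht).
  destruct (fam_ex_Cder _ (fam_remU C0 tau C1 C0 Ht (offlat_0 tau Ht))) as [l D]; exact (Clim_at_path0 remU tau l D).
Qed.
Lemma wp2_rem_lim (tau : Cplx) : upper_half tau ->
  Clim_at (fun z => lsum' (fun m n => RtoC 6 / (z - lat tau m n) ^ 4)) C0 (RtoC 6 / RtoC 60 * g2 tau).
Proof.
  intros Ht; rewrite <- (wp2_rem_0 tau Ht).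
  destruct (fam_ex_Cder _ (ex_intro _ _ (fam_wp2 C0 tau C1 C0 Ht (offlat_0 tau Ht)))) as [l D].
  exact (Clim_at_path0 (fun z tau => lsum' (fun m n => RtoC 6 / (z - lat tau m n) ^ 4)) tau l D).
Qed.
Lemma wpt_lim (tau : Cplx) : upper_half tau -> Clim_at (fun z => wpt z tau) C0 C0.
Proof.
  intros Ht; rewrite <- (wpt_0 tau Ht) at 2.
  destruct (fam_ex_Cder _ (ex_intro _ _ (fam_wpt C0 tau C1 C0 Ht (offlat_0 tau Ht)))) as [l D].
  exact (Clim_at_path0 wpt tau l D).
Qed.

Lemma Clim_at_eq (f : Cplx -> Cplx) (z l m : Cplx) : Clim_at f z l -> l = m -> Clim_at f z m.
Proof. intros H <-; exact H. Qed.

Ltac lim_step leaf :=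
  lazymatch goal with
  | |- Clim_at (fun _ => ?c) _ _ => apply Clim_at_const
  | |- Clim_at (fun w => w) _ _ => apply Clim_at_id
  | |- Clim_at (fun w => Cadd (@?f w) (@?g w)) _ _ => apply (Clim_at_plus f g)
  | |- Clim_at (fun w => Csub (@?f w) (@?g w)) _ _ => apply (Clim_at_minus f g)
  | |- Clim_at (fun w => Cmul (@?f w) (@?g w)) _ _ => apply (Clim_at_mult f g)
  | |- Clim_at (fun w => Copp (@?f w)) _ _ => apply (Clim_at_opp f)
  | |- _ => leaf
  end.
Ltac der_step leaf :=
  lazymatch goal with
  | |- Cder (fun _ => ?c) _ _ => apply Cder_const
  | |- Cder (fun w => w) _ _ => apply Cder_id
  | |- Cder (fun w => Cadd (@?f w) (@?g w)) _ _ => apply (Cder_plus f g)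
  | |- Cder (fun w => Csub (@?f w) (@?g w)) _ _ => apply (Cder_minus f g)
  | |- Cder (fun w => Cmul (@?f w) (@?g w)) _ _ => apply (Cder_mult f g)
  | |- Cder (fun w => Copp (@?f w)) _ _ => apply (Cder_opp f)
  | |- _ => leaf
  end.

Ltac lim_rules Ht := repeat lim_step ltac:(idtac; lazymatch goal with
  | |- Clim_at (fun w => remS w _) _ _ => exact (remS_lim _ Ht)
  | |- Clim_at (fun w => remT w _) _ _ => exact (remT_lim _ Ht)
  | |- Clim_at (fun w => remU w _) _ _ => exact (remU_lim _ Ht)
  | |- Clim_at (fun w => wpt w _) _ _ => exact (wpt_lim _ Ht)
  | |- _ => exact (wp2_rem_lim _ Ht)
  end).

(** * Differential identities for elliptic functions *)

Section Identities.
Variable tau : Cplx.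
Hypothesis Ht : upper_half tau.

Lemma Cder_wzeta (z : Cplx) : ~ in_lattice z tau -> Cder (fun w => wzeta w tau) z (- wp z tau).
Proof. intros Hz; exact (Der2_z _ _ _ _ _ (Der2_wzeta z tau Ht Hz)). Qed.
Lemma Cder_wp (z : Cplx) : ~ in_lattice z tau -> Cder (fun w => wp w tau) z (wp' z tau).
Proof. intros Hz; exact (Der2_z _ _ _ _ _ (Der2_wp z tau Ht Hz)). Qed.
Lemma Cder_wp' (z : Cplx) : ~ in_lattice z tau -> Cder (fun w => wp' w tau) z (wp2 z tau).
Proof. intros Hz; exact (Der2_z _ _ _ _ _ (Der2_wp' z tau Ht Hz)). Qed.

Ltac cont_rules Hz := repeat lim_step ltac:(idtac; lazymatch goal with
  | |- Clim_at (fun w => wzeta w _) _ _ => exact (Cder_cont _ _ _ (Cder_wzeta _ Hz))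
  | |- Clim_at (fun w => wp w _) _ _ => exact (Cder_cont _ _ _ (Cder_wp _ Hz))
  | |- Clim_at (fun w => wp' w _) _ _ => exact (Cder_cont _ _ _ (Cder_wp' _ Hz))
  | |- Clim_at (fun w => wp2 w _) _ _ => exact (Cder_cont _ _ _ (Cder_wp2 _ _ Ht Hz))
  | |- Clim_at (fun w => wp3 w _) _ _ => exact (Ccont_wp3 _ _ Ht Hz)
  | |- Clim_at (fun w => wpt' w _) _ _ => exact (Ccont_wpt' _ _ Ht Hz)
  end).

Lemma near0_punctured (P : Cplx -> Prop) :
  (forall z, offlat z tau -> z <> C0 -> P z) -> near C0 (fun z => z <> C0 -> P z).
Proof. intros H; generalize (small_notin tau Ht); apply near_imp; intros z Hz N; auto. Qed.

(** Zeta corrected to have period 1; its increment [- kappa tau] along [tau] balances that of [wpt],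
    so that [kappa * wpt - xi * wp'] is elliptic. *)
Definition xi (z : Cplx) : Cplx := wzeta z tau - eta1 tau * z.

Lemma Cder_xi (z : Cplx) : ~ in_lattice z tau -> Cder xi z (- wp z tau - eta1 tau).
Proof.
  intros Hz; unfold xi; eapply Cder_eq;
    [apply Cder_minus; [apply Cder_wzeta, Hz | apply Cder_mult; [apply Cder_const | apply Cder_id]] | simpl; ring].
Qed.

Ltac der_rules := repeat der_step ltac:(idtac; lazymatch goal with
  | |- Cder (fun w => wzeta w _) _ _ => apply Cder_wzeta; assumption
  | |- Cder (fun w => wp w _) _ _ => apply Cder_wp; assumption
  | |- Cder (fun w => wp' w _) _ _ => apply Cder_wp'; assumption
  | |- Cder (fun w => wp2 w _) _ _ => apply Cder_wp2; assumption
  | |- Cder (fun w => wpt w _) _ _ => apply Cder_wpt; assumption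
  | |- Cder (fun w => zt w _) _ _ => apply Cder_zt; assumption
  | |- Cder xi _ _ => apply Cder_xi; assumption
  | |- Cder (fun w => xi w) _ _ => apply Cder_xi; assumption
  end).

(** The pole [6 / z^4] cancels in [wp2 - 6 wp^2], which is therefore constant by Liouville's
    theorem. *)
Lemma wp2_identity (z : Cplx) : ~ in_lattice z tau ->
  wp2 z tau = RtoC 6 * (wp z tau * wp z tau) - g2 tau / RtoC 2.
Proof.
  intros Hz.
  assert (E : wp2 z tau - RtoC 6 * (wp z tau * wp z tau) = - g2 tau / RtoC 2).
  { apply (elliptic_liouville tau (fun z => wp2 z tau - RtoC 6 * (wp z tau * wp z tau))
      (fun z => wp3 z tau - RtoC 12 * (wp z tau * wp' z tau)) (- g2 tau / RtoC 2) Ht); try assumption.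
    - intros w Hw; eapply Cder_eq; [der_rules | simpl; ring].
    - intros w Hw; unfold Ccont; cont_rules Hw.
    - intros w Hw; rewrite wp2_1, wp_1 by assumption; reflexivity.
    - intros w Hw; rewrite wp2_tau, wp_tau by assumption; reflexivity.
    (* The limit at the origin is [6/60 - 12 * 3/60 = - 1/2] times [g2]. *)
    - eapply Clim_at_eq; [apply Clim_at_ext with (fun z => lsum' (fun m n => RtoC 6 / (z - lat tau m n) ^ 4)
        - RtoC 12 * remT z tau - RtoC 6 * (z * z * (z * z)) * (remT z tau * remT z tau)); [|lim_rules Ht]|].
      + apply near0_punctured; intros w Hw Nw; unfold wp2; rewrite wp_expand by assumption; simpl; cfield.
      + simpl; cfield. }
  replace (wp2 z tau) with (wp2 z tau - RtoC 6 * (wp z tau * wp z tau) + RtoC 6 * (wp z tau * wp z tau)) by ring.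
  rewrite E; cfield.
Qed.

Lemma xi_1 (z : Cplx) : ~ in_lattice z tau -> xi (z + C1) = xi z.
Proof. intros Hz; unfold xi; rewrite wzeta_1 by assumption; ring. Qed.
Lemma xi_tau (z : Cplx) : ~ in_lattice z tau -> xi (z + tau) = xi z - kappa tau.
Proof. intros Hz; unfold xi, kappa; rewrite wzeta_tau by assumption; ring. Qed.

(** Once the increments along [tau] cancel, the pole of [- 2 xi wp'] at the origin is
    [4 / z^4 - 4 eta1 / z^2]; the terms in [wp^2] and [eta1 wp] are chosen to remove it. *)
Lemma wpt_identity (z : Cplx) : ~ in_lattice z tau ->
  RtoC 2 * kappa tau * wpt z tau = RtoC 2 * (xi z * wp' z tau) + RtoC 4 * (wp z tau * wp z tau)
    - RtoC 4 * (eta1 tau * wp z tau) - RtoC 2 / RtoC 3 * g2 tau.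
Proof.
  intros Hz.
  assert (E : RtoC 2 * kappa tau * wpt z tau - RtoC 2 * (xi z * wp' z tau) - RtoC 4 * (wp z tau * wp z tau)
    + RtoC 4 * (eta1 tau * wp z tau) = - RtoC 2 / RtoC 3 * g2 tau).
  { apply (elliptic_liouville tau (fun z => RtoC 2 * kappa tau * wpt z tau - RtoC 2 * (xi z * wp' z tau) - RtoC 4 * (wp z tau * wp z tau)
       + RtoC 4 * (eta1 tau * wp z tau))
      (fun z => RtoC 2 * kappa tau * wpt' z tau - RtoC 2 * ((- wp z tau - eta1 tau) * wp' z tau + (wzeta z tau - eta1 tau * z) * wp2 z tau)
         - RtoC 8 * (wp z tau * wp' z tau) + RtoC 4 * (eta1 tau * wp' z tau)) (- RtoC 2 / RtoC 3 * g2 tau) Ht); try assumption.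
    - intros w Hw; eapply Cder_eq; [der_rules | unfold xi; simpl; ring].
    - intros w Hw; unfold Ccont; cont_rules Hw.
    - intros w Hw; rewrite wpt_1, xi_1, wp'_1, wp_1 by assumption; reflexivity.
    - intros w Hw; rewrite wpt_tau, xi_tau, wp'_tau, wp_tau by assumption; ring.
    (* At the origin [wpt] vanishes and the remainders give [(- 12 - 4 - 24) / 60 = - 2/3] times
       [g2]. *)
    - eapply Clim_at_eq; [apply Clim_at_ext with (fun z => RtoC 2 * kappa tau * wpt z tau
        + RtoC 4 * remU z tau + RtoC 4 * remS z tau - RtoC 8 * remT z tau
        + z * z * (RtoC 4 * (z * z) * (remS z tau * remU z tau) - RtoC 4 * eta1 tau * remU z tau
           - RtoC 4 * (z * z) * (remT z tau * remT z tau) + RtoC 4 * eta1 tau * remT z tau)); [|lim_rules Ht]|].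
      + apply near0_punctured; intros w Hw Nw; unfold xi; rewrite wp_expand, wp'_expand, wzeta_expand by assumption; simpl; cfield.
      + simpl; cfield. }
  transitivity (RtoC 2 * kappa tau * wpt z tau - RtoC 2 * (xi z * wp' z tau) - RtoC 4 * (wp z tau * wp z tau)
    + RtoC 4 * (eta1 tau * wp z tau) + (RtoC 2 * (xi z * wp' z tau) + RtoC 4 * (wp z tau * wp z tau)
    - RtoC 4 * (eta1 tau * wp z tau))); [ring|].
  rewrite E; cfield.
Qed.

Lemma wpt'_identity (z : Cplx) : ~ in_lattice z tau ->
  RtoC 2 * kappa tau * wpt' z tau = RtoC 2 * ((- wp z tau - eta1 tau) * wp' z tau + xi z * wp2 z tau)
    + RtoC 8 * (wp z tau * wp' z tau) - RtoC 4 * (eta1 tau * wp' z tau).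
Proof.
  intros Hz; apply (Cder_unique (fun w => RtoC 2 * kappa tau * wpt w tau) z).
  - eapply Cder_eq; [der_rules | simpl; ring].
  - eapply Cder_ext; [|eapply Cder_eq; [|shelve]].
    + generalize (notin_near z tau Ht Hz); apply near_imp; intros w Hw; symmetry; apply wpt_identity, Hw.
    + der_rules.
    Unshelve. simpl; ring.
Qed.

(* The invariant [g3], obtained as an integration constant rather than as a lattice sum. *)
Definition c3 : Cplx := RtoC 4 * wp (RtoC (1 / 2)) tau ^ 3 - g2 tau * wp (RtoC (1 / 2)) tau - wp' (RtoC (1 / 2)) tau ^ 2.

(** The first integral of [wp2_identity], constant because the complement of the lattice is
    connected. *)
Lemma wp_ode (z : Cplx) : ~ in_lattice z tau ->
  wp' z tau ^ 2 = RtoC 4 * wp z tau ^ 3 - g2 tau * wp z tau - c3.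
Proof.
  intros Hz.
  assert (E := const_off_lattice tau (fun z => RtoC 4 * wp z tau ^ 3 - g2 tau * wp z tau - wp' z tau ^ 2) Ht).
  assert (E2 : RtoC 4 * wp z tau ^ 3 - g2 tau * wp z tau - wp' z tau ^ 2 = c3).
  { unfold c3; apply (E) ; [|exact Hz | apply half1_notin, Ht].
    intros w Hw; eapply Cder_eq; [simpl; der_rules|].
    simpl; rewrite (wp2_identity w Hw); cfield. }
  rewrite <- E2; ring.
Qed.

(* [Wfun = 0] is the heat equation: it expresses the [tau]-derivative of [xi], the logarithmic
   derivative of the theta function, through its first two [z]-derivatives. *)
Definition Wfun (z : Cplx) : Cplx :=
  RtoC 2 * kappa tau * (zt z tau - eta1t tau * z) + wp' z tau + RtoC 2 * (xi z * (wp z tau + eta1 tau)).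

(** By [wpt_identity] the derivative is a constant [k], so [Wfun] is affine; its period 1 forces
    [k = 0], and its oddness removes what remains. *)
Lemma Wfun_zero (z : Cplx) : ~ in_lattice z tau -> Wfun z = C0.
Proof.
  set (k := g2 tau / RtoC 6 - RtoC 2 * kappa tau * eta1t tau - RtoC 2 * (eta1 tau * eta1 tau)).
  assert (Const : forall z z', ~ in_lattice z tau -> ~ in_lattice z' tau -> Wfun z - k * z = Wfun z' - k * z').
  { apply (const_off_lattice tau (fun z => Wfun z - k * z) Ht); intros w Hw.
    assert (Ew := wpt_identity w Hw).
    eapply Cder_eq; [unfold Wfun; der_rules|].
    simpl; rewrite (wp2_identity w Hw).
    transitivity (- (RtoC 2 * kappa tau * wpt w tau) + (RtoC 2 * (xi w * wp' w tau) + RtoC 4 * (wp w tau * wp w tau)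
    - RtoC 4 * (eta1 tau * wp w tau) - RtoC 2 / RtoC 3 * g2 tau)); [unfold k; cfield | rewrite Ew; ring]. }
  assert (P1 : forall w, ~ in_lattice w tau -> Wfun (w + C1) = Wfun w).
  { intros w Hw; unfold Wfun; rewrite zt_1, wp'_1, xi_1, wp_1 by assumption; ring. }
  assert (Odd : forall w, ~ in_lattice w tau -> Wfun (- w) = - Wfun w).
  { intros w Hw; unfold Wfun, xi; rewrite zt_odd, wp'_odd, wzeta_odd, wp_even by assumption; ring. }
  assert (Ek : k = C0).
  { assert (H := half1_notin tau Ht); assert (H1 := notin_1 _ _ H).
    assert (E := Const _ _ H H1); rewrite P1 in E by exact H.
    replace k with (Wfun (RtoC (1 / 2)) - k * RtoC (1 / 2) - (Wfun (RtoC (1 / 2)) - k * (RtoC (1 / 2) + C1))) by ring.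
    rewrite E; ring. }
  intros Hz; assert (Hz' : ~ in_lattice (- z) tau) by (rewrite in_lattice_opp; exact Hz).
  assert (E := Const _ _ Hz Hz'); rewrite Odd, Ek in E by exact Hz.
  replace (Wfun z) with ((Wfun z - C0 * z - (- Wfun z - C0 * - z)) / RtoC 2) by cfield.
  rewrite E; cfield.
Qed.

(** Says that [kappa] has derivative zero. It is read off by comparing [Wfun = 0] at a point and at
    its translate by [tau], then dividing by [kappa]. *)
Lemma eta_derivatives : eta2t tau = eta1t tau * tau + eta1 tau.
Proof.
  assert (H := half1_notin tau Ht); set (w := RtoC (1 / 2)) in *.
  assert (E1 := Wfun_zero w H); assert (E2 := Wfun_zero (w + tau) (notin_tau _ _ H)).
  unfold Wfun in *; rewrite zt_tau, wp'_tau, xi_tau, wp_tau in E2 by assumption.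
  assert (K := kappa_neq0 tau Ht).
  assert (E : RtoC 2 * kappa tau * (eta2t tau - (eta1t tau * tau + eta1 tau)) = C0).
  { transitivity (C0 - C0); [rewrite <- E2 at 1; rewrite <- E1; ring | ring]. }
  apply Csub_eq0; apply Cmul_eq0 in E as [E|E]; [|exact E].
  exfalso; revert E; apply Cmul_neq0; [apply RtoC_neq0; lra | exact K].
Qed.
End Identities.

Lemma quotient_blowup (P Q : Cplx -> Cplx) (z p : Cplx) (M : R) :
  Clim_at P z p -> p <> C0 -> Clim_at Q z C0 ->
  near z (fun w => w <> z -> Q w <> C0 -> M < Cabs (P w / Q w)).
Proof.
  intros HP Np HQ; assert (Pp := Cabs_gt0 p Np).
  set (e := (Cabs p / (2 * (Rabs M + 1)))%R); assert (PM := Rabs_pos M).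
  assert (He : 0 < e) by (apply Rdiv_lt_0_compat; lra).
  generalize (near_and _ _ _ (Clim_at_neq0 _ _ _ HP Np) (Clim_at_near _ _ _ _ HQ He)).
  apply near_imp; intros w [H1 H2] N NQ; specialize (H1 N); specialize (H2 N).
  replace (Q w - C0) with (Q w) in H2 by ring.
  assert (Pq := Cabs_gt0 _ NQ); rewrite Cabs_div by assumption.
  apply Rle_lt_trans with (Rabs M); [apply Rle_abs|].
  apply Rmult_lt_reg_r with (Cabs (Q w)); [assumption|].
  replace (Cabs (P w) / Cabs (Q w) * Cabs (Q w))%R with (Cabs (P w)) by (field; lra).
  assert (E : ((Rabs M + 1) * e = Cabs p / 2)%R) by (unfold e; field; lra).
  nra.
Qed.

(** * Zeros of the derivative and the discriminant *)

Section Lattice.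
Variable tau : Cplx.
Hypothesis Ht : upper_half tau.

Lemma wp_lat (m n : Z) (z : Cplx) : ~ in_lattice z tau -> wp (z + lat tau m n) tau = wp z tau.
Proof.
  apply (Zperiod_induct tau (fun z => wp z tau)); intros w Hw; [apply wp_1 | apply wp_tau]; assumption.
Qed.

Lemma wp'_lat (m n : Z) (z : Cplx) : ~ in_lattice z tau -> wp' (z + lat tau m n) tau = wp' z tau.
Proof.
  apply (Zperiod_induct tau (fun z => wp' z tau)); intros w Hw; [apply wp'_1 | apply wp'_tau]; assumption.
Qed.

Lemma wzeta_lat (m n : Z) (z : Cplx) : ~ in_lattice z tau ->
  wzeta (z + lat tau m n) tau = wzeta z tau + ZtoC m * eta1 tau + ZtoC n * eta2 tau.
Proof.
  intros Hz; assert (Ti : Im tau <> 0%R) by (unfold upper_half in Ht; lra).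
  (* The multiple of [Im z] compensates the increment of [xi] along [tau]. *)
  assert (E := Zperiod_induct tau (fun z => xi tau z + kappa tau * RtoC (Im z / Im tau))).
  cbv beta in E.
  assert (E1 : xi tau (z + lat tau m n) + kappa tau * RtoC (Im (z + lat tau m n) / Im tau)
    = xi tau z + kappa tau * RtoC (Im z / Im tau)).
  { apply E; [| |exact Hz]; intros w Hw.
    - rewrite xi_1 by assumption; replace (Im (w + C1)) with (Im w) by (simpl; ring); reflexivity.
    - rewrite xi_tau by assumption.
      replace (RtoC (Im (w + tau) / Im tau)) with (RtoC (Im w / Im tau) + C1) by (apply Cplx_eq; simpl; field; exact Ti).
      ring. }
  replace (RtoC (Im (z + lat tau m n) / Im tau)) with (RtoC (Im z / Im tau) + ZtoC n) in E1
    by (apply Cplx_eq; unfold lat, ZtoC; simpl; field; exact Ti).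
  unfold xi in E1.
  transitivity (wzeta (z + lat tau m n) tau - eta1 tau * (z + lat tau m n) + kappa tau * (RtoC (Im z / Im tau) + ZtoC n)
    + eta1 tau * (z + lat tau m n) - kappa tau * (RtoC (Im z / Im tau) + ZtoC n)); [ring|].
  rewrite E1; unfold kappa, lat; ring.
Qed.

Lemma wp_blowup (p : Cplx) (M : R) : in_lattice p tau -> near p (fun w => w <> p -> M < Cabs (wp w tau)).
Proof.
  intros [m [n Ep]].
  assert (B : near C0 (fun u => u <> C0 -> u * u <> C0 -> M < Cabs ((C1 + u * u * (u * u) * remT u tau) / (u * u)))).
  { apply quotient_blowup with (C1 + C0 * C0 * (C0 * C0) * (RtoC 3 / RtoC 60 * g2 tau)).
    - lim_rules Ht.
    - intros E; apply C1_neq_C0; rewrite <- E; ring.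
    - eapply Clim_at_eq; [lim_rules Ht | ring]. }
  destruct (near_and _ _ _ B (small_notin tau Ht)) as [d [Hd H]].
  exists d; split; [exact Hd|]; intros w Hw N.
  destruct (H (w - p)) as [H1 H2]; [replace (w - p - C0) with (w - p) by ring; exact Hw|].
  assert (Nu := Csub_neq0 _ _ N); set (u := w - p) in *.
  replace w with (u + lat tau m n) by (unfold u; rewrite Ep; ring).
  rewrite wp_lat by (apply offlat_notin; assumption); rewrite wp_expand by assumption.
  replace (C1 / u ^ 2 + u ^ 2 * remT u tau) with ((C1 + u * u * (u * u) * remT u tau) / (u * u)) by (simpl; cfield).
  apply H1; [|apply Cmul_neq0]; exact Nu.
Qed.

Lemma Cabs_line (p v : Cplx) (t s : R) : Cabs (p + RtoC s * v - (p + RtoC t * v)) = (Rabs (s - t) * Cabs v)%R.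
Proof.
  replace (p + RtoC s * v - (p + RtoC t * v)) with (RtoC (s - t) * v) by (apply Cplx_eq; simpl; ring).
  rewrite Cabs_mul, Cabs_RtoC; reflexivity.
Qed.

Lemma near_line (p v : Cplx) (t : R) (P : Cplx -> Prop) : near (p + RtoC t * v) P ->
  exists d, 0 < d /\ forall s, Rabs (s - t) < d -> P (p + RtoC s * v).
Proof.
  intros [d [Hd H]]; assert (Q := Cabs_ge0 v).
  exists (d / (Cabs v + 1))%R; split; [apply Rdiv_lt_0_compat; lra|]; intros s Hs; apply H; rewrite Cabs_line.
  assert (Rabs (s - t) * (Cabs v + 1) < d).
  { apply Rmult_lt_compat_r with (r := (Cabs v + 1)%R) in Hs; [|lra].
    replace (d / (Cabs v + 1) * (Cabs v + 1))%R with d in Hs by (field; lra); exact Hs. }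
  generalize (Rabs_pos (s - t)); nra.
Qed.

Lemma Cabs_bounded (q : R -> Cplx) (T : R) : 0 <= T ->
  (forall t, 0 <= t <= T -> exists v, Rder q t v) -> exists M, 0 <= M /\ forall t, 0 <= t <= T -> Cabs (q t) <= M.
Proof.
  intros HT H; destruct (continuity_ab_maj (fun t => Cabs (q t)) 0 T HT) as [x [Hx _]].
  - intros t Hc; apply continuity_pt_locally; intros e; destruct (H t Hc) as [v D].
    destruct (Rder_cont _ _ _ D e (cond_pos e)) as [d [Hd G]]; exists (mkposreal d Hd); intros s Hs.
    specialize (G s Hs); eapply Rle_lt_trans; [|exact G].
    apply Rabs_le; generalize (Cabs_sub_ge (q s) (q t)) (Cabs_sub_ge (q t) (q s)); rewrite (Cabs_sub_sym (q t)); lra.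
  - exists (Cabs (q x)); split; [apply Cabs_ge0 | exact Hx].
Qed.

Lemma Rder_wp_line (p v : Cplx) (t : R) : ~ in_lattice (p + RtoC t * v) tau ->
  Rder (fun s => wp (p + RtoC s * v) tau) t (wp' (p + RtoC t * v) tau * v).
Proof.
  intros H; apply (Rder_chain (fun w => wp w tau) (fun s => p + RtoC s * v)); [apply Cder_wp; assumption | apply Rder_line].
Qed.

Lemma Rder_cmul (c : Cplx) (f : R -> Cplx) (t : R) (v : Cplx) : Rder f t v -> Rder (fun s => c * f s) t (c * v).
Proof.
  intros H; apply (Rder_chain (fun w => c * w) f); [|exact H].
  eapply Cder_eq; [apply Cder_mult; [apply Cder_const | apply Cder_id] | simpl; ring].
Qed.

Lemma Rder_plus (f g : R -> Cplx) (t : R) (v w : Cplx) :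
  Rder f t v -> Rder g t w -> Rder (fun s => f s + g s) t (v + w).
Proof.
  intros Hf Hg; assert (D := Rder_minus _ _ _ _ _ Hf (Rder_cmul (- C1) _ _ _ Hg)).
  replace (v + w) with (v - - C1 * w) by ring.
  intros e He; destruct (D e He) as [d [Hd G]]; exists d; split; [exact Hd|]; intros s Hs.
  specialize (G s Hs); replace (f s + g s - (f t + g t)) with (f s - - C1 * g s - (f t - - C1 * g t)) by ring; exact G.
Qed.

(* Both [wp (z0 + t v)] and [wp (z0 - t v)] solve [y'' = (6 y^2 - g2 / 2) v^2] with the
   same initial data when [wp' z0 = 0]. *)
Lemma wp_reflection (z0 v : Cplx) (T : R) : 0 < T -> wp' z0 tau = C0 ->
  (forall t, 0 <= t <= T -> ~ in_lattice (z0 + RtoC t * v) tau /\ ~ in_lattice (z0 + RtoC t * - v) tau) ->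
  wp (z0 + RtoC T * v) tau = wp (z0 + RtoC T * - v) tau.
Proof.
  intros HT H0 Good.
  set (d := fun t => wp (z0 + RtoC t * v) tau - wp (z0 + RtoC t * - v) tau).
  set (d1 := fun t => v * (wp' (z0 + RtoC t * v) tau + wp' (z0 + RtoC t * - v) tau)).
  set (q := fun t => RtoC 6 * v * v * (wp (z0 + RtoC t * v) tau + wp (z0 + RtoC t * - v) tau)).
  destruct (Cabs_bounded q T) as [M [HM HMb]]; [lra | |].
  { intros t Hc; destruct (Good t Hc) as [G1 G2]; eexists; unfold q; apply Rder_cmul, Rder_plus; apply Rder_wp_line; assumption. }
  apply Csub_eq0; change (d T = C0).
  apply (linear_ode_unique d d1 q T M HT HM); [| |exact HMb | |].
  - intros t Hc; destruct (Good t Hc) as [G1 G2]; eapply Rder_eq.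
    + unfold d; apply Rder_minus; apply Rder_wp_line; assumption.
    + unfold d1; ring.
  - intros t Hc; destruct (Good t Hc) as [G1 G2]; eapply Rder_eq.
    + unfold d1; apply Rder_cmul, Rder_plus;
      [apply (Rder_chain (fun w => wp' w tau) (fun s => z0 + RtoC s * v)) | apply (Rder_chain (fun w => wp' w tau) (fun s => z0 + RtoC s * - v))];
      try apply Rder_line; apply Cder_wp'; assumption.
    + rewrite !wp2_identity by assumption; unfold q, d; cfield.
  - unfold d; replace (z0 + RtoC 0 * v) with z0 by ring; replace (z0 + RtoC 0 * - v) with z0 by ring; ring.
  - unfold d1; replace (z0 + RtoC 0 * v) with z0 by ring; replace (z0 + RtoC 0 * - v) with z0 by ring; rewrite H0; ring.
Qed.

(** Otherwise [wp] would blow up along one ray and stay bounded along the opposite one, although its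
    values there agree. *)
Lemma one_sided_pole (z0 v : Cplx) (T : R) : 0 < T -> v <> C0 ->
  (forall t, 0 <= t < T -> wp (z0 + RtoC t * v) tau = wp (z0 + RtoC t * - v) tau) ->
  in_lattice (z0 + RtoC T * v) tau -> in_lattice (z0 + RtoC T * - v) tau.
Proof.
  intros HT Nv Eq Hin; apply NNPP; intros Hout.
  set (B := (Cabs (wp (z0 + RtoC T * - v) tau) + 1)%R).
  destruct (near_line z0 v T _ (wp_blowup _ B Hin)) as [d1 [Hd1 H1]].
  destruct (near_line z0 (- v) T _ (Ccont_near _ _ 1 (Cder_cont _ _ _ (Cder_wp tau Ht _ Hout)) Rlt_0_1)) as [d2 [Hd2 H2]].
  set (t := Rmax 0 (T - Rmin d1 d2 / 2)).
  assert (Pm : 0 < Rmin d1 d2) by (apply Rmin_pos; assumption).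
  assert (Ht1 : 0 <= t) by apply Rmax_l.
  assert (Ht2 : T - Rmin d1 d2 / 2 <= t) by apply Rmax_r.
  assert (Ht3 : t < T) by (unfold t; apply Rmax_lub_lt; lra).
  assert (Hm : Rabs (t - T) < Rmin d1 d2) by (rewrite Rabs_left by lra; lra).
  assert (L1 := Rmin_l d1 d2); assert (L2 := Rmin_r d1 d2).
  specialize (H1 t ltac:(lra)); specialize (H2 t ltac:(lra)).
  assert (Nt : z0 + RtoC t * v <> z0 + RtoC T * v).
  { intros E; assert (E2 := Cabs_line z0 v T t); rewrite E in E2.
    replace (z0 + RtoC T * v - (z0 + RtoC T * v)) with C0 in E2 by ring; rewrite Cabs_C0 in E2.
    generalize (Cabs_gt0 v Nv); assert (0 < Rabs (t - T)) by (apply Rabs_pos_lt; lra); nra. }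
  specialize (H1 Nt); rewrite (Eq t ltac:(lra)) in H1.
  set (x := wp (z0 + RtoC t * - v) tau) in *; set (y := wp (z0 + RtoC T * - v) tau) in *.
  generalize (Cabs_sub_ge x y); unfold B in H1; lra.
Qed.

(** The direction [- z0] makes the ray meet the lattice point 0 at time 1 at the latest. At the
    first exit time both opposite points are lattice points, and their sum is [2 z0]. *)
Lemma wp'_zero (z0 : Cplx) : ~ in_lattice z0 tau -> wp' z0 tau = C0 -> in_lattice (RtoC 2 * z0) tau.
Proof.
  intros Hz0 H0.
  set (v := - z0); assert (Nv : v <> C0) by (apply Copp_neq0, (notin_neq0 _ _ Hz0)).
  set (good := fun t => ~ in_lattice (z0 + RtoC t * v) tau /\ ~ in_lattice (z0 + RtoC t * - v) tau).
  destruct (first_exit good) as [T [HT [Bad Good]]].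
  - intros t [G1 G2].
    destruct (near_line z0 v t _ (notin_near _ tau Ht G1)) as [d1 [Hd1 H1]].
    destruct (near_line z0 (- v) t _ (notin_near _ tau Ht G2)) as [d2 [Hd2 H2]].
    exists (Rmin d1 d2); split; [apply Rmin_pos; assumption|]; intros s Hs; split;
      [apply H1 | apply H2]; eapply Rlt_le_trans; try exact Hs; [apply Rmin_l | apply Rmin_r].
  - split; [replace (z0 + RtoC 0 * v) with z0 by ring | replace (z0 + RtoC 0 * - v) with z0 by ring]; exact Hz0.
  - intros [G1 _]; apply G1; exists 0%Z, 0%Z; rewrite lat_00; unfold v; ring.
  - assert (Eq : forall t, 0 <= t < T -> wp (z0 + RtoC t * v) tau = wp (z0 + RtoC t * - v) tau).
    { intros t Hc; destruct (Rle_lt_or_eq_dec 0 t ltac:(lra)) as [L|E].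
      - apply wp_reflection; [exact L | exact H0 | intros s Hs; apply Good; lra].
      - rewrite <- E; f_equal; ring. }
    assert (Both : in_lattice (z0 + RtoC T * v) tau /\ in_lattice (z0 + RtoC T * - v) tau).
    { destruct (classic (in_lattice (z0 + RtoC T * v) tau)) as [H|H].
      - split; [exact H | exact (one_sided_pole z0 v T HT Nv Eq H)].
      - destruct (classic (in_lattice (z0 + RtoC T * - v) tau)) as [H'|H']; [|exfalso; apply Bad; split; assumption].
        exfalso; apply H; replace v with (- - v) by ring.
        apply (one_sided_pole z0 (- v) T HT (Copp_neq0 _ Nv)); [|exact H'].
        intros t Hc; replace (- - v) with v by ring; symmetry; apply Eq, Hc. }
    destruct Both as [[m [n E1]] H2].
    replace (RtoC 2 * z0) with (z0 + RtoC T * - v + lat tau m n) by (rewrite <- E1; ring).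
    rewrite in_lattice_shift; exact H2.
Qed.

(* At a double root [e = u / 2] of the cubic, [wp - e] solves a linear equation, so a zero would
   make it vanish identically; without zeros, [wp' / (2 (wp - e)) + zeta + e z] is constant, and
   its periods give [eta1 = - e], [eta2 = - e tau], so [kappa = 0]. *)
Lemma discriminant_neq0 (u : Cplx) : g2 tau = RtoC 3 * (u * u) -> c3 tau = - (u * u * u) -> False.
Proof.
  intros Eg Ec; set (e := u / RtoC 2).
  assert (Eu : u = RtoC 2 * e) by (unfold e; cfield).
  (* The three roots sum to zero, so the simple root is [- 2 e]. *)
  assert (Ode : forall z, ~ in_lattice z tau -> wp' z tau * wp' z tau = RtoC 4 * ((wp z tau - e) * (wp z tau - e)) * (wp z tau + RtoC 2 * e)).
  { intros z Hz; assert (E := wp_ode tau Ht z Hz); rewrite Eg, Ec, Eu in E; simpl in E.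
    transitivity (wp' z tau * (wp' z tau * C1)); [ring | rewrite E; ring]. }
  assert (W2 : forall z, ~ in_lattice z tau -> wp2 z tau = RtoC 6 * ((wp z tau + e) * (wp z tau - e))).
  { intros z Hz; rewrite (wp2_identity tau Ht z Hz), Eg, Eu; cfield. }
  assert (Ne : forall z, ~ in_lattice z tau -> wp z tau - e <> C0).
  { intros z Hz E0.
    assert (All : forall w, ~ in_lattice w tau -> wp w tau = e /\ wp' w tau = C0).
    { intros w Hw; apply (lattice_complement_connected tau (fun w => wp w tau = e /\ wp' w tau = C0) Ht) with z; try assumption.
      - intros a b Seg [Ea Ea'].
        set (v := b - a) in *.
        destruct (Cabs_bounded (fun t => RtoC 6 * v * v * (wp (a + RtoC t * v) tau + e)) 1) as [M [HM HMb]]; [lra | |].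
        { intros t Hc; eexists; apply Rder_cmul, Rder_plus; [apply Rder_wp_line, Seg, Hc|].
          apply (Rder_chain (fun _ => e) (fun s => a + RtoC s * v)); [apply Cder_const | apply Rder_line]. }
        destruct (linear_ode_unique (fun t => wp (a + RtoC t * v) tau - e) (fun t => v * wp' (a + RtoC t * v) tau)
          (fun t => RtoC 6 * v * v * (wp (a + RtoC t * v) tau + e)) 1 M Rlt_0_1 HM) as [R1 R2]; [| |exact HMb | | |].
        + intros t Hc; eapply Rder_eq; [apply Rder_minus; [apply Rder_wp_line, Seg, Hc|
            apply (Rder_chain (fun _ => e) (fun s => a + RtoC s * v)); [apply Cder_const | apply Rder_line]] | ring].
        + intros t Hc; eapply Rder_eq; [apply Rder_cmul, (Rder_chain (fun w => wp' w tau) (fun s => a + RtoC s * v));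
            [apply Cder_wp'; [exact Ht | apply Seg, Hc] | apply Rder_line]|].
          rewrite W2 by (apply Seg, Hc); ring.
        + replace (a + RtoC 0 * v) with a by ring; rewrite Ea; ring.
        + replace (a + RtoC 0 * v) with a by ring; rewrite Ea'; ring.
        + unfold v in R1, R2; rewrite segment_end in R1, R2; split; [apply Csub_eq0, R1|].
          apply Cmul_eq0 in R2 as [R2|R2]; [|exact R2].
          apply Csub_eq0 in R2; rewrite R2; exact Ea'.
      - assert (Ez : wp z tau = e) by (apply Csub_eq0, E0); split; [exact Ez|].
        assert (O := Ode z Hz); rewrite Ez in O.
        replace (RtoC 4 * ((e - e) * (e - e)) * (e + RtoC 2 * e)) with C0 in O by ring.
        apply Cmul_eq0 in O; tauto. }
    (* A constant [wp] contradicts its pole at the origin. *)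
    destruct (near_and _ _ _ (wp_blowup C0 (Cabs e) (ex_intro _ 0%Z (ex_intro _ 0%Z (eq_sym (lat_00 tau))))) (small_notin tau Ht)) as [d [Hd H]].
    destruct (H (RtoC (d / 2))) as [H1 H2].
    { replace (RtoC (d / 2) - C0) with (RtoC (d / 2)) by ring; rewrite Cabs_RtoC, Rabs_pos_eq; lra. }
    assert (N0 : RtoC (d / 2) <> C0) by (apply RtoC_neq0; lra).
    specialize (H1 N0); rewrite (proj1 (All _ (offlat_notin _ _ H2 N0))) in H1; lra. }
  (* By [W2] and [Ode] its derivative is [3 (wp + e) - 2 (wp + 2 e) - wp + e = 0]. *)
  set (f := fun z => wp' z tau / (RtoC 2 * (wp z tau - e)) + wzeta z tau + e * z).
  assert (Const : forall z z', ~ in_lattice z tau -> ~ in_lattice z' tau -> f z = f z').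
  { apply (const_off_lattice tau f Ht); intros w Hw.
    assert (N := Ne w Hw); assert (N2 : RtoC 2 * (wp w tau - e) <> C0) by (apply Cmul_neq0; [apply RtoC_neq0; lra | exact N]).
    assert (D1 := Cder_mult _ _ _ _ _ (Cder_const (RtoC 2) w) (Cder_minus _ _ _ _ _ (Cder_wp tau Ht w Hw) (Cder_const e w))).
    assert (D2 := Cder_div _ _ _ _ _ (Cder_wp' tau Ht w Hw) D1 N2).
    assert (D3 := Cder_plus _ _ _ _ _ (Cder_plus _ _ _ _ _ D2 (Cder_wzeta tau Ht w Hw))
      (Cder_mult _ _ _ _ _ (Cder_const e w) (Cder_id w))).
    eapply Cder_eq; [exact D3|]; simpl.
    rewrite (W2 w Hw).
    replace (wp' w tau * (C0 * (wp w tau - e) + RtoC 2 * (wp' w tau - C0))) with (RtoC 2 * (wp' w tau * wp' w tau)) by ring.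
    rewrite (Ode w Hw); cfield. }
  assert (E1 : eta1 tau = - e).
  { assert (H := half2_notin tau Ht); assert (H1 := notin_1 _ _ H); assert (E := Const _ _ H H1); unfold f in E.
    rewrite wp'_1, wp_1, wzeta_1 in E by assumption.
    set (x := wp' (tau / RtoC 2) tau / (RtoC 2 * (wp (tau / RtoC 2) tau - e))) in *; set (y := wzeta (tau / RtoC 2) tau) in *; set (t := tau / RtoC 2) in *.
    transitivity (x + (y + eta1 tau) + e * (t + C1) - (x + y + e * t) - e); [ring | rewrite <- E; ring]. }
  assert (E2 : eta2 tau = - e * tau).
  { assert (H := half1_notin tau Ht); assert (H1 := notin_tau _ _ H); assert (E := Const _ _ H H1); unfold f in E.
    rewrite wp'_tau, wp_tau, wzeta_tau in E by assumption.
    set (t := RtoC (1 / 2)) in *; set (x := wp' t tau / (RtoC 2 * (wp t tau - e))) in *; set (y := wzeta t tau) in *.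
    transitivity (x + (y + eta2 tau) + e * (t + tau) - (x + y + e * t) - e * tau); [ring | rewrite <- E; ring]. }
  apply (kappa_neq0 tau Ht); unfold kappa; rewrite E1, E2; ring.
Qed.

Definition numer (r s : Cplx) : Cplx :=
  let a := alpha r s tau in let Z := Zrs r s tau in
  RtoC 3 * wp' a tau * Z ^ 2 + (RtoC 12 * (wp a tau) ^ 2 - g2 tau) * Z + RtoC 3 * wp a tau * wp' a tau.

Lemma RtoC_half (a : Z) : RtoC (IZR a / 2) = ZtoC a / RtoC 2.
Proof. apply Cplx_eq; unfold Cdiv, Cinv, Cnorm2; simpl; field. Qed.

(** If [2 a = m + n tau], oddness and quasi-periodicity give [wzeta a = (m eta1 + n eta2) / 2]; then
    [Z] equals [(s - n/2) kappa], whose vanishing makes [(r, s)] the half-integer pair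
    [(m/2, n/2)]. *)
Lemma half_period_nonvanishing (r s : Cplx) : ~ in_half_Z2 r s -> ~ in_lattice (alpha r s tau) tau ->
  wp' (alpha r s tau) tau = C0 -> Zrs r s tau <> C0.
Proof.
  intros Hh Ha H0 HZ; destruct (wp'_zero _ Ha H0) as [m [n E]].
  assert (Hn : ~ in_lattice (- alpha r s tau) tau) by (rewrite in_lattice_opp; exact Ha).
  assert (E2 : wzeta (alpha r s tau) tau = wzeta (- alpha r s tau) tau + ZtoC m * eta1 tau + ZtoC n * eta2 tau).
  { rewrite <- wzeta_lat by exact Hn; f_equal; rewrite <- E; ring. }
  rewrite (wzeta_odd _ _ Ht Ha) in E2.
  assert (Er : r = ZtoC m / RtoC 2 - (s - ZtoC n / RtoC 2) * tau).
  { apply Csub_eq0; unfold alpha, lat in E.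
    transitivity ((RtoC 2 * (r + s * tau) - (ZtoC m + ZtoC n * tau)) / RtoC 2); [cfield | rewrite E; cfield]. }
  assert (E3 : (s - ZtoC n / RtoC 2) * kappa tau = C0).
  { unfold Zrs in HZ; set (y := wzeta (alpha r s tau) tau) in *.
    assert (Ey : y = (ZtoC m * eta1 tau + ZtoC n * eta2 tau) / RtoC 2).
    { transitivity ((y - (- y + ZtoC m * eta1 tau + ZtoC n * eta2 tau)) / RtoC 2 + (ZtoC m * eta1 tau + ZtoC n * eta2 tau) / RtoC 2);
        [cfield | rewrite <- E2; cfield]. }
    rewrite <- HZ, Ey; unfold kappa; rewrite Er at 1; cfield. }
  apply Cmul_eq0 in E3 as [E3|E3]; [|exact (kappa_neq0 tau Ht E3)].
  apply Hh; exists m, n; rewrite !RtoC_half; split; [rewrite Er, E3; ring | apply Csub_eq0, E3].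
Qed.

Lemma numer_neq0 (r s : Cplx) : ~ in_half_Z2 r s -> ~ in_lattice (alpha r s tau) tau ->
  Z2rs r s tau = C0 -> numer r s <> C0.
Proof.
  intros Hh Ha HZ HN; unfold numer, Z2rs in *; cbv zeta in *.
  assert (NZ := half_period_nonvanishing r s Hh Ha); assert (Ode := wp_ode tau Ht _ Ha).
  set (Z := Zrs r s tau) in *; set (p := wp (alpha r s tau) tau) in *; set (p' := wp' (alpha r s tau) tau) in *.
  assert (Ep : p' = Z ^ 3 - RtoC 3 * p * Z) by (symmetry; apply Csub_eq0; exact HZ).
  assert (F : Z * (RtoC 3 * ((Z * Z - p) * (Z * Z - p)) - g2 tau) = C0) by (rewrite <- HN, Ep; ring).
  apply Cmul_eq0 in F as [F|F].
  - apply NZ; [rewrite Ep, F; ring | exact F].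
  - assert (Eg : g2 tau = RtoC 3 * ((Z * Z - p) * (Z * Z - p))) by (symmetry; apply Csub_eq0, F).
    (* With [u = Z^2 - p] one has [p'^2 = (u + p) (u - 2 p)^2], and [wp_ode] then reads
       [c3 = - u^3]. *)
    apply (discriminant_neq0 (Z * Z - p) Eg).
    transitivity (RtoC 4 * p ^ 3 - g2 tau * p - p' ^ 2); [rewrite Ode; ring | rewrite Eg, Ep; ring].
Qed.
End Lattice.

(** * Variation in tau with (r, s) fixed *)

Lemma alpha_path (r s tau h : Cplx) : alpha r s (tau + h * C1) = alpha r s tau + h * s.
Proof. unfold alpha; ring. Qed.

Lemma Cder_g2 (tau : Cplx) : upper_half tau -> exists l, Cder (fun h => g2 (tau + h * C1)) C0 l.
Proof.
  intros Ht; destruct (fam_ex_Cder _ (fam_invpow4 C0 tau C0 C1 Ht (offlat_0 tau Ht))) as [l D].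
  exists (C0 * lsum' (fun m n => C1 / lat (tau + C0 * C1) m n ^ 4) + RtoC 60 * l).
  exact (Cder_mult _ _ _ _ _ (Cder_const (RtoC 60) C0) D).
Qed.

Section Variation.
Variables r s tau : Cplx.
Hypothesis Ht : upper_half tau.
Hypothesis Ha : ~ in_lattice (alpha r s tau) tau.

Let a := alpha r s tau.
Let p := wp a tau.
Let p' := wp' a tau.
Let Zr := Zrs r s tau.

Definition along (f : Cplx -> Cplx) (h : Cplx) : Cplx := f (tau + h * C1).

Lemma Cder_along_Der2 (f : Cplx -> Cplx -> Cplx) (fz ft : Cplx) :
  Der2 f a tau fz ft -> Cder (along (fun t => f (alpha r s t) t)) C0 (s * fz + ft).
Proof.
  intros D; specialize (D s C1); eapply Cder_eq; [eapply Cder_ext; [|exact D] | ring].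
  apply near_true; intros h; unfold along; rewrite alpha_path; reflexivity.
Qed.

(** With [r = a - s tau], the relation [eta_derivatives] leaves [zt - eta1t a - s (wp + eta1)], and
    [Wfun = 0] eliminates [zt]. The factor [2 kappa] is kept on the left to avoid a division. *)
Lemma Cder_along_Zrs : exists l, Cder (along (Zrs r s)) C0 l /\
  RtoC 2 * kappa tau * l = - p' - RtoC 2 * ((p + eta1 tau) * Zr).
Proof.
  exists (s * - p + zt a tau - (C0 * eta1 (tau + C0 * C1) + r * (C1 * eta1t tau)) - (C0 * eta2 (tau + C0 * C1) + s * (C1 * eta2t tau))); split.
  - apply (Cder_minus (fun h => along (fun t => wzeta (alpha r s t) t) h - r * eta1 (tau + h * C1)) (fun h => s * eta2 (tau + h * C1))).
    + apply Cder_minus; [apply Cder_along_Der2, Der2_wzeta; assumption|].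
      exact (Cder_mult _ _ _ _ _ (Cder_const r C0) (Cder_eta1 tau C1 Ht)).
    + exact (Cder_mult _ _ _ _ _ (Cder_const s C0) (Cder_eta2 tau C1 Ht)).
  - assert (W := Wfun_zero tau Ht a Ha); unfold Wfun, xi in W; rewrite (eta_derivatives tau Ht).
    unfold Zr, Zrs; fold a; fold p p' in W |- *.
    assert (Er : r = a - s * tau) by (unfold a, alpha; ring).
    set (y := wzeta a tau) in *; set (x := zt a tau) in *.
    transitivity ((RtoC 2 * kappa tau * (x - eta1t tau * a) + p' + RtoC 2 * ((y - eta1 tau * a) * (p + eta1 tau)))
      - p' - RtoC 2 * ((p + eta1 tau) * (y - r * eta1 tau - s * eta2 tau))); [|rewrite W; ring].
    unfold kappa; rewrite Er; ring.
Qed.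

(** Trading [xi] for [Z] absorbs the terms [2 kappa s] caused by the motion of [a], so [s]
    disappears from the derivatives of [wp] and [wp'] along the path. *)
Lemma xi_Zrs : xi tau a = Zr - kappa tau * s.
Proof. unfold xi, Zr, Zrs, kappa; fold a; replace (eta1 tau * a) with (eta1 tau * (r + s * tau)) by reflexivity; ring. Qed.

Lemma Cder_along_wp : exists l, Cder (along (fun t => wp (alpha r s t) t)) C0 l /\
  RtoC 2 * kappa tau * l = RtoC 2 * (Zr * p') + RtoC 4 * (p * p) - RtoC 4 * (eta1 tau * p) - RtoC 2 / RtoC 3 * g2 tau.
Proof.
  exists (s * p' + wpt a tau); split; [apply Cder_along_Der2, Der2_wp; assumption|].
  transitivity (RtoC 2 * kappa tau * s * p' + RtoC 2 * kappa tau * wpt a tau); [ring|].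
  rewrite (wpt_identity tau Ht a Ha), xi_Zrs; fold p p'; ring.
Qed.

Lemma Cder_along_wp' : exists l, Cder (along (fun t => wp' (alpha r s t) t)) C0 l /\
  RtoC 2 * kappa tau * l = RtoC 2 * (Zr * (RtoC 6 * (p * p) - g2 tau / RtoC 2)) + RtoC 6 * (p * p') - RtoC 6 * (eta1 tau * p').
Proof.
  exists (s * wp2 a tau + wpt' a tau); split; [apply Cder_along_Der2, Der2_wp'; assumption|].
  transitivity (RtoC 2 * kappa tau * s * wp2 a tau + RtoC 2 * kappa tau * wpt' a tau); [ring|].
  rewrite (wpt'_identity tau Ht a Ha), xi_Zrs, (wp2_identity tau Ht a Ha); fold p p'; ring.
Qed.

Lemma along_C0 (f : Cplx -> Cplx) : along f C0 = f tau.
Proof. unfold along; f_equal; ring. Qed.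

(** [Z], [wp] and [wp'] have weights 1, 2, 3 and contribute [- 2 eta1] times their weight; all terms
    of [Z2] have weight 3, so the [eta1] parts assemble into [- 6 eta1 Z2] and vanish with [Z2]. *)
Lemma Cder_along_Z2rs : exists l, Cder (along (Z2rs r s)) C0 l /\
  RtoC 2 * kappa tau * l = - RtoC 3 * numer tau r s - RtoC 6 * ((p + eta1 tau) * Z2rs r s tau).
Proof.
  destruct Cder_along_Zrs as [lz [Dz Ez]]; destruct Cder_along_wp as [lp [Dp Ep]]; destruct Cder_along_wp' as [lq [Dq Eq]].
  eexists; split.
  - apply (Cder_minus (fun h => along (Zrs r s) h * (along (Zrs r s) h * (along (Zrs r s) h * C1))
       - RtoC 3 * along (fun t => wp (alpha r s t) t) h * along (Zrs r s) h) (along (fun t => wp' (alpha r s t) t))).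
    + apply Cder_minus; apply Cder_mult; try exact Dz.
      * apply Cder_mult; [exact Dz|]; apply Cder_mult; [exact Dz | apply Cder_const].
      * apply Cder_mult; [apply Cder_const | exact Dp].
    + exact Dq.
  - rewrite !along_C0; unfold numer, Z2rs; fold a; fold p p'; cbv zeta; fold Zr.
    transitivity (RtoC 3 * (Zr * Zr - p) * (RtoC 2 * kappa tau * lz) - RtoC 3 * Zr * (RtoC 2 * kappa tau * lp) - RtoC 2 * kappa tau * lq);
      [ring | rewrite Ez, Ep, Eq; cfield].
Qed.

Lemma near_along (P : Cplx -> Prop) : near C0 (fun h => P (tau + h * C1)) -> near tau P.
Proof.
  intros [d [Hd H]]; exists d; split; [exact Hd|]; intros w Hw.
  replace w with (tau + (w - tau) * C1) by ring; apply H; replace (w - tau - C0) with (w - tau) by ring; exact Hw.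
Qed.

Lemma Ccont_of_along (f : Cplx -> Cplx) (l : Cplx) : Cder (along f) C0 l -> Ccont f tau.
Proof.
  intros D; apply Cder_cont in D; unfold Ccont in D; rewrite along_C0 in D.
  intros e He; destruct (D e He) as [d [Hd H]]; exists d; split; [exact Hd|]; intros w Hw.
  assert (G := H (w - tau)); unfold along in G; replace (tau + (w - tau) * C1) with w in G by ring.
  apply G; replace (w - tau - C0) with (w - tau) by ring; exact Hw.
Qed.

Lemma Ccont_Zrs : Ccont (Zrs r s) tau.
Proof. destruct Cder_along_Zrs as [l [D _]]; exact (Ccont_of_along _ _ D). Qed.
Lemma Ccont_wp_alpha : Ccont (fun t => wp (alpha r s t) t) tau.
Proof. destruct Cder_along_wp as [l [D _]]; exact (Ccont_of_along _ _ D). Qed.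
Lemma Ccont_wp'_alpha : Ccont (fun t => wp' (alpha r s t) t) tau.
Proof. destruct Cder_along_wp' as [l [D _]]; exact (Ccont_of_along _ _ D). Qed.
Lemma Ccont_Z2rs : Ccont (Z2rs r s) tau.
Proof. destruct Cder_along_Z2rs as [l [D _]]; exact (Ccont_of_along _ _ D). Qed.

Lemma Ccont_g2 : Ccont g2 tau.
Proof. destruct (Cder_g2 tau Ht) as [l D]; exact (Ccont_of_along _ _ D). Qed.

Ltac cont_alpha := unfold Ccont; repeat lim_step ltac:(idtac; lazymatch goal with
  | |- Clim_at (fun t => wp (alpha r s t) t) _ _ => exact Ccont_wp_alpha
  | |- Clim_at (fun t => wp' (alpha r s t) t) _ _ => exact Ccont_wp'_alpha
  | |- Clim_at (fun t => Zrs r s t) _ _ => exact Ccont_Zrs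
  | |- Clim_at (fun t => Z2rs r s t) _ _ => exact Ccont_Z2rs
  | |- Clim_at (fun t => g2 t) _ _ => exact Ccont_g2
  end).

Lemma Ccont_numer : Ccont (fun t => numer t r s) tau.
Proof.
  apply (Clim_at_ext (fun t => RtoC 3 * wp' (alpha r s t) t * (Zrs r s t * Zrs r s t)
    + (RtoC 12 * (wp (alpha r s t) t * wp (alpha r s t) t) - g2 t) * Zrs r s t + RtoC 3 * wp (alpha r s t) t * wp' (alpha r s t) t)).
  - apply near_true; intros t _; unfold numer; simpl; ring.
  - eapply Clim_at_eq; [cont_alpha|]; unfold numer; simpl; ring.
Qed.

Lemma domain_near : near tau (fun t => upper_half t /\ ~ in_lattice (alpha r s t) t).
Proof.
  apply near_along; generalize (notin_path a tau s C1 Ht Ha); apply near_imp; intros h; rewrite alpha_path; tauto.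
Qed.

Lemma wp_p_numer (t : Cplx) : Z2rs r s t <> C0 ->
  wp_p r s t = (RtoC 2 * Z2rs r s t * wp (alpha r s t) t + numer t r s) / (RtoC 2 * Z2rs r s t).
Proof. intros N; unfold wp_p, numer; cbv zeta; cfield. Qed.

Lemma Z2rs_isolated_zero : ~ in_half_Z2 r s -> Z2rs r s tau = C0 ->
  near tau (fun t => t <> tau -> Z2rs r s t <> C0).
Proof.
  intros Hh HZ; destruct Cder_along_Z2rs as [l [D E]].
  assert (Nl : l <> C0).
  { intros El; rewrite HZ, El in E; apply (numer_neq0 tau Ht r s Hh Ha HZ).
    replace (numer tau r s) with (- (- RtoC 3 * numer tau r s - RtoC 6 * ((p + eta1 tau) * C0)) / RtoC 3) by cfield.
    rewrite <- E; cfield. }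
  apply near_along; generalize (Clim_at_neq0 _ _ _ D Nl); apply near_imp; intros h Hh0 N EZ.
  assert (Nh : h <> C0) by (intros Eh; apply N; rewrite Eh; ring).
  specialize (Hh0 Nh); unfold along in Hh0; rewrite EZ in Hh0.
  replace (tau + C0 * C1) with tau in Hh0 by ring; rewrite HZ in Hh0.
  replace ((C0 - C0) / (h - C0)) with C0 in Hh0.
  - rewrite Cabs_C0 in Hh0; generalize (Cabs_ge0 l); lra.
  - replace (h - C0) with h by ring; cfield.
Qed.

End Variation.

(** * Poles at zeros of Z2 *)

Lemma near_pole (D : Cplx -> Prop) (f : Cplx -> Cplx) (tau0 : Cplx) :
  near tau0 (fun t => t <> tau0 -> D t) ->
  (forall M, near tau0 (fun t => t <> tau0 -> D t -> M < Cabs (f t))) -> has_pole_at D f tau0.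
Proof.
  intros [d [Hd H]] HM; split.
  - intros e He; set (m := (Rmin d e / 2)%R).
    assert (Pm : 0 < Rmin d e) by (apply Rmin_pos; [exact Hd | exact He]).
    assert (L1 := Rmin_l d e); assert (L2 := Rmin_r d e).
    assert (E : Cabs (tau0 + RtoC m - tau0) = m).
    { replace (tau0 + RtoC m - tau0) with (RtoC m) by ring; rewrite Cabs_RtoC, Rabs_pos_eq; unfold m; lra. }
    exists (tau0 + RtoC m); rewrite E; split; [|unfold m; lra].
    apply H; [rewrite E; unfold m; lra|]; intros En; rewrite En in E; replace (tau0 - tau0) with C0 in E by ring.
    rewrite Cabs_C0 in E; unfold m in E; lra.
  - intros M; destruct (HM M) as [e [He G]]; exists e; split; [exact He|]; intros t Dt [H1 H2].
    apply G; [exact H2 | | exact Dt]; intros ->; replace (tau0 - tau0) with C0 in H1 by ring; rewrite Cabs_C0 in H1; lra.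
Qed.

Lemma has_pole_at_ext (D D' : Cplx -> Prop) (f f' : Cplx -> Cplx) (tau0 : Cplx) :
  (forall t, D t <-> D' t) -> (forall t, D t -> f t = f' t) -> has_pole_at D f tau0 -> has_pole_at D' f' tau0.
Proof.
  intros HD Hf [H1 H2]; split.
  - intros d Hd; destruct (H1 d Hd) as [t [Dt B]]; exists t; split; [apply HD, Dt | exact B].
  - intros M; destruct (H2 M) as [d [Hd H]]; exists d; split; [exact Hd|]; intros t Dt B.
    apply HD in Dt; rewrite <- Hf by exact Dt; apply H; assumption.
Qed.

Lemma pole_at_Z2_zero (r s tau0 : Cplx) : ~ in_half_Z2 r s -> upper_half tau0 ->
  ~ in_lattice (alpha r s tau0) tau0 -> Z2rs r s tau0 = C0 -> has_pole_at (wp_p_dom r s) (wp_p r s) tau0.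
Proof.
  intros Hh Ht Ha HZ; apply near_pole.
  - generalize (near_and _ _ _ (domain_near r s tau0 Ht Ha) (Z2rs_isolated_zero r s tau0 Ht Ha Hh HZ)).
    apply near_imp; intros t [[H1 H2] H3] N; repeat split; auto.
  - intros M.
    assert (LQ : Clim_at (fun t => RtoC 2 * Z2rs r s t) tau0 C0).
    { eapply Clim_at_eq; [apply Clim_at_mult; [apply Clim_at_const | apply Ccont_Z2rs; assumption] | rewrite HZ; ring]. }
    assert (LP : Clim_at (fun t => RtoC 2 * Z2rs r s t * wp (alpha r s t) t + numer t r s) tau0 (numer tau0 r s)).
    { eapply Clim_at_eq; [apply Clim_at_plus; [apply Clim_at_mult; [exact LQ | apply Ccont_wp_alpha; assumption] | apply Ccont_numer; assumption] | ring]. }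
    generalize (quotient_blowup _ _ _ _ M LP (numer_neq0 tau0 Ht r s Hh Ha HZ) LQ); apply near_imp; intros t H N [_ [_ NZ]].
    rewrite wp_p_numer by exact NZ; apply H; [exact N | apply Cmul_neq0; [apply RtoC_neq0; lra | exact NZ]].
Qed.

(** * Poles where r + s tau vanishes *)

Section LatticePoint.
Variables r s tau0 : Cplx.
Hypothesis Ht : upper_half tau0.
Hypothesis Ha : alpha r s tau0 = C0.
Hypothesis Hs : s <> C0.

Let a (t : Cplx) : Cplx := alpha r s t.
Let S (t : Cplx) : Cplx := remS (a t) t.
Let T (t : Cplx) : Cplx := remT (a t) t.
Let U (t : Cplx) : Cplx := remU (a t) t.
(** [d] is the regular part of [Z = 1 / a + d]; it tends to [s * kappa tau0] because [r = - s tau0]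
    at the point considered. *)
Let c (t : Cplx) : Cplx := - (r * eta1 t) - s * eta2 t.
Let d (t : Cplx) : Cplx := c t + a t * a t * a t * S t.

Lemma rem_along (f : Cplx -> Cplx -> Cplx) (l : Cplx) :
  Cder (fun h => f (C0 + h * s) (tau0 + h * C1)) C0 l -> Ccont (fun t => f (a t) t) tau0.
Proof.
  intros D; apply (Ccont_of_along tau0 (fun t => f (a t) t) l); eapply Cder_ext; [|exact D].
  apply near_true; intros h; unfold along, a; rewrite alpha_path, Ha; reflexivity.
Qed.

Lemma S_cont : Ccont S tau0.
Proof. destruct (fam_ex_Cder _ (fam_remS C0 tau0 s C1 Ht (offlat_0 tau0 Ht))) as [l D]; exact (rem_along remS l D). Qed.
Lemma T_cont : Ccont T tau0.
Proof. destruct (fam_ex_Cder _ (fam_remT C0 tau0 s C1 Ht (offlat_0 tau0 Ht))) as [l D]; exact (rem_along remT l D). Qed.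
Lemma U_cont : Ccont U tau0.
Proof. destruct (fam_ex_Cder _ (fam_remU C0 tau0 s C1 Ht (offlat_0 tau0 Ht))) as [l D]; exact (rem_along remU l D). Qed.

Lemma a_lim : Clim_at a tau0 C0.
Proof.
  apply Clim_at_eq with (r + s * tau0); [|exact Ha].
  apply (Clim_at_plus (fun _ => r) (fun t => s * t)); [apply Clim_at_const|].
  apply (Clim_at_mult (fun _ => s) (fun t => t)); [apply Clim_at_const | apply Clim_at_id].
Qed.

Lemma c_lim : Clim_at c tau0 (s * kappa tau0).
Proof.
  assert (E : r = - (s * tau0)).
  { transitivity (alpha r s tau0 - s * tau0); [unfold alpha; ring | rewrite Ha; ring]. }
  apply Clim_at_eq with (c tau0); [|unfold c, kappa; rewrite E; ring].
  apply (Clim_at_minus (fun t => - (r * eta1 t)) (fun t => s * eta2 t)).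
  - apply (Clim_at_opp (fun t => r * eta1 t)), (Clim_at_mult (fun _ => r) eta1); [apply Clim_at_const|].
    exact (Ccont_of_along tau0 eta1 _ (Cder_eta1 tau0 C1 Ht)).
  - apply (Clim_at_mult (fun _ => s) eta2); [apply Clim_at_const|].
    exact (Ccont_of_along tau0 eta2 _ (Cder_eta2 tau0 C1 Ht)).
Qed.

Ltac lim_lattice := repeat lim_step ltac:(idtac; lazymatch goal with
  | |- Clim_at (fun t => a t) _ _ => exact a_lim
  | |- Clim_at (fun t => c t) _ _ => exact c_lim
  | |- Clim_at (fun t => S t) _ _ => exact S_cont
  | |- Clim_at (fun t => T t) _ _ => exact T_cont
  | |- Clim_at (fun t => U t) _ _ => exact U_cont
  | |- Clim_at (fun t => g2 t) _ _ => exact (Ccont_g2 tau0 Ht)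
  end).

Lemma d_lim : Clim_at d tau0 (s * kappa tau0).
Proof. unfold d; eapply Clim_at_eq; [lim_lattice | ring]. Qed.

(** [Q] is [a * Z2] and [P] is [a^2 (2 Z2 wp + numer)], expanded with all negative powers of [a]
    cancelled, so that their limits follow from continuity of the remainders. *)
Let Q (t : Cplx) : Cplx := RtoC 3 * (d t * d t)
  + a t * (d t * d t * d t - RtoC 3 * (a t * T t) - RtoC 3 * (a t * a t * T t * d t) + RtoC 2 * (a t * U t)).
Let P (t : Cplx) : Cplx :=
  let x := a t in let e := d t in
  RtoC 2 * (e * e * e) + x * (RtoC 2 * (T t * (C1 + RtoC 3 * (e * x) + RtoC 3 * (e * e * (x * x)) + e * e * e * (x * x * x)))
    - RtoC 6 * (U t * (C1 + RtoC 2 * (x * e) + x * x * (e * e))) + RtoC 12 * (T t * (C1 + x * e))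
    + RtoC 6 * (x * x * (x * x) * (T t * T t) * (C1 + x * e)) - RtoC 2 * T t - RtoC 2 * U t
    - RtoC 2 * (x * x * (x * x) * (T t * U t)) - g2 t * (C1 + x * e)).

Lemma Q_lim : Clim_at Q tau0 (RtoC 3 * (s * kappa tau0 * (s * kappa tau0))).
Proof.
  assert (D := d_lim); unfold Q; eapply Clim_at_eq.
  - repeat first [exact D | lim_step ltac:(idtac; lazymatch goal with
      | |- Clim_at (fun t => a t) _ _ => exact a_lim
      | |- Clim_at (fun t => d t) _ _ => exact D
      | |- Clim_at (fun t => T t) _ _ => exact T_cont
      | |- Clim_at (fun t => U t) _ _ => exact U_cont end)].
  - ring.
Qed.

Lemma P_lim : Clim_at P tau0 (RtoC 2 * (s * kappa tau0 * (s * kappa tau0) * (s * kappa tau0))).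
Proof.
  assert (D := d_lim); unfold P; cbv zeta; eapply Clim_at_eq.
  - repeat first [exact D | lim_step ltac:(idtac; lazymatch goal with
      | |- Clim_at (fun t => a t) _ _ => exact a_lim
      | |- Clim_at (fun t => d t) _ _ => exact D
      | |- Clim_at (fun t => T t) _ _ => exact T_cont
      | |- Clim_at (fun t => U t) _ _ => exact U_cont
      | |- Clim_at (fun t => g2 t) _ _ => exact (Ccont_g2 tau0 Ht) end)].
  - ring.
Qed.

Lemma a_neq0 (t : Cplx) : t <> tau0 -> a t <> C0.
Proof.
  intros N E; apply N; unfold a in E.
  assert (E2 : s * (t - tau0) = C0) by (transitivity (alpha r s t - alpha r s tau0); [unfold alpha; ring | rewrite E, Ha; ring]).
  apply Cmul_eq0 in E2 as [E2|E2]; [contradiction | apply Csub_eq0, E2].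
Qed.

Lemma expansions (t : Cplx) : upper_half t -> offlat (a t) t -> a t <> C0 ->
  a t * Z2rs r s t = Q t /\
  a t * a t * (RtoC 2 * Z2rs r s t * wp (a t) t + numer t r s) = P t.
Proof.
  intros Hu Ho Na.
  assert (EZ : Zrs r s t = C1 / a t + d t).
  { unfold Zrs; fold (a t); rewrite wzeta_expand by assumption; unfold d, c, S; simpl; cfield. }
  unfold numer, Z2rs; cbv zeta; fold (a t); rewrite EZ, wp_expand, wp'_expand by assumption.
  fold (T t) (U t); unfold P, Q; cbv zeta; split; simpl; cfield.
Qed.

Lemma pole_at_zero : has_pole_at (wp_p_dom r s) (wp_p r s) tau0.
Proof.
  assert (K : s * kappa tau0 <> C0) by (apply Cmul_neq0; [exact Hs | apply kappa_neq0, Ht]).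
  assert (Near : near tau0 (fun t => upper_half t /\ offlat (a t) t)).
  { apply near_along; generalize (path_good C0 tau0 s C1 Ht (offlat_0 tau0 Ht)); apply near_imp; intros h.
    unfold a; rewrite alpha_path, Ha; tauto. }
  assert (NQ : near tau0 (fun t => t <> tau0 -> Z2rs r s t <> C0)).
  { assert (K3 : RtoC 3 * (s * kappa tau0 * (s * kappa tau0)) <> C0)
      by (apply Cmul_neq0; [apply RtoC_neq0; lra | apply Cmul_neq0; exact K]).
    generalize (near_and _ _ _ Near (Clim_at_neq0 _ _ _ Q_lim K3)); apply near_imp; intros t [[H1 H2] H3] N E.
    destruct (expansions t H1 H2 (a_neq0 t N)) as [EQ _]; specialize (H3 N); rewrite <- EQ, E in H3.
    replace (a t * C0) with C0 in H3 by ring; rewrite Cabs_C0 in H3.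
    generalize (Cabs_ge0 (RtoC 3 * (s * kappa tau0 * (s * kappa tau0)))); lra. }
  apply near_pole.
  - generalize (near_and _ _ _ Near NQ); apply near_imp; intros t [[H1 H2] H3] N; repeat split; auto.
    apply offlat_notin; [exact H2 | apply a_neq0, N].
  - intros M.
    (* After multiplication by [a^2], the quotient defining [wp_p] becomes [P / (2 a Q)]. *)
    assert (LQ : Clim_at (fun t => RtoC 2 * (a t * Q t)) tau0 C0).
    { eapply Clim_at_eq; [apply (Clim_at_mult (fun _ => RtoC 2) (fun t => a t * Q t)); [apply Clim_at_const | apply (Clim_at_mult a Q); [exact a_lim | exact Q_lim]] | ring]. }
    assert (K2 : RtoC 2 * (s * kappa tau0 * (s * kappa tau0) * (s * kappa tau0)) <> C0)
      by (apply Cmul_neq0; [apply RtoC_neq0; lra | apply Cmul_neq0; [apply Cmul_neq0; exact K | exact K]]).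
    generalize (near_and _ _ _ Near (quotient_blowup _ _ _ _ M P_lim K2 LQ)); apply near_imp; intros t [[H1 H2] H3] N [_ [_ NZ]].
    assert (Na := a_neq0 t N); destruct (expansions t H1 H2 Na) as [EQ EP].
    rewrite <- EQ, <- EP in H3.
    rewrite wp_p_numer by exact NZ; fold (a t).
    replace ((RtoC 2 * Z2rs r s t * wp (a t) t + numer t r s) / (RtoC 2 * Z2rs r s t)) with
      (a t * a t * (RtoC 2 * Z2rs r s t * wp (a t) t + numer t r s) / (RtoC 2 * (a t * (a t * Z2rs r s t)))) by cfield.
    apply H3; [exact N|]; repeat apply Cmul_neq0; try assumption; apply RtoC_neq0; lra.
Qed.
End LatticePoint.

(** * Translation of (r, s) by integers *)

Section Shift.
Variables r s : Cplx.
Variables m n : Z.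
Let r' := r - ZtoC m.
Let s' := s - ZtoC n.

Lemma alpha_shift (t : Cplx) : alpha r s t = alpha r' s' t + lat t m n.
Proof. unfold alpha, lat, r', s'; ring. Qed.

(** The increment [m eta1 + n eta2] of zeta is exactly what the linear terms of [Z] subtract. *)
Lemma Zrs_shift (t : Cplx) : upper_half t -> ~ in_lattice (alpha r' s' t) t -> Zrs r s t = Zrs r' s' t.
Proof. intros Hu Hn; unfold Zrs; rewrite alpha_shift, wzeta_lat by assumption; unfold r', s'; ring. Qed.

Lemma Z2rs_shift (t : Cplx) : upper_half t -> ~ in_lattice (alpha r' s' t) t -> Z2rs r s t = Z2rs r' s' t.
Proof.
  intros Hu Hn; unfold Z2rs; cbv zeta; rewrite Zrs_shift, alpha_shift, wp_lat, wp'_lat by assumption; reflexivity.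
Qed.

Lemma wp_p_shift (t : Cplx) : upper_half t -> ~ in_lattice (alpha r' s' t) t -> wp_p r s t = wp_p r' s' t.
Proof.
  intros Hu Hn; unfold wp_p; cbv zeta; rewrite Z2rs_shift, Zrs_shift, alpha_shift, wp_lat, wp'_lat by assumption; reflexivity.
Qed.

Lemma wp_p_dom_shift (t : Cplx) : wp_p_dom r' s' t <-> wp_p_dom r s t.
Proof.
  unfold wp_p_dom; rewrite alpha_shift, in_lattice_shift; split; intros [H1 [H2 H3]]; repeat split; try assumption.
  - rewrite Z2rs_shift; assumption.
  - rewrite <- Z2rs_shift; assumption.
Qed.
End Shift.

Lemma pole_at_lattice_point (r s tau0 : Cplx) : ~ in_half_Z2 r s -> upper_half tau0 ->
  in_lattice (alpha r s tau0) tau0 -> has_pole_at (wp_p_dom r s) (wp_p r s) tau0.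
Proof.
  intros Hh Ht [m [n E]].
  assert (Ha : alpha (r - ZtoC m) (s - ZtoC n) tau0 = C0).
  { transitivity (alpha r s tau0 - lat tau0 m n); [unfold alpha, lat; ring | rewrite E; ring]. }
  apply (has_pole_at_ext (wp_p_dom (r - ZtoC m) (s - ZtoC n)) _ (wp_p (r - ZtoC m) (s - ZtoC n))).
  - apply wp_p_dom_shift.
  - intros t [H1 [H2 _]]; symmetry; apply wp_p_shift; assumption.
  (* A zero slope together with [alpha = 0] would make [r] and [s] integers, that is half-integers
     with the even numerators [2 m] and [2 n]. *)
  - apply pole_at_zero; try assumption; intros Es.
    assert (Er : r - ZtoC m = C0).
    { transitivity (alpha (r - ZtoC m) (s - ZtoC n) tau0 - (s - ZtoC n) * tau0); [unfold alpha; ring | rewrite Ha, Es; ring]. }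
    apply Hh; exists (2 * m)%Z, (2 * n)%Z; apply Csub_eq0 in Es; apply Csub_eq0 in Er; rewrite Es, Er.
    unfold ZtoC; rewrite !mult_IZR; split; f_equal; field.
Qed.

(** The formula has a finite limit at [tau0]; accumulation of the domain supplies a point where this
    limit and the growth of a pole conflict. *)
Lemma no_pole_elsewhere (r s tau0 : Cplx) : upper_half tau0 ->
  ~ in_lattice (alpha r s tau0) tau0 -> Z2rs r s tau0 <> C0 -> ~ has_pole_at (wp_p_dom r s) (wp_p r s) tau0.
Proof.
  intros Ht Ha HZ [Acc Big].
  assert (L : Clim_at (fun t => (RtoC 2 * Z2rs r s t * wp (alpha r s t) t + numer t r s) * (C1 / (RtoC 2 * Z2rs r s t))) tau0
    ((RtoC 2 * Z2rs r s tau0 * wp (alpha r s tau0) tau0 + numer tau0 r s) * (C1 / (RtoC 2 * Z2rs r s tau0)))).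
  { assert (L2 : Clim_at (fun t => RtoC 2 * Z2rs r s t) tau0 (RtoC 2 * Z2rs r s tau0))
      by (apply Clim_at_mult; [apply Clim_at_const | apply Ccont_Z2rs; assumption]).
    apply Clim_at_mult; [|apply Clim_at_inv; [exact L2 | apply Cmul_neq0; [apply RtoC_neq0; lra | exact HZ]]].
    apply Clim_at_plus; [apply Clim_at_mult; [exact L2 | apply Ccont_wp_alpha; assumption] | apply Ccont_numer; assumption]. }
  set (v := (RtoC 2 * Z2rs r s tau0 * wp (alpha r s tau0) tau0 + numer tau0 r s) * (C1 / (RtoC 2 * Z2rs r s tau0))) in *.
  destruct (L 1%R Rlt_0_1) as [d [Hd H]]; destruct (Big (Cabs v + 1)%R) as [e [He G]].
  destruct (Acc (Rmin d e)) as [t [Dt [B1 B2]]]; [apply Rmin_pos; assumption|].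
  specialize (H t ltac:(split; [exact B1 | exact (lt_Rmin_l _ _ _ B2)])).
  specialize (G t Dt ltac:(split; [exact B1 | exact (lt_Rmin_r _ _ _ B2)])).
  assert (NZ : Z2rs r s t <> C0) by apply Dt.
  rewrite wp_p_numer in G by exact NZ.
  replace ((RtoC 2 * Z2rs r s t * wp (alpha r s t) t + numer t r s) / (RtoC 2 * Z2rs r s t)) with
    ((RtoC 2 * Z2rs r s t * wp (alpha r s t) t + numer t r s) * (C1 / (RtoC 2 * Z2rs r s t))) in G by cfield.
  match type of G with _ < Cabs ?x => generalize (Cabs_sub_ge x v) end; lra.
Qed.

Theorem theorem2p1 (r s tau0 : Cplx) :
  ~ in_half_Z2 r s ->
  upper_half tau0 ->
  (has_pole_at (wp_p_dom r s) (wp_p r s) tau0 <->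
   (in_lattice (alpha r s tau0) tau0 \/
    (~ in_lattice (alpha r s tau0) tau0 /\ Z2rs r s tau0 = C0))).
Proof.
  intros Hh Ht; split.
  - intros HP; destruct (classic (in_lattice (alpha r s tau0) tau0)) as [Ha|Ha]; [left; exact Ha | right; split; [exact Ha|]].
    apply NNPP; intros HZ; exact (no_pole_elsewhere r s tau0 Ht Ha HZ HP).
  - intros [Ha|[Ha HZ]]; [apply pole_at_lattice_point | apply pole_at_Z2_zero]; assumption.
Qed.
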